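(* Let $\Lambda$ be a topologically transitive locally maximal hyperbolic set for a $C^{1+\alpha}$ diffeomorphism $f$, and let $\varphi\colon\Lambda\to\mathbb{R}$ be Hölder continuous. Fix $r$ with $0<r<\tau/3$ and, for each $x\in\Lambda$, let $m_x^{\mathcal C}$ be the reference measure on $V^u_{\mathrm{loc}}(x)\cap\Lambda$ associated to $\mathcal C=(\varphi,r)$ (defined in the context). Then for every $x\in\Lambda$ we have $f^*m_{f(x)}^{\mathcal C}:=m_{f(x)}^{\mathcal C}\circ f\ll m_x^{\mathcal C}$ with Radon–Nikodym derivative $e^{P(\varphi)-\varphi}$; that is, for every Borel set $A\subset V^u_{\mathrm{loc}}(f(x))\cap\Lambda$, $$m_{f(x)}^{\mathcal C}(A)=\int_{f^{-1}A}e^{P(\varphi)-\varphi(y)}\,dm_x^{\mathcal C}(y).$$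
   Context: Setting. $M$ is a smooth Riemannian manifold with distance $d$ and $f\colon M\to M$ is a $C^{1+\alpha}$ diffeomorphism. A hyperbolic set is a compact $\Lambda=f(\Lambda)\subset M$ with a $Df$-invariant splitting $T_xM=E^s(x)\oplus E^u(x)$, $x\in\Lambda$, and constants $C\ge1$, $0<\chi<1$ with $\|Df^nv\|\le C\chi^n\|v\|$ for $v\in E^s$ and $\|Df^{-n}v\|\le C\chi^n\|v\|$ for $v\in E^u$, $n\ge0$; the metric is chosen adapted so that $C=1$. $\Lambda$ is locally maximal if $\Lambda=\bigcap_{n\in\mathbb Z}f^n(U)$ for some open $U\supset\Lambda$. Local manifolds. A sufficiently small size $\tau>0$ is fixed, and $V^{s}_{\mathrm{loc}}(x),V^{u}_{\mathrm{loc}}(x)$, $x\in\Lambda$, denote the local stable/unstable manifolds of size $\tau$: images under $\exp_x$ of graphs of $C^{1+\alpha}$ functions $B^{s,u}_x(0,\tau)\to E^{u,s}(x)$ defined on the ball of radius $\tau$ in $E^{s,u}(x)$, containing $x$, tangent to $E^{s,u}(x)$ at $x$, with $f(V^u_{\mathrm{loc}}(x))\supset V^u_{\mathrm{loc}}(f(x))$, $f(V^s_{\mathrm{loc}}(x))\subset V^s_{\mathrm{loc}}(f(x))$, and for some $\lambda\in(\chi,1)$, $d(f(y),f(z))\le\lambda d(y,z)$ on $V^s_{\mathrm{loc}}(x)$ and $d(f^{-1}(y),f^{-1}(z))\le\lambda d(y,z)$ on $V^u_{\mathrm{loc}}(x)$. Pressure. $S_n\varphi(x)=\sum_{k=0}^{n-1}\varphi(f^kx)$;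 $d_n(x,y)=\max_{0\le k<n}d(f^kx,f^ky)$; $B_n(x,\delta)=\{y:d_n(x,y)<\delta\}$. The topological pressure is $P(\varphi)=\lim_{\delta\to0}\varlimsup_{n\to\infty}\frac1n\log Z_n^{\mathrm{span}}(\Lambda,\varphi,\delta)$, where $Z_n^{\mathrm{span}}(\Lambda,\varphi,\delta)=\inf\{\sum_{x\in E}e^{S_n\varphi(x)}:E\subset\Lambda,\ \Lambda\subset\bigcup_{x\in E}B_n(x,\delta)\}$. Reference measures. For $x\in\Lambda$ put $W=V^u_{\mathrm{loc}}(x)$, $X=W\cap\Lambda$. For $Z\subset X$, $$m_x^{\mathcal C}(Z)=\lim_{N\to\infty}\inf\sum_i e^{-n_iP(\varphi)}e^{S_{n_i}\varphi(x_i)},$$ the infimum being over all finite or countable collections of $u$-Bowen balls $\{B_{n_i}(x_i,r)\cap W\}$ with $x_i\in X$, $n_i\ge N$, which cover $Z$. This is an outer measure that restricts to a Borel measure on $X$. The measure $m_{f(x)}^{\mathcal C}\circ f$ is considered on $f^{-1}(V^u_{\mathrm{loc}}(f(x))\cap\Lambda)\subset V^u_{\mathrm{loc}}(x)\cap\Lambda$. *)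

(* Defs.v *)
From HB Require Import structures.
From mathcomp Require Import all_boot all_order all_algebra.
From mathcomp Require Import all_classical all_reals all_analysis.

Set Implicit Arguments.
Unset Strict Implicit.
Unset Printing Implicit Defensive.

Import Order.TTheory GRing.Theory Num.Theory numFieldNormedType.Exports.

Local Open Scope classical_set_scope.
Local Open Scope ring_scope.

(* Class C^k on an open set [U] of a finite-dimensional space. *)
Fixpoint Ck_on (R : realType) (V W : normedModType R) (k : nat)
    (U : set V) (F : V -> W) : Prop :=
  if k is k'.+1 then
    (forall u, U u -> differentiable F u) /\
    (forall v, Ck_on k' U (fun u => 'D_v F u))
  else forall u, U u -> {for u, continuous F}.

(* [cmap] and [cinv] are total functions, meaningful on [cdom] and on its
   image [ccod] only. *)
Record chart (R : realType) (n : nat) (M : topologicalType) := Chart {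
  cdom : set M;
  cmap : M -> 'rV[R]_n;
  cinv : 'rV[R]_n -> M }.

Definition ccod (R : realType) (n : nat) (M : topologicalType)
  (c : chart R n M) : set 'rV[R]_n := cmap c @` cdom c.

Definition is_chart (R : realType) (n : nat) (M : topologicalType)
    (c : chart R n M) : Prop :=
  [/\ open (cdom c), open (ccod c),
      forall x, cdom c x -> cinv c (cmap c x) = x,
      forall x, cdom c x -> {for x, continuous (cmap c)} &
      forall u, ccod c u -> {for u, continuous (cinv c)}].

(* A smooth structure is given by an atlas indexed by the points, [rchart p]
   being a chart around [p]; every smooth atlas can be presented so, up to
   equivalence.  The tangent space at [p] is identified with ['rV[R]_n] through
   the chart [rchart p].  The metric is given by its Gram matrices: [gram p u]
   is the matrix of the metric at the point of coordinates [u], in the chart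
   [rchart p]; [gram_compat] says that these local expressions agree. *)
Record riemannian (R : realType) (n : nat) (M : topologicalType) := Riemannian {
  rchart : M -> chart R n M;
  gram : M -> 'rV[R]_n -> 'M[R]_n;
  rhausdorff : hausdorff_space M;
  rsecond_countable : @second_countable M;
  rchart_is_chart : forall p, is_chart (rchart p);
  rchart_mem : forall p, cdom (rchart p) p;
  rchart_smooth : forall p q k,
    Ck_on k (cmap (rchart p) @` (cdom (rchart p) `&` cdom (rchart q)))
          (cmap (rchart q) \o cinv (rchart p));
  gram_smooth : forall p k, Ck_on k (ccod (rchart p)) (gram p);
  gram_sym : forall p u, ccod (rchart p) u -> (gram p u)^T = gram p u;
  gram_pos : forall p u (v : 'rV[R]_n), ccod (rchart p) u -> v != 0 ->
    0 < (v *m gram p u *m v^T) 0 0;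
  gram_compat : forall p q x, cdom (rchart p) x -> cdom (rchart q) x ->
    let T : 'rV[R]_n -> 'rV[R]_n :=
      'd (cmap (rchart q) \o cinv (rchart p)) (cmap (rchart p) x) in
    forall v w, v *m gram p (cmap (rchart p) x) *m w^T =
                T v *m gram q (cmap (rchart q) x) *m (T w)^T }.

Section Geometry.
Context (R : realType) (n : nat) (M : topologicalType) (X : riemannian R n M).

Definition coord (p : M) : M -> 'rV[R]_n := cmap (rchart X p).

Definition in_coord (f : M -> M) (x : M) : 'rV[R]_n -> 'rV[R]_n :=
  coord (f x) \o f \o cinv (rchart X x).

Definition tangent_map (f : M -> M) (x : M) (v : 'rV[R]_n) : 'rV[R]_n :=
  'd (in_coord f x) (coord x x) v.

Definition gnorm (x : M) (v : 'rV[R]_n) : R :=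
  Num.sqrt ((v *m gram X x (coord x x) *m v^T) 0 0).

Definition velocity (c : R -> M) (t : R) : 'rV[R]_n := derive1 (coord (c t) \o c) t.

Definition C1_curve_at (c : R -> M) (t : R) : Prop :=
  \forall s \near t, [/\ {for s, continuous c},
    derivable (coord (c t) \o c) s 1 &
    {for s, continuous (derive1 (coord (c t) \o c))}].

(* A C^1 curve on [0, 1] extends to a C^1 curve around [0, 1], so that
   two-sided derivatives can be used. *)
Definition C1_path (x y : M) : set (R -> M) :=
  [set c | [/\ c 0 = x, c 1 = y & forall t : R, 0 <= t <= 1 -> C1_curve_at c t]].

Definition path_length (c : R -> M) : \bar R :=
  (\int[lebesgue_measure]_(t in `[0%R, 1%R]) (gnorm (c t) (velocity c t))%:E)%E.

(* Piecewise C^1 curves give the same infimum: reparametrise so that the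
   velocity vanishes at the corners.  [M] need not be connected: the distance
   between two components is [+oo]. *)
Definition rdist (x y : M) : \bar R :=
  ereal_inf [set path_length c | c in C1_path x y].

Definition partial (W : normedModType R) (F : 'rV[R]_n -> W) (i : 'I_n) :=
  fun u => 'D_(delta_mx 0 i) F u.

Definition christoffel (p : M) (u : 'rV[R]_n) (k i j : 'I_n) : R :=
  2^-1 * \sum_(l < n) invmx (gram X p u) k l *
    (partial (gram X p) i u j l + partial (gram X p) j u i l
     - partial (gram X p) l u i j).

Definition geodesic_at (c : R -> M) (t : R) : Prop :=
  let g := coord (c t) \o c in
  [/\ {for t, continuous c},
      \forall s \near t, derivable g s 1,
      derivable (derive1 g) t 1 &
      forall k : 'I_n, derive1 (derive1 g) t 0 k +
        \sum_(i < n) \sum_(j < n)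
          christoffel (c t) (g t) k i j * derive1 g t 0 i * derive1 g t 0 j = 0].

(* [is_exp x v y] is exp_x(v) = y; exp_x is only partially defined if the
   metric is not complete. *)
Definition is_exp (x : M) (v : 'rV[R]_n) (y : M) : Prop :=
  exists c : R -> M,
    [/\ forall t : R, 0 <= t <= 1 -> \forall s \near t, geodesic_at c s,
        c 0 = x, velocity c 0 = v & c 1 = y].

Definition C1holder_map (alpha : R) (f : M -> M) : Prop :=
  continuous f /\
  forall x, exists U K, open_nbhs (coord x x) U /\
    (forall u, U u -> differentiable (in_coord f x) u) /\
    (forall u v w, U u -> U v ->
      `|'d (in_coord f x) u w - 'd (in_coord f x) v w|
        <= K * `|u - v| `^ alpha * `|w|).

Definition C1holder_diffeo (alpha : R) (f finv : M -> M) : Prop :=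
  [/\ cancel f finv, cancel finv f, C1holder_map alpha f &
      C1holder_map alpha finv].

(* The splitting is encoded by matrices: [Es x] and [Eu x] stand for their
   row spaces. *)
Definition hyperbolic_set (f finv : M -> M) (Lambda : set M)
    (Es Eu : M -> 'M[R]_n) (C chi : R) : Prop :=
  [/\ compact Lambda /\ f @` Lambda = Lambda,
      1 <= C /\ 0 < chi < 1,
      forall x, Lambda x -> row_full (Es x + Eu x)%MS /\ mxdirect (Es x + Eu x),
      forall x v, Lambda x ->
        ((v <= Es x)%MS = (tangent_map f x v <= Es (f x))%MS) /\
        ((v <= Eu x)%MS = (tangent_map f x v <= Eu (f x))%MS) &
      forall x v k, Lambda x ->
        ((v <= Es x)%MS ->
          gnorm (iter k f x) (tangent_map (iter k f) x v)
            <= C * chi ^+ k * gnorm x v) /\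
        ((v <= Eu x)%MS ->
          gnorm (iter k finv x) (tangent_map (iter k finv) x v)
            <= C * chi ^+ k * gnorm x v)].

Definition locally_maximal (f finv : M -> M) (Lambda : set M) : Prop :=
  exists U : set M, [/\ open U, Lambda `<=` U &
    Lambda = \bigcap_k ((iter k f @` U) `&` (iter k finv @` U))].

Definition topologically_transitive (f : M -> M) (Lambda : set M) : Prop :=
  forall U V : set M, open U -> open V ->
    Lambda `&` U !=set0 -> Lambda `&` V !=set0 ->
    exists k, (iter k f @` (Lambda `&` U)) `&` V !=set0.

(* [V] is the image under exp_x of the graph of a C^{1+alpha} function [psi]
   from the ball of radius [tau] of [E] to [F], with psi(0) = 0 and
   Dpsi(0) = 0.  The subspace [E] is parametrised by the coordinates [a] in the
   basis [row_base E]; [L] is a Hoelder constant of Dpsi for the metric at [x],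
   meant to be uniform in [x] and independent of [tau], so that the graph is
   within the injectivity radius once [tau] is small. *)
Definition local_graph (alpha tau L : R) (E F : 'M[R]_n) (x : M)
    (V : set M) : Prop :=
  let b := row_base E in
  let D := [set a : 'rV[R]_(\rank E) | gnorm x (a *m b) < tau] in
  exists psi : 'rV[R]_(\rank E) -> 'rV[R]_n,
    [/\ forall a, D a -> (psi a <= F)%MS,
        forall a, D a -> differentiable psi a,
        forall a a' w, D a -> D a' ->
          gnorm x ('d psi a w - 'd psi a' w)
            <= L * gnorm x ((a - a') *m b) `^ alpha * gnorm x (w *m b),
        psi 0 = 0 /\ (forall w, 'd psi 0 w = 0) &
        V = [set y | exists2 a, D a & is_exp x (a *m b + psi a) y]].

Definition local_manifolds (f finv : M -> M) (Lambda : set M)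
    (Es Eu : M -> 'M[R]_n) (alpha tau L lambda : R) (Vs Vu : M -> set M) : Prop :=
  forall x, Lambda x ->
  [/\ local_graph alpha tau L (Es x) (Eu x) x (Vs x) /\
      local_graph alpha tau L (Eu x) (Es x) x (Vu x),
      f @` Vs x `<=` Vs (f x),
      Vu (f x) `<=` f @` Vu x,
      forall y z, Vs x y -> Vs x z ->
        (rdist (f y) (f z) <= lambda%:E * rdist y z)%E &
      forall y z, Vu x y -> Vu x z ->
        (rdist (finv y) (finv z) <= lambda%:E * rdist y z)%E].

Definition holder_on (Lambda : set M) (phi : M -> R) : Prop :=
  exists K beta : R, [/\ 0 < K, 0 < beta &
    forall x y, Lambda x -> Lambda y ->
      (`|phi x - phi y|%:E <= K%:E * rdist x y `^ beta)%E].

Definition birkhoff_sum (f : M -> M) (phi : M -> R) (k : nat) (x : M) : R :=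
  \sum_(i < k) phi (iter i f x).

Definition bowen_dist (f : M -> M) (k : nat) (x y : M) : \bar R :=
  \big[maxe/0%E]_(i < k) rdist (iter i f x) (iter i f y).

Definition bowen_ball (f : M -> M) (k : nat) (x : M) (delta : R) : set M :=
  [set y | (bowen_dist f k x y < delta%:E)%E].

Definition Zspan (f : M -> M) (Lambda : set M) (phi : M -> R) (k : nat)
    (delta : R) : \bar R :=
  ereal_inf [set (\esum_(x in E) (expR (birkhoff_sum f phi k x))%:E)%E
            | E in [set E : set M | E `<=` Lambda /\
                Lambda `<=` \bigcup_(x in E) bowen_ball f k x delta]].

Definition pressure (f : M -> M) (Lambda : set M) (phi : M -> R) : \bar R :=
  lim ((fun delta : R =>
    limn_esup (fun k => (k%:R^-1)%:E * lne (Zspan f Lambda phi k delta))%E)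
  @ 0^'+).

End Geometry.

Section ReferenceMeasure.
Context (R : realType) (n : nat) (M : ptopologicalType) (X : riemannian R n M).
Context (f : M -> M) (Lambda : set M) (phi : M -> R) (r : R) (W : set M).
Local Open Scope ereal_scope.

(* A pair [(x, k)] stands for the u-Bowen ball B_k(x, r) `&` W. *)
Definition ubowen_covers (N : nat) (Z : set M) : set (set (M * nat)) :=
  [set C | [/\ countable C,
    forall p, C p -> (W `&` Lambda) p.1 /\ (N <= p.2)%N &
    Z `<=` \bigcup_(p in C) (bowen_ball X f p.2 p.1 r `&` W)]].

Definition ubowen_weight (p : M * nat) : \bar R :=
  (expR (- (p.2%:R * fine (pressure X f Lambda phi)))
   * expR (birkhoff_sum f phi p.2 p.1))%:E.

Definition ubowen_inf (N : nat) (Z : set M) : \bar R :=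
  ereal_inf [set \esum_(p in C) ubowen_weight p | C in ubowen_covers N Z].

(* Extended by 0 outside W `&` Lambda, so as to have an outer measure on M. *)
Definition ref_outer (Z : set M) : \bar R :=
  limn (fun N => ubowen_inf N (Z `&` (W `&` Lambda))).

Lemma ubowen_weight_ge0 p : 0 <= ubowen_weight p.
Proof. by rewrite lee_fin mulr_ge0// expR_ge0. Qed.

Lemma ubowen_inf_ge0 N Z : 0 <= ubowen_inf N Z.
Proof.
apply: le_ereal_inf_tmp => _ [C _ <-]; apply: esum_ge0 => p _.
exact: ubowen_weight_ge0.
Qed.

Lemma ubowen_inf0 N : ubowen_inf N set0 = 0.
Proof.
apply/eqP; rewrite eq_le ubowen_inf_ge0 andbT; apply: ereal_inf_lbound.
by exists set0; [split => //; exact: countable0|rewrite esum_set0].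
Qed.

Lemma le_ubowen_inf N Z Z' : Z `<=` Z' -> ubowen_inf N Z <= ubowen_inf N Z'.
Proof.
move=> ZZ'; apply: ereal_inf_le_tmp => _ [C [cC CN CZ] <-].
by exists C => //; split => //; exact: subset_trans CZ.
Qed.

Lemma nd_ubowen_inf Z : nondecreasing_seq (ubowen_inf ^~ Z).
Proof.
move=> N N' NN'; apply: ereal_inf_le_tmp => _ [C [cC CN CZ] <-].
exists C => //; split => // p /CN[? N'p]; split => //.
exact: leq_trans N'p.
Qed.

Lemma esum_bigcup_le (C : nat -> set (M * nat)) :
  \esum_(p in \bigcup_k C k) ubowen_weight p
    <= \sum_(k <oo) \esum_(p in C k) ubowen_weight p.
Proof.
have w0 := ubowen_weight_ge0.
rewrite seqDU_bigcup_eq (@esum_bigcupT _ _ setT _ _ (@trivIset_seqDU _ C) w0).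
rewrite nneseries_esumT; last by move=> k; exact: esum_ge0.
apply: le_esum => k _; rewrite esum_mkcond [leRHS]esum_mkcond.
apply: le_esum => p _; case: ifPn => [|_]; last by case: ifPn.
by move=> /set_mem/(@subset_seqDU _ C k) pC; rewrite ifT//; exact/mem_set.
Qed.

Lemma ubowen_inf_sigma_subadditive N : sigma_subadditive (ubowen_inf N).
Proof.
move=> A; have [[i ioo]|] := pselect (exists i, ubowen_inf N (A i) = +oo).
  rewrite (eseries_pinfty _ _ ioo) ?leey// => k _.
  by rewrite -ltNye (lt_le_trans _ (ubowen_inf_ge0 _ _)).
rewrite -forallNE => Aoo.
apply/lee_addgt0Pr => e e0.
apply: le_trans (epsilon_trick _ _ (ltW e0)); last first.
  by move=> k; exact: ubowen_inf_ge0.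
have H k : exists C, ubowen_covers N (A k) C /\
    \esum_(p in C) ubowen_weight p <= ubowen_inf N (A k) + (e / (2 ^ k.+1)%:R)%:E.
  have ek : (0 < e / (2 ^ k.+1)%:R)%R by rewrite divr_gt0// ltr0n expn_gt0.
  have : ubowen_inf N (A k) \is a fin_num.
    by rewrite ge0_fin_numE ?ubowen_inf_ge0// ltey; apply/eqP/Aoo.
  move=> /(lb_ereal_inf_adherent ek)[_ [C CA <-]] /ltW ?.
  by exists C.
have [C CP] := choice H.
apply: le_trans (lee_nneseries _ (fun k _ => (CP k).2)); last first.
  by move=> k _ _; apply: esum_ge0 => p _; exact: ubowen_weight_ge0.
apply: le_trans (esum_bigcup_le C); apply: ereal_inf_lbound.
exists (\bigcup_k C k) => //; split.
- by apply: bigcup_countable => // k _; have [[]] := CP k.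
- by move=> p [k _ Cp]; have [[_ + _] _] := CP k; exact.
- move=> z [k _ Az]; have [[_ _ /(_ _ Az)[p Cp ?]] _] := CP k.
  by exists p => //; exists k.
Qed.

Lemma ref_outerE Z :
  ref_outer Z = ereal_sup (range (fun N => ubowen_inf N (Z `&` (W `&` Lambda)))).
Proof.
by apply/cvg_lim => //; exact/ereal_nondecreasing_cvgn/nd_ubowen_inf.
Qed.

Lemma ref_outer0 : ref_outer set0 = 0.
Proof.
apply: lim_near_cst => //; apply: nearW => N.
by rewrite set0I ubowen_inf0.
Qed.

Lemma ref_outer_ge0 Z : 0 <= ref_outer Z.
Proof.
rewrite ref_outerE; apply: le_trans (ubowen_inf_ge0 0 _) (ereal_sup_ubound _).
by exists 0%N.
Qed.

Lemma le_ref_outer : {homo ref_outer : A B / A `<=` B >-> A <= B}.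
Proof.
move=> A B AB; rewrite !ref_outerE; apply: ge_ereal_sup => _ [N _ <-].
apply: le_trans (ereal_sup_ubound _); last by exists N.
by apply: le_ubowen_inf; exact: setSI.
Qed.

Lemma ref_outer_sigma_subadditive : sigma_subadditive ref_outer.
Proof.
move=> A; rewrite ref_outerE; apply: ge_ereal_sup => _ [N _ <-].
rewrite setI_bigcupl; apply: le_trans (ubowen_inf_sigma_subadditive _ _) _.
apply: lee_nneseries => k _; first by move=> _; exact: ubowen_inf_ge0.
by rewrite ref_outerE; apply: ereal_sup_ubound; exists N.
Qed.

HB.instance Definition _ := isOuterMeasure.Build R M ref_outer
  ref_outer0 ref_outer_ge0 le_ref_outer ref_outer_sigma_subadditive.

Definition ref_outer_measure : {outer_measure set M -> \bar R} := ref_outer.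

(* The sigma-algebra is the one of Caratheodory; it contains the Borel sets
   when the outer measure restricts to a Borel measure, and enlarging the
   sigma-algebra does not change the integrals of nonnegative Borel functions. *)
Definition ref_measure :
    {measure set (caratheodory_type ref_outer_measure) -> \bar R} :=
  (ref_outer_measure : set (caratheodory_type ref_outer_measure) -> \bar R).

End ReferenceMeasure.

Definition borel (M : topologicalType) (A : set M) : Prop := <<s @open M >> A.

(* Main.v *)
(* The value of the pressure plays no role.

   If [y], [z] in [V^u(x)] and [Lambda] are [r]-close for [d_k] with [k] large, then
   they are close, uniformly: their orbits stay close in the future, and in the
   past since [f^-1] contracts [V^u(x)], so that in the limit [k -> oo] they
   coincide by expansivity.  Thus Bowen balls of large order have small traces on
   [V^u(x)], and the outer measure is additive on sets that are apart; by
   Caratheodory's criterion the Borel sets are measurable.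

   The image of the Bowen ball [B_k(y, r)] under [f] is contained in
   [B_(k-1)(f y, r)], and the weight of the latter is [e^(P - phi y)] times the
   weight of the former; conversely for [f^-1], by contraction.  Hence, near a
   point [a], covers for one of the two outer measures are turned into covers for
   the other one, up to a factor [e^(P - phi a)] and a small error.  Cutting a Borel
   set into countably many small pieces gives the integral formula.

   The image [f y] of a centre has to be in [V^u(f x)], not only in [f(V^u(x))]:
   [V^u(f x)] is open in [f(V^u(x))] if [tau] is small.  This uses the local
   graphs, and therefore that the exponential map is uniformly close to the
   identity in charts.

   [rdist] is only used through its comparison with the coordinates near a point,
   where the loss is a factor 2. *)

Require Import Defs.
From HB Require Import structures.
From mathcomp Require Import all_boot all_order all_algebra.
From mathcomp Require Import all_classical all_reals all_analysis.
From mathcomp Require Import measurable_realfun ring lra.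
Set Implicit Arguments.
Unset Strict Implicit.
Unset Printing Implicit Defensive.

Import Order.TTheory GRing.Theory Num.Theory numFieldNormedType.Exports.

Local Open Scope classical_set_scope.
Local Open Scope ring_scope.

Local Notation coord := Defs.coord.

Local Notation gnorm := Defs.gnorm.

(** * Matrix norms and the mean value inequality *)

(** A bounded loss in the comparison of distances would spoil contraction rates, so the dynamical
    part is qualitative: a vector lies in [Es] as soon as its forward images are bounded, whatever
    the bound. Transversality, expansivity and openness then follow one pattern. Failing
    configurations accumulate at a point along an ultrafilter, their normalised directions converge
    to a unit vector, and bounds on future or past place this vector in spaces that are transverse.
    Differences of two moving points have to be mapped to their limits, which takes derivatives in
    the strict sense ([secant]); this notion also provides the continuity of derivatives. The
    exponential map is a mere relation. Existence and uniqueness of its values come from the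
    geodesic equation in a fixed chart, whose quadratic homogeneity gives solutions beyond time 1
    and a time-one map that is a translation up to a small Lipschitz defect. The reference measures
    are not known to be finite; therefore all errors in their comparison are multiplicative. *)

Lemma ultra_fmap (T U : Type) (g : T -> U) (F : set_system T) :
  UltraFilter F -> UltraFilter (g @ F).
Proof.
move=> FU; split; first exact: fmap_proper_filter.
move=> G GF gFG; apply/seteqP; split => // A GA.
have [//|FnA] := in_ultra_setVsetC (g @^-1` A) FU.
have GnA : G (~` A) by apply: gFG.
by have [x []] := @filter_ex _ _ GF _ (filterI GA GnA).
Qed.

Section MatrixNorm.
Context {R : realType}.

Lemma cvg_big_sum T (F : set_system T) {FF : Filter F} (I : Type) (s : seq I)
    (g : I -> T -> R) (a : I -> R) :
  (forall i, g i x @[x --> F] --> a i) ->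
  \sum_(i <- s) g i x @[x --> F] --> \sum_(i <- s) a i.
Proof.
move=> ga; elim: s => [|i s IH].
  rewrite big_nil (_ : (fun x => _) = cst 0); first exact: cvg_cst.
  by apply/funext => x; rewrite big_nil.
rewrite big_cons (_ : (fun x => _) = (fun x => g i x + \sum_(j <- s) g j x)).
  exact: cvgD.
by apply/funext => x; rewrite big_cons.
Qed.

Lemma mxnorm_le m n (A : 'M[R]_(m, n)) (c : R) :
  0 <= c -> (forall i j, `|A i j| <= c) -> `|A| <= c.
Proof.
by move=> c0 Ac; rewrite [leLHS]/Num.Def.normr/= mx_normrE; apply: bigmax_le.
Qed.

Lemma entry_le_norm m n (A : 'M[R]_(m, n)) i j : `|A i j| <= `|A|.
Proof.
rewrite [leRHS]/Num.Def.normr/= mx_normrE.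
exact: (@le_bigmax _ _ _ 0 (fun ij => `|A ij.1 ij.2|) (i, j)).
Qed.

Lemma mxnorm_mul m n p (A : 'M[R]_(m, n)) (B : 'M[R]_(n, p)) :
  `|A *m B| <= n%:R * `|A| * `|B|.
Proof.
apply: mxnorm_le => [|i j]; first by rewrite !mulr_ge0.
rewrite mxE; apply: le_trans (ler_norm_sum _ _ _) _.
apply: (@le_trans _ _ (\sum_(k < n) `|A| * `|B|)); last first.
  by rewrite sumr_const card_ord -mulrA mulr_natl.
by apply: ler_sum => k _; rewrite normrM ler_pM// entry_le_norm.
Qed.

Lemma mxnorm_tr m n (A : 'M[R]_(m, n)) : `|A^T| = `|A|.
Proof.
have le p q (B : 'M[R]_(p, q)) : `|B^T| <= `|B|.
  by apply: mxnorm_le => // i j; rewrite mxE entry_le_norm.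
by apply/eqP; rewrite eq_le le/= -{1}(trmxK A) le.
Qed.

Lemma cvg_entry T (F : set_system T) {FF : Filter F} m n
    (A : T -> 'M[R]_(m, n)) (a : 'M[R]_(m, n)) :
  (forall i j, A x i j @[x --> F] --> a i j) -> A x @[x --> F] --> a.
Proof.
move=> Aa; apply/cvgrPdist_le => e e0.
have : \forall x \near F, forall ij : 'I_m * 'I_n, `|a ij.1 ij.2 - A x ij.1 ij.2| <= e.
  apply: filter_forall => ij.
  by have /cvgrPdist_le := Aa ij.1 ij.2; apply.
apply: filterS => x Ax; apply: mxnorm_le => [|i j]; first exact: ltW.
by rewrite !mxE; exact: (Ax (i, j)).
Qed.

Lemma cvg_coord T (F : set_system T) {FF : Filter F} m n
    (A : T -> 'M[R]_(m, n)) (a : 'M[R]_(m, n)) i j :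
  A x @[x --> F] --> a -> A x i j @[x --> F] --> a i j.
Proof.
move=> Aa; apply: (@cvg_comp _ _ _ A (fun M => M i j)); first exact: Aa.
exact: coord_continuous.
Qed.

Lemma cvg_mulmx T (F : set_system T) {FF : Filter F} m n p
    (A : T -> 'M[R]_(m, n)) (B : T -> 'M[R]_(n, p)) (a : 'M[R]_(m, n)) (b : 'M[R]_(n, p)) :
  A x @[x --> F] --> a -> B x @[x --> F] --> b ->
  A x *m B x @[x --> F] --> a *m b.
Proof.
move=> Aa Bb; apply: cvg_entry => i j.
rewrite mxE (_ : (fun x => _) = (fun x => \sum_k A x i k * B x k j)); last first.
  by apply/funext => x; rewrite mxE.
apply: (@cvg_big_sum _ F _ _ _ (fun k x => A x i k * B x k j) (fun k => a i k * b k j)).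
by move=> k; apply: cvgM; exact: cvg_coord.
Qed.

Lemma cvg_trmx T (F : set_system T) {FF : Filter F} m n
    (A : T -> 'M[R]_(m, n)) (a : 'M[R]_(m, n)) :
  A x @[x --> F] --> a -> (A x)^T @[x --> F] --> a^T.
Proof.
move=> Aa; apply: cvg_entry => i j; rewrite mxE.
rewrite (_ : (fun x => _) = (fun x => A x j i)); last first.
  by apply/funext => x; rewrite mxE.
exact: cvg_coord.
Qed.

Lemma mul_delta_row n m (A : 'M[R]_(n, m)) i j :
  ((delta_mx 0 i : 'rV_n) *m A) 0 j = A i j.
Proof. by rewrite -rowE mxE. Qed.

Lemma mxnorm_delta n (i : 'I_n) : `|delta_mx 0 i : 'rV[R]_n| <= 1.
Proof.
apply: mxnorm_le => // j k; rewrite mxE; case: (_ && _).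
  by rewrite normr1.
by rewrite normr0.
Qed.

Lemma mxnorm_op m n (A : 'M[R]_(n, m)) (c : R) : 0 <= c ->
  (forall v : 'rV[R]_n, `|v *m A| <= c * `|v|) -> `|A| <= c.
Proof.
move=> c0 Ac; apply: mxnorm_le => // i j; rewrite -mul_delta_row.
apply: le_trans (entry_le_norm _ _ _) _; apply: le_trans (Ac _) _.
by rewrite -[X in _ <= X]mulr1 ler_wpM2l// mxnorm_delta.
Qed.

(** Limits along an ultrafilter take the place of convergent subsequences in the compactness
    arguments; here the compact set is a closed ball in finite dimension. *)
Lemma bounded_cvg n T (F : set_system T) (v : T -> 'rV[R]_n) c :
  UltraFilter F -> (forall x, `|v x| <= c) -> exists a : 'rV[R]_n, v x @[x --> F] --> a.
Proof.
move=> FU vc; pose S := [set a : 'rV[R]_n | `|a| <= c].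
have cS : compact S.
  apply: bounded_closed_compact.
    by exists c; split; [exact: num_real|move=> x cx y /= /le_trans -> //; exact: ltW].
  rewrite (_ : S = (fun a => `|a|) @^-1` [set x | x <= c])//; apply: preimage_closed.
    by move=> *; exact: norm_continuous.
  exact: closed_le.
have := cS; rewrite compact_ultra => /(_ (v @ F)).
case; [exact: ultra_fmap|by apply: (@filterE _ F) => x; exact: vc|].
by move=> a [a1 va]; exists a.
Qed.

End MatrixNorm.

Section VectorCurves.
Context {R : realType} {m n : nat}.
Implicit Types g : R -> 'M[R]_(m, n).

Lemma is_derive_entry (V : normedModType R) (g : V -> 'M[R]_(m, n)) t v (dg : 'M[R]_(m, n)) i j :
  is_derive t v g dg -> is_derive t v (fun x => g x i j) (dg i j).
Proof.
move=> [dgt <-]; have dgij := (derivable_mxP g t v).1 dgt i j.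
by apply: DeriveDef => //; rewrite (derive_mx dgt) mxE.
Qed.

Lemma is_derive_mx (V : normedModType R) (g : V -> 'M[R]_(m, n)) t v (dg : 'M[R]_(m, n)) :
  (forall i j, is_derive t v (fun x => g x i j) (dg i j)) -> is_derive t v g dg.
Proof.
move=> H; have dgt : derivable g t v.
  by apply/derivable_mxP => i j; have [] := H i j.
apply: DeriveDef => //; rewrite (derive_mx dgt); apply/matrixP => i j.
by rewrite mxE; have [] := H i j.
Qed.

Lemma is_derive_continuous (V : normedModType R) (g : R -> V) (t : R) (dg : V) :
  is_derive t 1 g dg -> {for t, continuous g}.
Proof.
by move=> [/derivable1_diffP d _]; exact: differentiable_continuous.
Qed.

(** The norm is the largest entry, so the scalar mean value theorem, applied to each entry with its
    own intermediate point, loses no constant. *)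
Lemma mvt_norm g (dg : R -> 'M[R]_(m, n)) (a b K : R) : a <= b ->
  (forall t, a <= t <= b -> is_derive t 1 g (dg t)) ->
  (forall t, a < t < b -> `|dg t| <= K) -> `|g b - g a| <= K * (b - a).
Proof.
rewrite le_eqVlt => /predU1P[<- _ _|ab gd gK].
  by rewrite !subrr mulr0 normr0.
have K0 : 0 <= K.
  by apply: le_trans (gK ((a + b) / 2) _) => //; rewrite !midf_lt.
apply: mxnorm_le => [|i j]; first by rewrite mulr_ge0// subr_ge0 ltW.
have gdij t : a <= t <= b -> is_derive t 1 (fun x => g x i j) (dg t i j).
  by move=> /gd; exact: is_derive_entry.
have [||c cab gab] := @MVT _ (fun x => g x i j) (fun x => dg x i j) a b ab.
- by move=> x /[!in_itv]/= /andP[ax xb]; apply: gdij; rewrite !ltW.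
- apply: derivable_within_continuous => x /[!in_itv]/= xab.
  by have [] := gdij x xab.
rewrite !mxE gab normrM (ger0_norm (x := b - a)) ?subr_ge0 ?(ltW ab)//.
apply: ler_wpM2r; first by rewrite subr_ge0 ltW.
apply: le_trans (entry_le_norm _ _ _) _; by apply: gK; move: cab; rewrite in_itv.
Qed.

End VectorCurves.

(** * Strict differentiability *)

Section StrictDifferentiability.
Context {R : realType} {n m : nat}.
Implicit Types (F : 'rV[R]_n -> 'rV[R]_m) (u : 'rV[R]_n).

(* Sealed by [Qed]: unification would otherwise unfold ['d]. *)
Lemma jac_subproof F u : {J : 'M[R]_(n, m) | forall v, v *m J = 'd F u v}.
Proof. by exists (lin1_mx ('d F u)) => v; rewrite mul_rV_lin1. Qed.

Definition jac F u : 'M[R]_(n, m) := sval (jac_subproof F u).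

Lemma mul_jac F u v : v *m jac F u = 'd F u v.
Proof. exact: (svalP (jac_subproof F u)). Qed.

Lemma is_derive_segment F u v (t : R) :
  differentiable F (u + t *: v) ->
  is_derive t 1 (fun s : R => F (u + s *: v)) (v *m jac F (u + t *: v)).
Proof.
move=> dF; rewrite mul_jac.
have ds : is_diff t (fun s : R => u + s *: v) (fun s : R => s *: v).
  have -> : (fun s : R => u + s *: v) = cst u + (fun s : R => s *: v) by [].
  have := @is_diffD R R 'rV[R]_n (cst u) (fun s : R => s *: v) 0 (fun s : R => s *: v) t.
  by rewrite add0r; apply; apply: is_diff_scalel.
have ds' : differentiable (fun s : R => u + s *: v) t by exact: ex_diff.
have dc : differentiable (F \o (fun s : R => u + s *: v)) t.
  exact: differentiable_comp.
split; first exact: diff_derivable.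
rewrite deriveE// (@diff_comp _ _ _ _ (fun s : R => u + s *: v) F t ds' dF)/=.
by rewrite (@diff_val _ _ _ _ _ _ _ ds) scale1r.
Qed.

(** Mean value inequality for [F] minus the linear map of matrix [J], along a segment. *)
Lemma segment_le F u v (K : R) (J : 'M[R]_(n, m)) :
  (forall t, 0 <= t <= 1 -> differentiable F (u + t *: (v - u))) ->
  (forall t, 0 <= t <= 1 ->
    `|(v - u) *m jac F (u + t *: (v - u)) - (v - u) *m J| <= K) ->
  `|F v - F u - (v - u) *m J| <= K.
Proof.
move=> dF FK.
pose g (t : R) := F (u + t *: (v - u)) - t *: ((v - u) *m J).
have := @mvt_norm _ _ _ g
  (fun t => (v - u) *m jac F (u + t *: (v - u)) - (v - u) *m J) 0 1 K ler01.
rewrite /g !scale1r !scale0r addr0 subr0 subr0 mulr1.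
rewrite (_ : u + (v - u) = v); last by rewrite addrC subrK.
rewrite addrAC; apply.
- move=> t t01; apply: is_deriveB; first exact: is_derive_segment (dF _ t01).
  have -> : (fun t : R => t *: ((v - u) *m J)) = (fun t : R => t *: ((v - u) *m J)) by [].
  split; first by apply: diff_derivable; apply: ex_diff.
  rewrite deriveE; last exact: ex_diff.
  by rewrite (@diff_val _ _ _ _ _ _ _ (is_diff_scalel _ _)) scale1r.
- by move=> t /andP[t0 t1]; apply: FK; rewrite !ltW.
Qed.

Lemma ball_segment u v w (d t : R) : `|u - v| < d -> `|u - w| < d ->
  0 <= t <= 1 -> `|u - (w + t *: (v - w))| < d.
Proof.
move=> uv uw /andP[t0 t1].
have -> : u - (w + t *: (v - w)) = (1 - t) *: (u - w) + t *: (u - v).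
  apply/rowP => i; rewrite !mxE; ring.
apply: le_lt_trans (ler_normD _ _) _; rewrite !normrZ !ger0_norm ?subr_ge0//.
have -> : d = (1 - t) * d + t * d by ring.
move: t0; rewrite le_eqVlt => /predU1P[<-|t0].
  by rewrite subr0 !mul1r !mul0r !addr0.
apply: ler_ltD; last by rewrite ltr_pM2l.
by apply: ler_wpM2l; [rewrite subr_ge0|exact: ltW].
Qed.

Lemma C1_secant F u :
  (\forall v \near u, differentiable F v) ->
  (forall e : R, 0 < e -> \forall v \near u,
     forall w : 'rV_n, `|w *m jac F v - w *m jac F u| <= e * `|w|) ->
  forall e : R, 0 < e -> exists2 O, nbhs u O & forall v w : 'rV_n, O v -> O w ->
     `|F v - F w - (v - w) *m jac F u| <= e * `|v - w|.
Proof.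
move=> dF cF e e0.
have : \forall v \near u, differentiable F v /\
    forall w : 'rV_n, `|w *m jac F v - w *m jac F u| <= e * `|w|.
  by near=> v; split; near: v => //; exact: cF.
move=> /nbhs_ballP[d /= d0 dP].
exists (ball u d); first exact: nbhsx_ballx.
move=> v w; rewrite -!ball_normE /= => uv uw; apply: segment_le => t t01.
  by apply: (dP _ _).1; rewrite -ball_normE/=; exact: ball_segment.
by apply: (dP _ _).2; rewrite -ball_normE/=; exact: ball_segment.
Unshelve. all: by end_near. Qed.

Lemma row_sum_norm_le (A : 'M[R]_(n, m)) (c : R) : 0 <= c ->
  (forall i, `|row i A| <= c) -> forall w : 'rV[R]_n, `|w *m A| <= n%:R * c * `|w|.
Proof.
move=> c0 Ac w; apply: le_trans (mxnorm_mul _ _) _.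
rewrite -!mulrA ler_wpM2l// mulrC ler_wpM2r//.
apply: mxnorm_le => // i j; have := entry_le_norm (row i A) 0 j.
by rewrite mxE => /le_trans; apply.
Qed.

Lemma Ck1_secant (U : set 'rV[R]_n) F u : open U -> Ck_on 1 U F -> U u ->
  forall e : R, 0 < e -> exists2 O, nbhs u O & forall v w : 'rV_n, O v -> O w ->
     `|F v - F w - (v - w) *m jac F u| <= e * `|v - w|.
Proof.
move=> oU [dF cF] Uu; apply: C1_secant.
  by apply: filterS (open_nbhs_nbhs (conj oU Uu)); exact: dF.
move=> e e0.
(* [n.+1] rather than [n], so that the tolerance per row is positive in dimension 0 too. *)
have n0 : 0 < n.+1%:R :> R by [].
have H : \forall v \near u, forall i : 'I_n,
    `|'D_(delta_mx 0 i) F u - 'D_(delta_mx 0 i) F v| <= e / n.+1%:R.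
  apply: (@filter_forall _ _ (fun (i : 'I_n) (v : 'rV[R]_n) =>
    `|'D_(delta_mx 0 i) F u - 'D_(delta_mx 0 i) F v| <= e / n.+1%:R) (nbhs u)) => i.
  have cFi : {for u, continuous (fun v => 'D_(delta_mx 0 i) F v)}.
    exact: (cF (delta_mx 0 i) u Uu).
  move/cvgrPdist_le : cFi; apply; exact: divr_gt0.
have UU : \forall v \near u, U v by exact: open_nbhs_nbhs.
apply: filterS2 H UU => v Hv Uv w; rewrite -mulmxBr.
apply: le_trans (row_sum_norm_le (c := e / n.+1%:R) _ _ w) _.
- by rewrite divr_ge0// ltW.
- move=> i; rewrite rowE mulmxBr distrC.
  have Eu := mul_jac F u (delta_mx 0 i); have Ev := mul_jac F v (delta_mx 0 i).
  have Du := deriveE (delta_mx 0 i) (dF _ Uu).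
  have Dv := deriveE (delta_mx 0 i) (dF _ Uv).
  have E := f_equal2 (fun a b : 'rV[R]_m => `|a - b|)
    (etrans Eu (esym Du)) (etrans Ev (esym Dv)).
  by apply: le_trans (Hv i); rewrite le_eqVlt; apply/orP; left; apply/eqP.
- rewrite ler_wpM2r// mulrCA -[X in _ <= X]mulr1 ler_wpM2l//; first exact: ltW.
  by rewrite ler_pdivrMr// mul1r ler_nat.
Qed.

End StrictDifferentiability.

(** * Quadratic forms *)

Section QuadraticForm.
Context {R : realType} {n : nat}.
Implicit Types (G : 'M[R]_n) (u v w : 'rV[R]_n).

Definition bform G v w : R := (v *m G *m w^T) 0 0.

Definition qnorm G v : R := Num.sqrt (bform G v v).

Definition posdef G := G^T = G /\ forall v, v != 0 -> 0 < bform G v v.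

Lemma bformDl G u v w : bform G (u + v) w = bform G u w + bform G v w.
Proof. by rewrite /bform !mulmxDl mxE. Qed.

Lemma bformDr G u v w : bform G w (u + v) = bform G w u + bform G w v.
Proof. by rewrite /bform linearD/= mulmxDr mxE. Qed.

Lemma bformZl G (c : R) v w : bform G (c *: v) w = c * bform G v w.
Proof. by rewrite /bform -!scalemxAl mxE. Qed.

Lemma bformZr G (c : R) v w : bform G v (c *: w) = c * bform G v w.
Proof. by rewrite /bform linearZ/= -scalemxAr mxE. Qed.

Lemma bformN G v : bform G (- v) (- v) = bform G v v.
Proof. by rewrite /bform linearN/= mulmxN !mulNmx opprK. Qed.

Lemma bformC G v w : G^T = G -> bform G v w = bform G w v.
Proof.
move=> GT; rewrite /bform -[in LHS](trmxK (v *m G *m w^T)) mxE !trmx_mul trmxK GT.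
by rewrite mulmxA.
Qed.

Lemma bformBG G G' v w : bform (G - G') v w = bform G v w - bform G' v w.
Proof. by rewrite /bform mulmxBr mulmxBl !mxE. Qed.

Lemma bform_le G v w : `|bform G v w| <= n%:R ^+ 2 * `|G| * `|v| * `|w|.
Proof.
apply: le_trans (entry_le_norm _ _ _) _; apply: le_trans (mxnorm_mul _ _) _.
rewrite mxnorm_tr ler_wpM2r// expr2 -!mulrA ler_wpM2l//.
by rewrite [`|G| * _]mulrC mulrA mxnorm_mul.
Qed.

Lemma bform_ge0 G v : posdef G -> 0 <= bform G v v.
Proof.
move=> [_ Gp]; have [->|/Gp/ltW//] := eqVneq v 0.
by rewrite /bform !mul0mx mxE.
Qed.

Lemma qnorm_ge0 G v : 0 <= qnorm G v.
Proof. exact: sqrtr_ge0. Qed.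

Lemma qnorm0 G : qnorm G 0 = 0.
Proof. by rewrite /qnorm /bform !mul0mx mxE sqrtr0. Qed.

Lemma qnormN G v : qnorm G (- v) = qnorm G v.
Proof. by rewrite /qnorm bformN. Qed.

Lemma qnormZ G (c : R) v : qnorm G (c *: v) = `|c| * qnorm G v.
Proof.
by rewrite /qnorm bformZl bformZr mulrA -expr2 sqrtrM ?sqr_ge0// sqrtr_sqr.
Qed.

Lemma qnorm_sqr G v : posdef G -> qnorm G v ^+ 2 = bform G v v.
Proof. by move=> Gp; rewrite sqr_sqrtr// bform_ge0. Qed.

Lemma qnorm_gt0 G v : posdef G -> v != 0 -> 0 < qnorm G v.
Proof. by move=> [_ Gp] v0; rewrite sqrtr_gt0 Gp. Qed.

Lemma bform_CS G v w : posdef G -> bform G v w <= qnorm G v * qnorm G w.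
Proof.
move=> Gp; have [Gs _] := Gp.
have [v0|v0] := eqVneq v 0.
  by rewrite v0 /bform !mul0mx mxE mulr_ge0 ?qnorm_ge0.
have [w0|w0] := eqVneq w 0.
  by rewrite w0 /bform trmx0 mulmx0 mxE mulr_ge0 ?qnorm_ge0.
have a0 := qnorm_gt0 Gp v0; have b0 := qnorm_gt0 Gp w0.
set a := qnorm G v in a0 *; set b := qnorm G w in b0 *.
(* The value of the form at this vector is [2 * a * b * (a * b - bform G v w)]. *)
have := bform_ge0 (b *: v + (- a) *: w) Gp.
rewrite bformDl !bformDr !bformZl !bformZr (bformC w v Gs).
rewrite -(qnorm_sqr v Gp) -(qnorm_sqr w Gp) -/a -/b => H.
rewrite -(ler_pM2l (mulr_gt0 a0 b0)); nra.
Qed.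

Lemma qnormD G v w : posdef G -> qnorm G (v + w) <= qnorm G v + qnorm G w.
Proof.
move=> Gp; have [Gs _] := Gp.
rewrite -(@ler_pXn2r _ 2%N) ?nnegrE ?addr_ge0 ?qnorm_ge0//.
rewrite sqrrD !qnorm_sqr// bformDl !bformDr (bformC w v Gs).
have := bform_CS v w Gp; lra.
Qed.

Lemma cvg_bform T (F : set_system T) {FF : Filter F} (A : T -> 'M[R]_n)
    (v w : T -> 'rV[R]_n) (A0 : 'M[R]_n) (v0 w0 : 'rV[R]_n) :
  A x @[x --> F] --> A0 -> v x @[x --> F] --> v0 -> w x @[x --> F] --> w0 ->
  bform (A x) (v x) (w x) @[x --> F] --> bform A0 v0 w0.
Proof.
move=> AA vv ww; apply: (@cvg_coord _ _ F _ _ _ (fun x => v x *m A x *m (w x)^T)).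
by apply: cvg_mulmx; [exact: cvg_mulmx|exact: cvg_trmx].
Qed.

Lemma cvg_qnorm T (F : set_system T) {FF : Filter F} (A : T -> 'M[R]_n)
    (v : T -> 'rV[R]_n) (A0 : 'M[R]_n) (v0 : 'rV[R]_n) :
  A x @[x --> F] --> A0 -> v x @[x --> F] --> v0 ->
  qnorm (A x) (v x) @[x --> F] --> qnorm A0 v0.
Proof.
move=> AA vv; exact: (cvg_comp _ _ (cvg_bform AA vv vv) (@sqrt_continuous _ _)).
Qed.

(** The constant is the minimum on the unit sphere, which is empty in dimension 0. *)
Lemma qnorm_lower G : posdef G -> exists2 c : R, 0 < c & forall v, c * `|v| <= qnorm G v.
Proof.
move=> Gp; have [n0|n0] := posnP n.
  exists 1 => // v; rewrite (_ : v = 0) ?normr0 ?mulr0 ?qnorm_ge0//.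
  by apply/rowP => i; have := ltn_ord i; rewrite [X in (_ < X)%N -> _]n0.
pose S := [set v : 'rV[R]_n | `|v| = 1].
have cS : compact S.
  apply: bounded_closed_compact.
    by exists 1; split => // x x1 y /= ->; exact: ltW.
  rewrite (_ : S = (fun a => `|a|) @^-1` [set 1])//; apply: preimage_closed.
    by move=> *; exact: norm_continuous.
  exact: closed_eq.
have normalize v : v != 0 -> S (`|v|^-1 *: v).
  by move=> v0; rewrite /S/= normrZ normfV normr_id mulVf// normr_eq0.
have S0 : S !=set0.
  exists (`|const_mx 1 : 'rV[R]_n|^-1 *: const_mx 1); apply: normalize.
  by apply/eqP => /rowP /(_ (Ordinal n0)); rewrite !mxE => /eqP; rewrite oner_eq0.
have [|v Sv vmin] := @EVT_min_rV R n (qnorm G) S S0 cS.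
  apply: continuous_subspaceT => v.
  by apply: (@cvg_qnorm _ (nbhs v) _ (fun=> G) id); [exact: cvg_cst|exact: cvg_id].
have v0 : v != 0 by apply/eqP => v0; move: Sv; rewrite inE /S/= v0 normr0 => /eqP; rewrite eq_sym oner_eq0.
exists (qnorm G v); first exact: qnorm_gt0.
move=> w; have [->|w0] := eqVneq w 0; first by rewrite normr0 mulr0 qnorm0.
have := vmin _ (mem_set (normalize _ w0)).
by rewrite qnormZ normfV normr_id ler_pdivlMl ?normr_gt0// mulrC.
Qed.

Lemma qnorm_upper G v : qnorm G v <= Num.sqrt (n%:R ^+ 2 * `|G|) * `|v|.
Proof.
have -> : `|v| = Num.sqrt (`|v| ^+ 2) by rewrite sqrtr_sqr normr_id.
rewrite -sqrtrM ?mulr_ge0// ler_wsqrtr//.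
by apply: le_trans (ler_norm _) _; apply: le_trans (bform_le _ _ _) _; rewrite expr2 mulrA.
Qed.

Lemma qnorm_perturb G : posdef G -> \forall G' \near G, posdef G' ->
  forall v, 2^-1 * qnorm G v <= qnorm G' v <= 2 * qnorm G v.
Proof.
move=> Gp; have [c c0 Gc] := qnorm_lower Gp.
(* A relative error [3 / 4] on the squares leaves [1 / 4 = (1 / 2) ^+ 2] below and [7 / 4 <= 2 ^+ 2]
   above. The [+ 1] keeps the denominator positive when [n = 0]. *)
pose d := 3 / 4 * c ^+ 2 / (n%:R ^+ 2 + 1).
have d0 : 0 < d by rewrite /d divr_gt0 ?mulr_gt0 ?exprn_gt0// ltr_wpDl ?sqr_ge0.
have : \forall G' \near G, `|G' - G| < d.
  by apply/nbhs_ballP; exists d => // G'; rewrite -ball_normE/= distrC.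
apply: filterS => G' G'd G'p v.
have key : `|bform G' v v - bform G v v| <= 3 / 4 * bform G v v.
  rewrite -bformBG; apply: le_trans (bform_le _ _ _) _.
  rewrite -(qnorm_sqr _ Gp).
  have h1 : n%:R ^+ 2 * `|G' - G| <= 3 / 4 * c ^+ 2.
    apply: (@le_trans _ _ ((n%:R ^+ 2 + 1) * d)).
      by apply: ler_pM; [exact: sqr_ge0|exact: normr_ge0|rewrite lerDl|exact: ltW].
    by rewrite /d mulrC divfK// gt_eqF// ltr_wpDl ?sqr_ge0.
  rewrite -mulrA -expr2.
  apply: le_trans (ler_wpM2r (sqr_ge0 _) h1) _.
  rewrite -[_ * c ^+ 2 * _]mulrA -exprMn ler_wpM2l//.
  by rewrite ler_pXn2r ?nnegrE ?mulr_ge0 ?qnorm_ge0// ltW.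
have h0 := bform_ge0 v Gp; have h0' := bform_ge0 v G'p.
have q := qnorm_ge0 G v; have q' := qnorm_ge0 G' v.
move: key; rewrite -!qnorm_sqr// ler_norml => /andP[k1 k2].
apply/andP; split.
  by rewrite -(@ler_pXn2r _ 2%N) ?nnegrE ?mulr_ge0// exprMn; move: k1 k2; rewrite !expr2; lra.
by rewrite -(@ler_pXn2r _ 2%N) ?nnegrE ?mulr_ge0// exprMn; move: k1 k2; rewrite !expr2; lra.
Qed.

End QuadraticForm.

(** * Charts *)

Section Charts.
Context {R : realType} {n : nat} {M : topologicalType} (X : riemannian R n M).
Implicit Types (p q x y z : M) (v w : 'rV[R]_n) (J : 'M[R]_n).

Local Notation dom p := (cdom (rchart X p)).

Lemma dom_nbhs p x : dom p x -> nbhs x (dom p).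
Proof. by have [op _ _ _ _] := rchart_is_chart X p => px; exact: open_nbhs_nbhs. Qed.

Lemma coordK p x : dom p x -> cinv (rchart X p) (coord X p x) = x.
Proof. by have [_ _ + _ _] := rchart_is_chart X p; exact. Qed.

Lemma coord_cts p x : dom p x -> {for x, continuous (coord X p)}.
Proof. by have [_ _ _ + _] := rchart_is_chart X p; exact. Qed.

Lemma coord_cod p x : dom p x -> ccod (rchart X p) (coord X p x).
Proof. by move=> px; exists x. Qed.

Lemma cod_open p : open (ccod (rchart X p)).
Proof. by have [_ + _ _ _] := rchart_is_chart X p. Qed.

Lemma cod_nbhs p x : dom p x -> nbhs (coord X p x) (ccod (rchart X p)).
Proof.
move=> px; apply: open_nbhs_nbhs; split; [exact: cod_open|exact: coord_cod].
Qed.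

Lemma cinv_cts p u : ccod (rchart X p) u -> {for u, continuous (cinv (rchart X p))}.
Proof. by have [_ _ _ _ +] := rchart_is_chart X p; exact. Qed.

Lemma cinvK p u : ccod (rchart X p) u -> coord X p (cinv (rchart X p) u) = u.
Proof. by move=> [x px <-]; rewrite -/(coord X p x) coordK. Qed.

Lemma cinv_dom p u : ccod (rchart X p) u -> dom p (cinv (rchart X p) u).
Proof. by move=> [x px <-]; rewrite -/(coord X p x) coordK. Qed.

Lemma cinv_cvg p x : dom p x ->
  cinv (rchart X p) u @[u --> coord X p x] --> x.
Proof. by move=> px A Ax; apply: (cinv_cts (coord_cod px)); rewrite coordK. Qed.

Lemma coord_inj p x y : dom p x -> dom p y -> coord X p x = coord X p y -> x = y.
Proof. by move=> px py xy; rewrite -(coordK px) xy coordK. Qed.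

(* Strict differentiability at [x] in the charts at [p] and [p']: [J] maps
   secants of [F] near [x] up to relative error. *)
Definition secant p p' (F : M -> M) x J := forall e : R, 0 < e ->
  exists2 O, nbhs x O & forall y z, O y -> O z ->
    `|coord X p' (F y) - coord X p' (F z) - (coord X p y - coord X p z) *m J|
      <= e * `|coord X p y - coord X p z|.

Lemma secant_chart p p' (F : M -> M) x J : dom p x ->
  (forall e : R, 0 < e -> exists2 O, nbhs (coord X p x) O &
     forall v w, O v -> O w ->
       `|(coord X p' \o F \o cinv (rchart X p)) v -
         (coord X p' \o F \o cinv (rchart X p)) w - (v - w) *m J| <= e * `|v - w|) ->
  secant p p' F x J.
Proof.
move=> px H e e0; have [ O Ox HO] := H e e0.
have cO : nbhs x (coord X p @^-1` O) by exact: (coord_cts px).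
exists (dom p `&` coord X p @^-1` O); first exact: filterI (dom_nbhs px) cO.
move=> y z [py Oy] [pz Oz]; have := HO _ _ Oy Oz.
by rewrite /= !coordK.
Qed.

Lemma secant_comp p p' p'' (F G : M -> M) x J J' :
  {for x, continuous F} -> secant p p' F x J -> secant p' p'' G (F x) J' ->
  secant p p'' (G \o F) x (J *m J').
Proof.
move=> cF FJ GJ e e0.
(* [c] bounds the secants of [F] once their error is at most 1. The error [e2] of [G] is multiplied
   by [c], the error [e1] of [F] by [c'], and each contributes [e / 2]. *)
pose c := n%:R * `|J| + 1; pose c' := n%:R * `|J'| + 1.
have c0 : 0 < c by rewrite /c ltr_wpDl ?mulr_ge0.
have c'0 : 0 < c' by rewrite /c' ltr_wpDl ?mulr_ge0.
pose e1 := Num.min 1 (e / 2 / c'); pose e2 := e / 2 / c.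
have e10 : 0 < e1 by rewrite lt_min ltr01 !divr_gt0.
have e20 : 0 < e2 by rewrite !divr_gt0.
have [ O Ox HO] := FJ _ e10.
have [ O' Ox' HO'] := GJ _ e20.
exists (O `&` F @^-1` O'); first by apply: filterI => //; exact: cF.
move=> y z [ Oy Oy'] [ Oz Oz'].
have h1 := HO _ _ Oy Oz.
have h2 := HO' _ _ Oy' Oz'.
set xi := coord X p y - coord X p z in h1 *.
set et := coord X p' (F y) - coord X p' (F z) in h1 h2 *.
set ze := coord X p'' (G (F y)) - coord X p'' (G (F z)) in h2 *.
rewrite -/ze mulmxA.
have hxi : `|et| <= c * `|xi|.
  rewrite -(subrK (xi *m J) et); apply: le_trans (ler_normD _ _) _.
  rewrite /c mulrDl mul1r addrC lerD//.
    by rewrite -mulrA [`|J| * _]mulrC mulrA mxnorm_mul.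
  by apply: (le_trans h1); rewrite -[X in _ <= X]mul1r ler_wpM2r// ge_min lexx.
have -> : ze - xi *m J *m J' = (ze - et *m J') + (et - xi *m J) *m J'.
  by rewrite [(et - _) *m _]mulmxBl addrA subrK.
apply: le_trans (ler_normD _ _) _.
have -> : e * `|xi| = e2 * (c * `|xi|) + e / 2 * `|xi|.
  by rewrite mulrA /e2 divfK ?gt_eqF// -mulrDl -splitr.
apply: lerD; first by apply: (le_trans h2); rewrite ler_wpM2l// ltW.
apply: le_trans (mxnorm_mul _ _) _.
apply: (@le_trans _ _ (e1 * `|xi| * c')).
  rewrite mulrAC mulrC ler_pM ?mulr_ge0// /c'.
  by rewrite lerDl.
rewrite mulrAC ler_wpM2r//.
by rewrite -ler_pdivlMr// ge_min lexx orbT.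
Qed.

Lemma secant_near p p' (F : M -> M) x J : secant p p' F x J -> dom p x ->
  forall e : R, 0 < e -> \forall y \near x, forall J',
    secant p p' F y J' -> forall v, `|v *m (J' - J)| <= e * `|v|.
Proof.
move=> FJ px e e0; have [ O Ox HO] := FJ _ (divr_gt0 e0 (ltr0n R 2)).
have px' := dom_nbhs px.
near=> y => J' FJ' v.
have py : dom p y by near: y.
have Oy : nbhs y O by near: y; apply: nbhs_interior.
have [ O' O'y HO'] := FJ' _ (divr_gt0 e0 (ltr0n R 2)).
have [->|v0] := eqVneq v 0; first by rewrite mul0mx !normr0 mulr0.
have nv0 : 0 < `|v| by rewrite normr_gt0.
(* A secant from [y] in the direction [v], short enough for both estimates to apply; homogeneity
   removes the length [t] afterwards. *)
have [t t0 [ Ot tcod]] : exists2 t : R, 0 < t &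
   (O `&` O') (cinv (rchart X p) (coord X p y + t *: v)) /\
   ccod (rchart X p) (coord X p y + t *: v).
  have ct : (coord X p y + t *: v) @[t --> (0 : R)] --> coord X p y.
    rewrite -[X in _ --> X]addr0 -(scale0r v).
    by apply: cvgD; [exact: cvg_cst|apply: cvgZr_tmp; exact: cvg_id].
  have H1 : \forall t \near (0 : R), ccod (rchart X p) (coord X p y + t *: v).
    exact: (ct _ (cod_nbhs py)).
  have H2 : \forall t \near (0 : R),
      (O `&` O') (cinv (rchart X p) (coord X p y + t *: v)).
    apply: (ct ((O `&` O') \o cinv (rchart X p))).
    apply: (cinv_cts (coord_cod py)); rewrite coordK//.
    by apply: filterI.
  have [d /= d0 dH] : nbhs_ball (0 : R) (fun t => ccod (rchart X p) (coord X p y + t *: v) /\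
      (O `&` O') (cinv (rchart X p) (coord X p y + t *: v))).
    by apply/nbhs_ballP; exact: filterI H1 H2.
  exists (d / 2); first by rewrite divr_gt0.
  by apply/and_comm; apply: dH; rewrite -ball_normE/= sub0r normrN gtr0_norm ?divr_gt0// ltr_pdivrMr// ltr_pMr// ltr1n.
have Oy0 := nbhs_singleton Oy; have O'y0 := nbhs_singleton O'y.
have h1 := HO _ _ Ot.1 Oy0; have h2 := HO' _ _ Ot.2 O'y0.
move: h1 h2; rewrite cinvK// [_ + t *: v]addrC addrK => h1 h2.
have : `|(t *: v) *m (J' - J)| <= e * `|t *: v|.
  rewrite mulmxBr; set a := coord X p' (F _) - _ in h1 h2.
  have -> : (t *: v) *m J' - (t *: v) *m J =
    (a - (t *: v) *m J) - (a - (t *: v) *m J') by rewrite opprB [a - _ + _]addrC addrA subrK.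
  apply: le_trans (ler_normB _ _) _.
  by rewrite [e]splitr mulrDl lerD.
by rewrite -scalemxAl !normrZ gtr0_norm// mulrCA ler_pM2l.
Unshelve. all: by end_near. Qed.

Lemma secant_unique p p' (F : M -> M) x J J' : dom p x ->
  secant p p' F x J -> secant p p' F x J' -> J = J'.
Proof.
move=> px FJ FJ'; apply/eqP; rewrite -subr_eq0 -normr_eq0 eq_le normr_ge0 andbT.
apply/ler_addgt0Pl => e e0; rewrite addr0.
apply: mxnorm_op => [|v]; first exact: ltW.
by have := nbhs_singleton (secant_near FJ' px e0); exact.
Qed.

Lemma secant_cvg T (Fl : set_system T) {FF : Filter Fl} p p' (F : M -> M) x J
    (xs : T -> M) (Js : T -> 'M[R]_n) : dom p x -> secant p p' F x J ->
  xs t @[t --> Fl] --> x -> (\forall t \near Fl, secant p p' F (xs t) (Js t)) ->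
  Js t @[t --> Fl] --> J.
Proof.
move=> px FJ xsx FJs; apply/cvgrPdist_le => e e0.
have H : \forall t \near Fl, forall J', secant p p' F (xs t) J' ->
    forall v, `|v *m (J' - J)| <= e * `|v|.
  exact: xsx (secant_near FJ px e0).
apply: filterS2 H FJs => t Ht FJt; rewrite distrC; apply: mxnorm_op => [|v]; first exact: ltW.
exact: Ht.
Qed.

(** Both ends of the secants move, so differentiability at [x] alone would not suffice: this is what
    strictness is for. *)
Lemma secant_lim T (Fl : set_system T) {FF : Filter Fl} p p' (F : M -> M) x J
    (ys zs : T -> M) (c : T -> R) (v : 'rV[R]_n) : secant p p' F x J ->
  ys t @[t --> Fl] --> x -> zs t @[t --> Fl] --> x ->
  c t *: (coord X p (ys t) - coord X p (zs t)) @[t --> Fl] --> v ->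
  c t *: (coord X p' (F (ys t)) - coord X p' (F (zs t))) @[t --> Fl] --> v *m J.
Proof.
move=> FJ ysx zsx cv.
pose a t := c t *: (coord X p (ys t) - coord X p (zs t)).
pose b t := c t *: (coord X p' (F (ys t)) - coord X p' (F (zs t))).
have ab : (b t - a t *m J) @[t --> Fl] --> (0 : 'rV[R]_n).
  apply/cvgrPdist_le => e e0.
  have v1 : 0 < `|v| + 1 by rewrite ltr_wpDl.
  have [ O Ox HO] := FJ _ (divr_gt0 e0 v1).
  have av : \forall t \near Fl, `|a t| <= `|v| + 1.
    move/cvgrPdist_le : cv => /(_ 1 ltr01); apply: filterS => t.
    rewrite -/(a t) distrC => h; rewrite -(subrK v (a t)) addrC.
    by apply: le_trans (ler_normD _ _) _; rewrite lerD2l.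
  have Oys := ysx _ Ox; have Ozs := zsx _ Ox.
  near=> t; rewrite sub0r normrN.
  have Oy : O (ys t) by near: t; exact: Oys.
  have Oz : O (zs t) by near: t; exact: Ozs.
  rewrite /a /b -scalemxAl -scalerBr normrZ.
  apply: (@le_trans _ _ (`|c t| * (e / (`|v| + 1) *
     `|coord X p (ys t) - coord X p (zs t)|))).
    by rewrite ler_wpM2l// HO.
  rewrite mulrCA -normrZ -/(a t).
  have : `|a t| <= `|v| + 1 by near: t.
  rewrite -[X in _ -> _ <= X](divfK (lt0r_neq0 v1)) => h.
  by rewrite ler_wpM2l// divr_ge0// ltW.
rewrite -[v *m J]add0r.
have -> : (fun t => c t *: (coord X p' (F (ys t)) - coord X p' (F (zs t)))) =
   (fun t => (b t - a t *m J) + a t *m J) by apply/funext => t; rewrite subrK.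
by apply: cvgD => //; apply: cvg_mulmx => //; exact: cvg_cst.
Unshelve. all: by end_near. Qed.

Definition trans p q x : 'M[R]_n :=
  jac (coord X q \o cinv (rchart X p)) (coord X p x).

Lemma overlap_open p q :
  open (cmap (rchart X p) @` (dom p `&` dom q)).
Proof.
rewrite openE => _ [x [px qx] <-]; rewrite /interior/= -/(coord X p x).
have cx := cinv_cvg px.
apply: filterS (filterI (cod_nbhs px) (cx _ (dom_nbhs qx))).
move=> u [uc uq]; exists (cinv (rchart X p) u); last exact: (cinvK uc).
by split => //; exact: cinv_dom.
Qed.

Lemma secant_trans p q x : dom p x -> dom q x -> secant p q id x (trans p q x).
Proof.
move=> px qx; apply: secant_chart => // e e0.
have := @Ck1_secant R n n _ _ (coord X p x) (@overlap_open p q)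
  (rchart_smooth X p q 1) _ e e0.
by apply; exists x.
Qed.

Lemma trans_comp p q r x : dom p x -> dom q x -> dom r x ->
  trans p q x *m trans q r x = trans p r x.
Proof.
move=> px qx rx; apply: (secant_unique px _ (secant_trans px rx)).
apply: (@secant_comp p q r id id) => //; exact: secant_trans.
Qed.

Lemma secant_id p x : secant p p id x 1%:M.
Proof.
move=> e e0; exists setT; first exact: filterT.
by move=> y z _ _ /=; rewrite mulmx1 subrr normr0 mulr_ge0// ltW.
Qed.

Lemma trans_id p x : dom p x -> trans p p x = 1%:M.
Proof.
move=> px; apply: (secant_unique px (secant_trans px px)); exact: secant_id.
Qed.

Lemma transK p q x : dom p x -> dom q x -> trans p q x *m trans q p x = 1%:M.
Proof. by move=> px qx; rewrite trans_comp// trans_id. Qed.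

Lemma mul_transK p q x v : dom p x -> dom q x -> v *m trans p q x *m trans q p x = v.
Proof. by move=> px qx; rewrite -mulmxA transK// mulmx1. Qed.

Definition gramx p x : 'M[R]_n := gram X p (coord X p x).

Lemma gramx_posdef p x : dom p x -> posdef (gramx p x).
Proof.
move=> px; split; first exact: gram_sym (coord_cod px).
by move=> v v0; exact: gram_pos (coord_cod px) v0.
Qed.

Lemma gramx_trans p q x v w : dom p x -> dom q x ->
  bform (gramx p x) v w = bform (gramx q x) (v *m trans p q x) (w *m trans p q x).
Proof.
move=> px qx; rewrite /bform (gram_compat px qx v w).
by rewrite (mul_jac _ _ v) (mul_jac _ _ w).
Qed.

Lemma gnormE x v : gnorm X x v = qnorm (gramx x x) v.
Proof. by []. Qed.

Lemma gnorm_trans p q x v : dom p x -> dom q x ->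
  qnorm (gramx p x) v = qnorm (gramx q x) (v *m trans p q x).
Proof. by move=> px qx; rewrite /qnorm (gramx_trans _ _ px qx). Qed.

Lemma gramx_cts p x : dom p x -> {for x, continuous (gramx p)}.
Proof.
move=> px; apply: continuous_comp; first exact: coord_cts.
exact: (gram_smooth X p 0 _ (coord_cod px)).
Qed.

Lemma rchart_self x : dom x x. Proof. exact: rchart_mem. Qed.

End Charts.
#[global] Hint Resolve rchart_self : core.

(** * Curves and their speed *)

Section FirstExit.
Context {R : realType}.

(** The exit time is the infimum of the bad times; it is bad itself because being good is an open
    condition. *)
Lemma first_exit (P : R -> Prop) (t1 : R) : 0 <= t1 <= 1 -> P 0 -> ~ P t1 ->
  (forall t, 0 <= t <= 1 -> P t -> \forall s \near t, P s) ->
  exists t, [/\ 0 < t <= 1, ~ P t & forall s, 0 <= s < t -> P s].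
Proof.
move=> /andP[t10 t11] P0 nPt1 oP.
pose B := [set t | 0 <= t <= 1 /\ ~ P t].
have Bt1 : B t1 by split => //; rewrite t10.
have lB : lbound B 0 by move=> t [/andP[]].
have hB : has_inf B by split; [exists t1|exists 0].
have i0 : 0 <= inf B by apply: lb_le_inf => //; exists t1.
have i1 : inf B <= 1 by apply: le_trans t11; apply: ge_inf => //; exists 0.
have Pb s : 0 <= s < inf B -> P s.
  move=> /andP[s0 sB]; apply: contrapT => nPs.
  have : inf B <= s.
    apply: ge_inf; first by exists 0.
    by split => //; rewrite s0/= (le_trans (ltW sB)).
  by rewrite leNgt sB.
have nP : ~ P (inf B).
  move=> Pi; have i01 : 0 <= inf B <= 1 by rewrite i0.
  have /nbhs_ballP[d /= d0 dP] := oP _ i01 Pi.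
  have [e [/andP[e0 e1] nPe] ed] := inf_adherent d0 hB.
  have ie : inf B <= e by apply: ge_inf; [exists 0|split => //; rewrite e0].
  apply: nPe; apply: dP; rewrite -ball_normE/= ltr_norml; apply/andP; split; lra.
exists (inf B); split => //; rewrite i1 andbT lt_neqAle i0 andbT.
by apply/eqP => B0; apply: nP; rewrite -B0.
Qed.

Lemma continuous_within_cc (V : topologicalType) (f : R -> V) (a b : R) :
  (forall t, a <= t <= b -> {for t, continuous f}) ->
  {within `[a, b], continuous f}.
Proof.
move=> cf; apply: continuous_in_subspaceT => t.
by rewrite inE/= in_itv/= => /cf.
Qed.

Lemma continuous_near_eq (T V : topologicalType) (f g : T -> V) t :
  (\forall s \near t, f s = g s) -> {for t, continuous g} ->
  {for t, continuous f}.
Proof.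
move=> fg cg A; rewrite /= (nbhs_singleton fg) => /cg gA.
by apply: filterS2 fg gA => s; rewrite /preimage/= => ->.
Qed.

Lemma FTC_segment (F f : R -> R) (a b : R) : a < b ->
  (forall t, a <= t <= b -> is_derive t 1 F (f t)) ->
  (forall t, a <= t <= b -> {for t, continuous f}) ->
  (\int[lebesgue_measure]_(t in `[a, b]) (f t)%:E = (F b - F a)%:E)%E.
Proof.
move=> ab dF cf; rewrite EFinB; apply: continuous_FTC2 => //.
- exact: continuous_within_cc.
- have cF t : a <= t <= b -> {for t, continuous F}.
    by move=> /dF; exact: is_derive_continuous.
  split.
  + move=> t /[!in_itv]/= /andP[a0 b0].
    by have [] := dF t; first by rewrite (ltW a0) (ltW b0).
  + by apply: cvg_at_right_filter; apply: cF; rewrite lexx (ltW ab).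
  + by apply: cvg_at_left_filter; apply: cF; rewrite lexx (ltW ab).
- move=> t /[!in_itv]/= /andP[a0 b0]; rewrite derive1E.
  by have [|_ ->] := dF t; first by rewrite (ltW a0) (ltW b0).
Qed.

Lemma integral_segment_le (f g : R -> R) (a b : R) :
  (forall t, a <= t <= b -> {for t, continuous f}) ->
  (forall t, a <= t <= b -> {for t, continuous g}) ->
  (forall t, a <= t <= b -> f t <= g t) ->
  (\int[lebesgue_measure]_(t in `[a, b]) (f t)%:E <=
   \int[lebesgue_measure]_(t in `[a, b]) (g t)%:E)%E.
Proof.
move=> cf cg fg; apply: le_integral.
- by [].
- apply: continuous_compact_integrable; first exact: segment_compact.
  exact: continuous_within_cc.
- apply: continuous_compact_integrable; first exact: segment_compact.
  exact: continuous_within_cc.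
- by move=> t; rewrite inE/= in_itv/= lee_fin => /fg.
Qed.

Lemma integral_segment_subset (f : R -> R) (b c : R) : 0 <= b <= c ->
  (forall t, 0 <= t <= c -> {for t, continuous f}) ->
  (forall t, 0 <= f t) ->
  (\int[lebesgue_measure]_(t in `[0%R, b]) (f t)%:E <=
   \int[lebesgue_measure]_(t in `[0%R, c]) (f t)%:E)%E.
Proof.
move=> /andP[b0 b1] cf f0; apply: ge0_subset_integral => //.
- have /integrableP[] : lebesgue_measure.-integrable `[0%R, c] (EFin \o f) => //.
  apply: continuous_compact_integrable; first exact: segment_compact.
  exact: continuous_within_cc.
- by move=> t _; rewrite lee_fin.
- by move=> t /=; rewrite !in_itv/= => /andP[-> /le_trans]; exact.
Qed.

End FirstExit.

Section CurvesInCharts.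
Context {R : realType} {n : nat} {M : topologicalType} (X : riemannian R n M).
Implicit Types (p q x y z : M) (v w : 'rV[R]_n) (c : R -> M).

Local Notation dom p := (cdom (rchart X p)).

(** The difference quotients of [c] are rescaled secants of the identity of [M], read in the two
    charts. *)
Lemma curve_chart p q c t w : {for t, continuous c} -> dom p (c t) -> dom q (c t) ->
  is_derive t 1 (coord X p \o c) w ->
  is_derive t 1 (coord X q \o c) (w *m trans X p q (c t)).
Proof.
move=> cc pt qt [/cvg_ex[/= l Hl] wE].
have lw : l = w by rewrite -wE; apply/esym/cvg_lim.
rewrite {}lw in Hl.
have sc : c (h *: 1 + t) @[h --> (0 : R)^'] --> c t.
  have ht : (h *: (1 : R) + t) @[h --> (0 : R)^'] --> (0 : R) *: (1 : R) + t.
    apply: cvg_within_filter.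
    by apply: cvgD; [apply: cvgZr_tmp; exact: cvg_id|exact: cvg_cst].
  by rewrite scale0r add0r in ht; exact: (cvg_comp _ _ ht cc).
have := @secant_lim _ _ _ X _ (0 : R)^' _ p q id (c t) _
  (fun h => c (h *: 1 + t)) (fun=> c t) (fun h => h^-1) w
  (secant_trans pt qt) sc (cvg_cst _) Hl.
move=> H; apply: DeriveDef; last by apply: cvg_lim; [exact: norm_hausdorff|exact: H].
by apply/cvg_ex; exists (w *m trans X p q (c t)); exact: H.
Qed.

Lemma trans_cts p q x : dom p x -> dom q x -> {for x, continuous (trans X p q)}.
Proof.
move=> px qx.
apply: (@secant_cvg _ _ _ X _ (nbhs x) _ p q id x _ id _ px (secant_trans px qx)).
- exact: cvg_id.
- near=> y; apply: secant_trans; near: y; exact: dom_nbhs.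
Unshelve. all: by end_near. Qed.

Definition speed c t : R := gnorm X (c t) (velocity X c t).

Lemma speed_chart p c t w : {for t, continuous c} -> dom p (c t) ->
  is_derive t 1 (coord X p \o c) w -> speed c t = qnorm (gramx X p (c t)) w.
Proof.
move=> cc pt dw; rewrite /speed gnormE (gnorm_trans _ pt (rchart_self X (c t))).
have [_ E] := curve_chart cc pt (rchart_self X (c t)) dw.
by rewrite /velocity derive1E E.
Qed.

Lemma C1_curve_chart p c t : C1_curve_at X c t -> dom p (c t) ->
  (\forall s \near t, [/\ {for s, continuous c}, dom p (c s) &
     is_derive s 1 (coord X p \o c) (derive1 (coord X p \o c) s)]) /\
  {for t, continuous (derive1 (coord X p \o c))}.
Proof.
move=> Ct pt; pose q := c t.
have [ct gt gct] := nbhs_singleton Ct.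
have Hs : \forall s \near t, [/\ {for s, continuous c}, dom p (c s), dom q (c s),
    is_derive s 1 (coord X p \o c)
      (derive1 (coord X q \o c) s *m trans X q p (c s))
   & is_derive s 1 (coord X p \o c) (derive1 (coord X p \o c) s)].
  near=> s.
  have [cs gs gcs] : [/\ {for s, continuous c}, derivable (coord X q \o c) s 1 &
    {for s, continuous (derive1 (coord X q \o c))}] by near: s; exact: Ct.
  have ps : dom p (c s) by near: s; apply: ct; exact: dom_nbhs.
  have qs : dom q (c s) by near: s; apply: ct; apply: dom_nbhs; exact: rchart_self.
  have ds : is_derive s 1 (coord X p \o c)
      (derive1 (coord X q \o c) s *m trans X q p (c s)).
    by apply: (curve_chart cs qs ps); rewrite derive1E; exact: (derivableP gs).
  split; [exact: cs|exact: ps|exact: qs|exact: ds|].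
  by rewrite derive1E; apply: derivableP; have [] := ds.
split; first by apply: filterS Hs => s [].
have E : \forall s \near t, derive1 (coord X p \o c) s =
    derive1 (coord X q \o c) s *m trans X q p (c s).
  by apply: filterS Hs => s [_ _ _ [_ H] _]; rewrite derive1E.
apply: (continuous_near_eq E).
apply: cvg_mulmx; first exact: gct.
apply: (@cvg_comp _ _ _ c (trans X q p) _ (nbhs (c t))); first exact: ct.
by apply: trans_cts => //; exact: rchart_self.
Unshelve. all: by end_near. Qed.

Lemma speed_cts c t : C1_curve_at X c t -> {for t, continuous (speed c)}.
Proof.
move=> Ct; have qt := rchart_self X (c t).
have [Hs gct] := C1_curve_chart Ct qt.
have E : \forall s \near t, speed c s =
    qnorm (gramx X (c t) (c s)) (derive1 (coord X (c t) \o c) s).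
  by apply: filterS Hs => s [cs qs ds]; exact: speed_chart.
apply: (continuous_near_eq E).
have [ct _ _] := nbhs_singleton Ct.
apply: cvg_qnorm; last exact: gct.
apply: (@cvg_comp _ _ _ c (gramx X (c t)) _ (nbhs (c t))); first exact: ct.
exact: gramx_cts.
Qed.

Lemma path_lengthE c : path_length X c =
  (\int[lebesgue_measure]_(t in `[0%R, 1%R]) (speed c t)%:E)%E.
Proof. by []. Qed.

End CurvesInCharts.

(** * The distance near a point *)

Lemma is_derive_line (R : realType) (m n : nat) (u v : 'M[R]_(m, n)) (t : R) :
  is_derive t 1 (fun s : R => u + s *: v) v.
Proof.
have ds : is_derive t 1 (fun s : R => s *: v) v.
  split; first by apply: diff_derivable; apply: ex_diff.
  rewrite deriveE; last exact: ex_diff.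
  by rewrite (@diff_val _ _ _ _ _ _ _ (is_diff_scalel _ _)) scale1r.
have := @is_deriveD _ _ _ (cst u) (fun s : R => s *: v) t 1 0 v
  (is_derive_cst _ _ _) ds.
by rewrite add0r.
Qed.

Section LocalDistance.
Context {R : realType} {n : nat} {M : topologicalType} (X : riemannian R n M).
Implicit Types (p q x y z : M) (v w : 'rV[R]_n) (c : R -> M) (s : R).

Local Notation dom p := (cdom (rchart X p)).

(** The metric at [p], extended to the whole chart as a constant norm. Its balls are convex in
    coordinates, and [rdist] is compared with it. *)
Definition pnorm p v : R := qnorm (gramx X p p) v.

Lemma pnorm_posdef p : posdef (gramx X p p).
Proof. by apply: gramx_posdef. Qed.

Hint Resolve pnorm_posdef : core.

Definition qball p s : set M :=
  [set x | dom p x /\ pnorm p (coord X p x - coord X p p) < s].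

Definition good_radius p s := forall u, pnorm p (u - coord X p p) <= s ->
  ccod (rchart X p) u /\
  forall v, 2^-1 * pnorm p v <= qnorm (gram X p u) v <= 2 * pnorm p v.

Lemma good_radius_ex p : exists2 s, 0 < s & good_radius p s.
Proof.
have pp := rchart_self X p.
have cg : {for coord X p p, continuous (gram X p)}.
  exact: (gram_smooth X p 0 _ (coord_cod pp)).
have H : \forall u \near coord X p p, ccod (rchart X p) u /\
    (posdef (gram X p u) ->
    forall v, 2^-1 * pnorm p v <= qnorm (gram X p u) v <= 2 * pnorm p v).
  have := cg _ (qnorm_perturb (pnorm_posdef p)).
  by apply: filterS2 (cod_nbhs pp) => u cu Hu; split.
have /nbhs_ballP[d /= d0 dH] := H.
have [k k0 kN] := qnorm_lower (pnorm_posdef p).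
exists (k * d / 2); first by rewrite divr_gt0 ?mulr_gt0.
move=> u Nu; have [|cu Hu] := dH u.
  rewrite -ball_normE/= distrC -(ltr_pM2l k0).
  apply: le_lt_trans (kN _) _; apply: le_lt_trans Nu _.
  by rewrite ltr_pdivrMr// ltr_pMr ?mulr_gt0// ltr1n.
split => //; apply: Hu; split; first exact: gram_sym cu.
by move=> v; exact: gram_pos.
Qed.

Lemma good_radiusW p s s' : s <= s' -> good_radius p s' -> good_radius p s.
Proof. by move=> ss' gs u us; apply: gs; exact: le_trans ss'. Qed.

Lemma pnorm_coord_cts p x : dom p x ->
  {for x, continuous (fun y => pnorm p (coord X p y - coord X p p))}.
Proof.
move=> px; apply: (@cvg_qnorm _ _ _ (nbhs x)); first exact: cvg_cst.
by apply: cvgB; [exact: coord_cts|exact: cvg_cst].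
Qed.

Lemma qball_open p s x : qball p s x -> nbhs x (qball p s).
Proof.
move=> [px xs]; have := pnorm_coord_cts px.
move=> /(_ _ (open_nbhs_nbhs (conj (@open_lt _ s) xs))).
by apply: filterS2 (dom_nbhs px) => y py ys; split.
Qed.

Lemma qball_center p s : 0 < s -> qball p s p.
Proof. by move=> s0; split; [exact: rchart_self|rewrite subrr /pnorm qnorm0]. Qed.

Lemma qball_nbhs p s : 0 < s -> nbhs p (qball p s).
Proof. by move=> /qball_center/qball_open. Qed.

Lemma qballW p s s' : s <= s' -> qball p s `<=` qball p s'.
Proof. by move=> ss' x [px xs]; split => //; exact: lt_le_trans ss'. Qed.

Lemma closed_coord_preimage p (K : set 'rV[R]_n) : compact K ->
  K `<=` ccod (rchart X p) -> closed [set x | dom p x /\ K (coord X p x)].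
Proof.
move=> cK Kc; rewrite (_ : [set x | _] = cinv (rchart X p) @` K).
  apply: compact_closed; first exact: (rhausdorff X).
  apply: continuous_compact => //; apply: continuous_in_subspaceT => u.
  by rewrite inE => /Kc; exact: cinv_cts.
apply/seteqP; split => [x [px xK]|_ [u Ku <-]].
  by exists (coord X p x) => //; rewrite coordK.
by have cu := Kc _ Ku; split; [exact: cinv_dom|rewrite cinvK].
Qed.

Lemma closed_qball p s : good_radius p s ->
  closed [set x | dom p x /\ pnorm p (coord X p x - coord X p p) <= s].
Proof.
move=> gs; pose K := [set u | pnorm p (u - coord X p p) <= s].
have [k k0 kN] := qnorm_lower (pnorm_posdef p).
have cK : compact K.
  apply: bounded_closed_compact.
    exists (k^-1 * s + `|coord X p p|); split; first exact: num_real.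
    move=> r rs u Ku; apply: le_trans (ltW rs).
    rewrite -(subrK (coord X p p) u); apply: le_trans (ler_normD _ _) _.
    by rewrite lerD2r ler_pdivlMl//; exact: le_trans (kN _) Ku.
  rewrite (_ : K = (fun u => pnorm p (u - coord X p p)) @^-1` [set r | r <= s])//.
  apply: preimage_closed; last exact: closed_le.
  move=> u _; apply: (@cvg_qnorm _ _ _ (nbhs u)); first exact: cvg_cst.
  by apply: cvgB; [exact: cvg_id|exact: cvg_cst].
by apply: closed_coord_preimage cK _ => u Ku; have [] := gs _ Ku.
Qed.

(** Pairing the curve with its displacement [e] reduces the estimate to a scalar integral: the
    pairing grows by [l ^+ 2], at a rate at most [2 * l] times the speed by Cauchy-Schwarz and the
    choice of the radius. *)
Lemma path_lower p s c b : good_radius p s -> 0 <= b <= 1 ->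
  (forall t, 0 <= t <= 1 -> C1_curve_at X c t) ->
  (forall t, 0 <= t <= b -> dom p (c t) /\
     pnorm p (coord X p (c t) - coord X p p) <= s) ->
  ((2^-1 * pnorm p (coord X p (c b) - coord X p (c 0%R)))%:E <= path_length X c)%E.
Proof.
move=> gs /andP[b0 b1] Cc cb.
have speed0 t : 0 <= speed X c t by exact: qnorm_ge0.
set e := coord X p (c b) - coord X p (c 0).
have [e0|e0] := eqVneq e 0.
  rewrite e0 /pnorm qnorm0 mulr0; apply: integral_ge0 => t _.
  by rewrite lee_fin; exact: speed0.
have bpos : 0 < b.
  by rewrite lt_neqAle b0 andbT; apply: contra e0 => /eqP b00; rewrite /e -b00 subrr.
have cb' t : 0 <= t <= b -> C1_curve_at X c t.
  by move=> /andP[t0 tb]; apply: Cc; rewrite t0 (le_trans tb).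
have l0 : 0 < pnorm p e by apply: qnorm_gt0.
set l := pnorm p e in l0 *.
pose F t := bform (gramx X p p) (coord X p (c t)) e.
pose f t := bform (gramx X p p) (derive1 (coord X p \o c) t) e.
have FTC : (\int[lebesgue_measure]_(t in `[0%R, b]) (f t)%:E = (F b - F 0)%:E)%E.
  apply: FTC_segment => // t tb.
    have [/nbhs_singleton[_ _ dt] _] := C1_curve_chart (cb' _ tb) (cb _ tb).1.
    have dij := is_derive_entry 0 _ dt.
    have -> : F = (fun t => \sum_i (coord X p (c t)) 0 i * (gramx X p p *m e^T) i 0).
      by apply/funext => r; rewrite /F /bform -mulmxA mxE.
    have -> : f t = \sum_i (derive1 (coord X p \o c) t) 0 i * (gramx X p p *m e^T) i 0.
      by rewrite /f /bform -mulmxA mxE.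
    rewrite (_ : (fun _ => _) = \sum_(i < n) (fun t => coord X p (c t) 0 i * (gramx X p p *m e^T) i 0)); last first.
      by apply/funext => r; rewrite fct_sumE.
    apply: is_derive_sum => i.
    have := @is_deriveM _ _ (fun t => coord X p (c t) 0 i)
      (cst ((gramx X p p *m e^T) i 0)) t 1 _ 0 (dij i) (is_derive_cst _ _ _).
    by rewrite scaler0 add0r /= [_ *: _]mulrC.
  have [_ ct] := C1_curve_chart (cb' _ tb) (cb _ tb).1.
  by apply: cvg_bform; [exact: cvg_cst|exact: ct|exact: cvg_cst].
have fle t : 0 <= t <= b -> f t <= 2 * l * speed X c t.
  move=> tb; have [pt st] := cb _ tb.
  have [/nbhs_singleton[ct _ dt] _] := C1_curve_chart (cb' _ tb) pt.
  rewrite (speed_chart ct pt dt); apply: le_trans (bform_CS _ _ (pnorm_posdef p)) _.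
  rewrite -/(pnorm p e) -/l mulrC [2 * l]mulrC -mulrA ler_pM2l//.
  by have [_ /(_ (derive1 (coord X p \o c) t))/andP[+ _]] := gs _ st; rewrite ler_pdivrMl.
have H : ((l ^+ 2)%:E <= (2 * l)%:E * path_length X c)%E.
  have -> : l ^+ 2 = F b - F 0.
    rewrite /F -[- bform _ _ _]mulN1r -bformZl -bformDl scaleN1r -/e.
    by rewrite /l /pnorm qnorm_sqr.
  rewrite -FTC path_lengthE -ge0_integralZl//; last first.
  - by rewrite lee_fin mulr_ge0// ltW.
  - by move=> t _; rewrite lee_fin.
  - have /integrableP[] : lebesgue_measure.-integrable `[0%R, 1%R] (EFin \o speed X c) => //.
    apply: continuous_compact_integrable; first exact: segment_compact.
    by apply: continuous_within_cc => t /Cc; exact: speed_cts.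
  have lspeed t : 0 <= t <= 1 -> {for t, continuous (fun t => 2 * l * speed X c t)}.
    by move=> /Cc/speed_cts cs; apply: cvgM; [exact: cvg_cst|exact: cs].
  apply: (@le_trans _ _ (\int[lebesgue_measure]_(t in `[0%R, b]) (2 * l * speed X c t)%:E)%E).
    apply: integral_segment_le => // t tb.
      have [_ ct] := C1_curve_chart (cb' _ tb) (cb _ tb).1.
      by apply: cvg_bform; [exact: cvg_cst|exact: ct|exact: cvg_cst].
    by apply: lspeed; move: tb => /andP[-> /le_trans ->].
  by apply: (@integral_segment_subset _ (fun t => 2 * l * speed X c t)) => //;
    [rewrite b0|move=> t; rewrite !mulr_ge0// ltW].
have l2 : 0 < 2 * l by rewrite mulr_gt0.
rewrite -(@lee_pmul2l _ (2 * l)%:E)//; apply: le_trans H.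
by rewrite -EFinM lee_fin expr2; lra.
Qed.

Lemma pnorm_tri p u v w : pnorm p (u - w) <= pnorm p (u - v) + pnorm p (v - w).
Proof. by rewrite -(subrKA v) qnormD. Qed.

Lemma pnormC p v w : pnorm p (v - w) = pnorm p (w - v).
Proof. by rewrite /pnorm -qnormN opprB. Qed.

(** Between radius [s] and the boundary of radius [4 * s] the displacement is at least [3 * s], of
    which the comparison of metrics keeps half. *)
Lemma path_exit p s c : good_radius p (4 * s) -> qball p s (c 0) ->
  (forall t, 0 <= t <= 1 -> C1_curve_at X c t) ->
  (exists2 t, 0 <= t <= 1 & ~ qball p (4 * s) (c t)) ->
  ((3 / 2 * s)%:E <= path_length X c)%E.
Proof.
move=> gs [p0 cs] Cc [t1 t101 nt1].
have s0 : 0 < s by apply: le_lt_trans cs; exact: qnorm_ge0.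
have [||t [/andP[t0 tle1] nt bt]] := @first_exit R (fun t => qball p (4 * s) (c t)) t1 t101 _ nt1.
- by apply: (@qballW p s) => //; rewrite ler_peMl ?ler1n// ltW.
- move=> t t01 ct; have [cct _ _] := nbhs_singleton (Cc t t01).
  by apply: cct; exact: qball_open.
have t01 : 0 <= t <= 1 by rewrite ltW.
have [cct _ _] := nbhs_singleton (Cc t t01).
(* At the exit time the curve is still in the chart: the closed ball is closed in [M], which is
   Hausdorff. *)
have [pt st] : [set x | dom p x /\ pnorm p (coord X p x - coord X p p) <= 4 * s] (c t).
  apply: (@closed_cvg _ _ (t^'-) _ (fun r => c r)); first exact: closed_qball gs.
    near=> r; have [] : qball p (4 * s) (c r).
      apply: bt; apply/andP; split; last by near: r; exact: nbhs_left_lt.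
      by near: r; apply: nbhs_left_ge.
    by move=> pr sr; split => //; exact: ltW.
  by apply: cvg_at_left_filter; exact: cct.
have st4 : pnorm p (coord X p (c t) - coord X p p) = 4 * s.
  apply/eqP; rewrite eq_le st/= leNgt; apply/negP => lt4; apply: nt; split => //.
have := @path_lower p (4 * s) c t gs t01 Cc; set L := path_length _ _ => H.
apply: le_trans (H _).
  rewrite lee_fin; have := pnorm_tri p (coord X p (c t)) (coord X p (c 0)) (coord X p p).
  by rewrite st4; lra.
move=> r /andP[r0]; rewrite le_eqVlt => /predU1P[->//|rt].
have [pr /ltW sr] : qball p (4 * s) (c r) by apply: bt; rewrite r0.
by split.
Unshelve. all: by end_near. Qed.

Lemma rdist_exit p s y z : good_radius p (4 * s) -> qball p s y ->
  ~ qball p (4 * s) z -> ((3 / 2 * s)%:E <= rdist X y z)%E.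
Proof.
move=> gs ys nz; apply: le_ereal_inf_tmp => _ [c [c0 c1 Cc] <-].
apply: path_exit gs _ Cc _; first by rewrite c0.
by exists 1; [rewrite ler01 lexx|rewrite c1].
Qed.

Lemma rdist_lower p s y z : good_radius p (4 * s) -> qball p s y -> qball p s z ->
  ((2^-1 * pnorm p (coord X p y - coord X p z))%:E <= rdist X y z)%E.
Proof.
move=> gs ys zs; apply: le_ereal_inf_tmp => _ [c [c0 c1 Cc] <-].
have [[t t01 nt]|in4] := pselect (exists2 t, 0 <= t <= 1 & ~ qball p (4 * s) (c t)).
  (* The displacement is below [2 * s], so half of it is below the length of any curve that leaves
     the large ball. *)
  apply: (@le_trans _ _ (3 / 2 * s)%:E).
    rewrite lee_fin; have := pnorm_tri p (coord X p y) (coord X p p) (coord X p z).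
    have [_ ys'] := ys; have [_ zs'] := zs.
    have s0 : 0 < s by apply: le_lt_trans ys'; exact: qnorm_ge0.
    by rewrite (pnormC p (coord X p p)); lra.
  by apply: path_exit gs _ Cc _; [rewrite c0|exists t].
rewrite pnormC -c0 -c1; apply: path_lower gs _ Cc _; first by rewrite ler01 lexx.
move=> t t01; have : qball p (4 * s) (c t).
  by apply: contrapT => nt; apply: in4; exists t.
by move=> [pt /ltW].
Qed.

(** The coordinate segment from [y] to [z] stays in the ball by convexity, and its speed is at most
    twice its constant frozen speed. *)
Lemma rdist_upper p s y z : good_radius p s -> qball p s y -> qball p s z ->
  (rdist X y z <= (2 * pnorm p (coord X p y - coord X p z))%:E)%E.
Proof.
move=> gs [py ys] [pz zs].
pose v : 'rV[R]_n := coord X p z - coord X p y.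
pose g (t : R) : 'rV[R]_n := coord X p y + t *: v.
pose c t := cinv (rchart X p) (g t).
have gin t : 0 <= t <= 1 -> pnorm p (g t - coord X p p) < s.
  move=> /andP[t0 t1].
  have -> : g t - coord X p p =
     (1 - t) *: (coord X p y - coord X p p) + t *: (coord X p z - coord X p p).
    by apply/rowP => i; rewrite !mxE; ring.
  apply: le_lt_trans (qnormD _ _ (pnorm_posdef p)) _.
  rewrite !qnormZ (ger0_norm t0) ger0_norm ?subr_ge0//.
  rewrite -!/(pnorm p _).
  move: ys zs; set a := pnorm _ _; set b := pnorm _ _ => ys zs.
  have h1 : 0 <= (1 - t) * (s - a) by rewrite mulr_ge0 ?subr_ge0// ltW.
  have [t00|tpos] := eqVneq t 0; first by rewrite t00; lra.
  have h2 : 0 < t * (s - b) by rewrite mulr_gt0 ?subr_gt0// lt_neqAle eq_sym tpos.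
  lra.
have gcts t : {for t, continuous g}.
  by apply: cvgD; [exact: cvg_cst|apply: cvgZr_tmp; exact: cvg_id].
have gcod t : 0 <= t <= 1 -> ccod (rchart X p) (g t).
  by move=> /gin/ltW/gs[].
have gder (t : R) : is_derive t 1 g v.
  exact: is_derive_line.
have near_cod (t : R) : 0 <= t <= 1 -> \forall r \near t, ccod (rchart X p) (g r).
  by move=> /gcod gt; apply: gcts; apply: open_nbhs_nbhs; split => //; exact: cod_open.
have cder (t : R) : ccod (rchart X p) (g t) -> [/\ {for t, continuous c}, dom p (c t) &
    is_derive t 1 (coord X p \o c) v].
  move=> gt; split.
  - by apply: continuous_comp; [exact: gcts|exact: cinv_cts].
  - exact: cinv_dom.
  - have E : \forall r \near t, g r = (coord X p \o c) r.
      have : \forall r \near t, ccod (rchart X p) (g r).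
        by apply: gcts; apply: open_nbhs_nbhs; split => //; exact: cod_open.
      by apply: filterS => r gr; rewrite /= /c cinvK.
    exact: (near_eq_is_derive E (gder t)).
have Cc (t : R) : 0 <= t <= 1 -> C1_curve_at X c t.
  move=> t01; set q := c t.
  have [ct pt _] := cder t (gcod t t01).
  have H : \forall r \near t, ccod (rchart X p) (g r) /\ dom q (c r).
    have qd : \forall r \near t, dom q (c r).
      by apply: ct; apply: dom_nbhs; exact: rchart_self.
    by apply: filterS2 (near_cod t t01) qd.
  have dq (r : R) : ccod (rchart X p) (g r) /\ dom q (c r) ->
      is_derive r 1 (coord X q \o c) (v *m trans X p q (c r)).
    by move=> [/cder[cr pr dr] qr]; exact: (curve_chart cr pr qr dr).
  have := nbhs_interior H; apply: filterS => r Hr.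
  have [gr qr] := nbhs_singleton Hr; have [cr pr _] := cder r gr.
  split => //; first by have [] := dq r (conj gr qr).
  apply: (@continuous_near_eq _ _ _ (fun r => v *m trans X p q (c r))).
    by apply: filterS Hr => r' /dq[_]; rewrite derive1E.
  apply: cvg_mulmx; first exact: cvg_cst.
  exact: (cvg_comp _ _ cr (trans_cts pr qr)).
have c0 : c 0 = y by rewrite /c /g scale0r addr0 coordK.
have c1 : c 1 = z by rewrite /c /g scale1r addrC subrK coordK.
apply: (@le_trans _ _ (path_length X c)).
  by apply: ereal_inf_lbound; exists c.
rewrite path_lengthE.
apply: (@le_trans _ _ (\int[lebesgue_measure]_(t in `[0%R, 1%R]) (2 * pnorm p v)%:E)%E).
  apply: (@integral_segment_le _ _ (fun=> 2 * pnorm p v)) => [t /Cc|t _|t t01].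
    exact: speed_cts.
    exact: cst_continuous.
  have [ct pt dt] := cder t (gcod t t01).
  rewrite (speed_chart ct pt dt) /gramx /c (cinvK (gcod t t01)).
  by have [_ /(_ v)/andP[]] := gs _ (ltW (gin t t01)).
rewrite integral_cst//= lebesgue_measure_itv/= lte_fin ltr01 oppr0 adde0 mule1.
by rewrite lee_fin pnormC.
Qed.

End LocalDistance.
#[global] Hint Resolve pnorm_posdef : core.

(** * Hyperbolic sets *)

Section TangentMatrix.
Context {R : realType} {n : nat} {M : topologicalType} (X : riemannian R n M).
Implicit Types (f : M -> M) (p q x y z : M) (v w : 'rV[R]_n).

Local Notation dom p := (cdom (rchart X p)).

Definition tmx f x : 'M[R]_n := jac (in_coord X f x) (coord X x x).

Lemma tangent_mapE f x v : tangent_map X f x v = v *m tmx f x.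
Proof. by rewrite /tangent_map /tmx mul_jac. Qed.

Lemma secant_tmx alpha f x : 0 < alpha -> C1holder_map X alpha f ->
  secant X x (f x) f x (tmx f x).
Proof.
move=> a0 [cf /(_ x)[U [K [[oU Ux] [dU hU]]]]].
apply: secant_chart; first exact: rchart_self.
have UU : \forall u \near coord X x x, U u by exact: open_nbhs_nbhs.
apply: C1_secant; first by apply: filterS UU => u; exact: dU.
move=> e e0; pose e' := e / (`|K| + 1).
have K1 : 0 < `|K| + 1 by rewrite ltr_wpDl.
have e'0 : 0 < e' by rewrite divr_gt0.
(* Within this radius the Hoelder bound is at most [e]; the [+ 1] in [e'] covers [K = 0]. *)
pose d := e' `^ alpha^-1.
have d0 : 0 < d by rewrite powR_gt0.
have dd : \forall u \near coord X x x, `|u - coord X x x| < d.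
  by apply/nbhs_ballP; exists d => // u; rewrite -ball_normE/= distrC.
apply: filterS2 UU dd => u Uu ud w.
have Eu := mul_jac (in_coord X f x) u w.
have Ex := mul_jac (in_coord X f x) (coord X x x) w.
have E := f_equal2 (fun a b : 'rV[R]_n => `|a - b|) Eu Ex.
apply: (@le_trans _ _ (K * `|u - coord X x x| `^ alpha * `|w|)).
  apply: le_trans (hU u (coord X x x) w Uu Ux).
  by rewrite le_eqVlt; apply/orP; left; apply/eqP; exact: E.
apply: ler_wpM2r => //.
apply: (@le_trans _ _ (`|K| * d `^ alpha)).
  apply: (@le_trans _ _ (`|K| * `|u - coord X x x| `^ alpha)).
    by apply: ler_wpM2r; [exact: powR_ge0|exact: ler_norm].
  apply: ler_wpM2l => //; apply: ge0_ler_powR; rewrite ?nnegrE//.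
  - exact: ltW.
  - exact: ltW.
  - exact: ltW.
rewrite /d -powRrM mulVf ?gt_eqF// powRr1 ?(ltW e'0)//.
rewrite /e' mulrCA ger_pMr// ler_pdivrMr// mul1r.
by rewrite lerDl.
Qed.

(** The derivative of the [k]-th iterate, as a product along the orbit: each factor is read in the
    charts at the points of the orbit, like the metric and the splitting. *)
Fixpoint Dn f k x : 'M[R]_n :=
  if k is k'.+1 then Dn f k' x *m tmx f (iter k' f x) else 1%:M.

Lemma secant_Dn f k x : continuous f ->
  (forall y, secant X y (f y) f y (tmx f y)) ->
  secant X x (iter k f x) (iter k f) x (Dn f k x).
Proof.
move=> cf sf; elim: k => [|k IH] /=; first exact: secant_id.
apply: (@secant_comp _ _ _ X _ (iter k f x) _ (iter k f) f) => //.
elim: k {IH} => [|k IH] /=; first exact: cvg_id.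
by apply: (cvg_comp _ _ IH); exact: cf.
Qed.

End TangentMatrix.

Lemma iter_cts (T : topologicalType) (f : T -> T) k :
  continuous f -> continuous (iter k f).
Proof.
by move=> cf; elim: k => [|k IH] x /=; [exact: cvg_id|exact: (cvg_comp _ _ (IH x) (cf _))].
Qed.

Section Hyperbolic.
Context {R : realType} {n : nat} {M : topologicalType} (X : riemannian R n M).

(** A form that is symmetric under exchanging [f] with [finv] and [Es] with [Eu], so that each fact
    about [Es] yields one about [Eu]. One step of contraction is enough, as the metric is
    adapted. *)
Record hyperbolic (f finv : M -> M) (Lambda : set M)
    (Es Eu : M -> 'M[R]_n) (chi : R) : Prop := Hyperbolic {
  hyp_fK : cancel f finv;
  hyp_finvK : cancel finv f;
  hyp_f_cts : continuous f;
  hyp_finv_cts : continuous finv;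
  hyp_f_secant : forall x, secant X x (f x) f x (tmx X f x);
  hyp_finv_secant : forall x, secant X x (finv x) finv x (tmx X finv x);
  hyp_compact : compact Lambda;
  hyp_fL : forall x, Lambda x -> Lambda (f x);
  hyp_finvL : forall x, Lambda x -> Lambda (finv x);
  hyp_chi : 0 < chi < 1;
  hyp_split : forall x (v : 'rV[R]_n), Lambda x ->
    exists s u, [/\ (s <= Es x)%MS, (u <= Eu x)%MS & v = s + u];
  hyp_direct : forall x (v : 'rV[R]_n), Lambda x -> (v <= Es x)%MS -> (v <= Eu x)%MS -> v = 0;
  hyp_f_Es : forall x (v : 'rV[R]_n), Lambda x -> (v <= Es x)%MS -> (v *m tmx X f x <= Es (f x))%MS;
  hyp_f_Eu : forall x (v : 'rV[R]_n), Lambda x -> (v <= Eu x)%MS -> (v *m tmx X f x <= Eu (f x))%MS;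
  hyp_finv_Es : forall x (v : 'rV[R]_n), Lambda x -> (v <= Es x)%MS -> (v *m tmx X finv x <= Es (finv x))%MS;
  hyp_finv_Eu : forall x (v : 'rV[R]_n), Lambda x -> (v <= Eu x)%MS -> (v *m tmx X finv x <= Eu (finv x))%MS;
  hyp_contract_Es : forall x (v : 'rV[R]_n), Lambda x -> (v <= Es x)%MS ->
    gnorm X (f x) (v *m tmx X f x) <= chi * gnorm X x v;
  hyp_contract_Eu : forall x (v : 'rV[R]_n), Lambda x -> (v <= Eu x)%MS ->
    gnorm X (finv x) (v *m tmx X finv x) <= chi * gnorm X x v }.

Lemma hyperbolic_inv f finv Lambda Es Eu chi :
  hyperbolic f finv Lambda Es Eu chi -> hyperbolic finv f Lambda Eu Es chi.
Proof.
move=> H; split.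
- exact: (hyp_finvK H).
- exact: (hyp_fK H).
- exact: (hyp_finv_cts H).
- exact: (hyp_f_cts H).
- exact: (hyp_finv_secant H).
- exact: (hyp_f_secant H).
- exact: (hyp_compact H).
- exact: (hyp_finvL H).
- exact: (hyp_fL H).
- exact: (hyp_chi H).
- move=> x v Lx; have [s [u [ss uu ->]]] := hyp_split H v Lx.
  by exists u, s; rewrite addrC.
- by move=> x v Lx vu vs; apply: (hyp_direct H Lx).
- exact: (hyp_finv_Eu H).
- exact: (hyp_finv_Es H).
- exact: (hyp_f_Eu H).
- exact: (hyp_f_Es H).
- exact: (hyp_contract_Eu H).
- exact: (hyp_contract_Es H).
Qed.

Lemma tmxK f finv x : cancel f finv -> {for x, continuous f} ->
  (forall x, secant X x (f x) f x (tmx X f x)) ->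
  (forall x, secant X x (finv x) finv x (tmx X finv x)) ->
  tmx X f x *m tmx X finv (f x) = 1%:M.
Proof.
move=> fK cf sf si.
have := secant_comp cf (sf x) (si (f x)); rewrite fK => H.
apply: (secant_unique (rchart_self X x) H) => e e0.
have [ O Ox HO] := secant_id X x x e0.
by exists O => // y z Oy Oz; rewrite /= !fK; exact: HO.
Qed.

Lemma hyperbolic_setP alpha (f finv : M -> M) Lambda Es Eu chi : 0 < alpha ->
  C1holder_diffeo X alpha f finv -> hyperbolic_set X f finv Lambda Es Eu 1 chi ->
  hyperbolic f finv Lambda Es Eu chi.
Proof.
move=> a0 [fK finvK Cf Cfinv] [[cL fL] [_ chi01] sp inv con].
have fLP x : Lambda x -> Lambda (f x) by move=> Lx; rewrite -fL; exists x.
have finvLP x : Lambda x -> Lambda (finv x).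
  by move=> Lx; have : (f @` Lambda) x by [rewrite fL]; move=> [y Ly <-]; rewrite fK.
have sf x := secant_tmx x a0 Cf.
have si x := secant_tmx x a0 Cfinv.
have cf : continuous f by case: Cf.
have ci : continuous finv by case: Cfinv.
have invK x : tmx X finv x *m tmx X f (finv x) = 1%:M.
  exact: (tmxK finvK (ci x) si sf).
split => //.
- move=> x v Lx; have [full _] := sp x Lx.
  have /sub_addsmxP[[a b] /= ->] : (v <= Es x + Eu x)%MS by apply: submx_full.
  by exists (a *m Es x), (b *m Eu x); rewrite !submxMl.
- move=> x v Lx vs vu; have [_ dir] := sp x Lx.
  have /mxdirect_addsP E := dir.
  by apply/eqP; rewrite -submx0 -E sub_capmx vs.
- by move=> x v Lx; have [-> _] := inv x v Lx; rewrite tangent_mapE.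
- by move=> x v Lx; have [_ ->] := inv x v Lx; rewrite tangent_mapE.
(* Invariance under [f] is an equivalence, so at [finv x] it also gives invariance under [finv]. *)
- move=> x v Lx vs; have [-> _] := inv (finv x) (v *m tmx X finv x) (finvLP _ Lx).
  by rewrite tangent_mapE -mulmxA invK mulmx1 finvK.
- move=> x v Lx vs; have [_ ->] := inv (finv x) (v *m tmx X finv x) (finvLP _ Lx).
  by rewrite tangent_mapE -mulmxA invK mulmx1 finvK.
- move=> x v Lx vs; have [/(_ vs) + _] := con x v 1%N Lx.
  by rewrite mul1r expr1 -tangent_mapE.
- move=> x v Lx vs; have [_ /(_ vs)] := con x v 1%N Lx.
  by rewrite mul1r expr1 -tangent_mapE.
Qed.

Section Growth.
Context {f finv : M -> M} {Lambda : set M} {Es Eu : M -> 'M[R]_n} {chi : R}.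
Hypothesis H : hyperbolic f finv Lambda Es Eu chi.

Lemma iter_L k x : Lambda x -> Lambda (iter k f x).
Proof. by move=> Lx; elim: k => //= k; exact: (hyp_fL H). Qed.

Lemma Es_Dn k x (v : 'rV[R]_n) : Lambda x -> (v <= Es x)%MS ->
  (v *m Dn X f k x <= Es (iter k f x))%MS /\
  gnorm X (iter k f x) (v *m Dn X f k x) <= chi ^+ k * gnorm X x v.
Proof.
move=> Lx vs; elim: k => [|k [IH1 IH2]] /=.
  by rewrite mulmx1 expr0 mul1r.
have Lk := iter_L k Lx.
rewrite mulmxA; split; first exact: (hyp_f_Es H).
apply: le_trans (hyp_contract_Es H Lk IH1) _.
by rewrite exprS -mulrA ler_wpM2l//; have /andP[/ltW] := hyp_chi H.
Qed.

Lemma Eu_Dn k x (v : 'rV[R]_n) : Lambda x -> (v <= Eu x)%MS ->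
  (v *m Dn X f k x <= Eu (iter k f x))%MS /\
  gnorm X x v <= chi ^+ k * gnorm X (iter k f x) (v *m Dn X f k x).
Proof.
move=> Lx vs; elim: k => [|k [IH1 IH2]] /=.
  by rewrite mulmx1 expr0 mul1r.
have Lk := iter_L k Lx.
rewrite mulmxA; split; first exact: (hyp_f_Eu H).
have Lk1 := hyp_fL H Lk; have chi0 : 0 <= chi by have /andP[/ltW] := hyp_chi H.
have := hyp_contract_Eu H Lk1 (hyp_f_Eu H Lk IH1).
rewrite -mulmxA (tmxK (hyp_fK H) (@hyp_f_cts _ _ _ _ _ _ H _) (hyp_f_secant H) (hyp_finv_secant H)).
rewrite mulmx1 (hyp_fK H) => h.
apply: (le_trans IH2); rewrite exprSr -mulrA ler_wpM2l//.
by rewrite exprn_ge0.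
Qed.

(** The unstable component of [v] grows at least like [chi ^- k], hence vanishes if the images of
    [v] stay bounded. As [C] is arbitrary, constant factors lost in comparing distances do no
    harm. *)
Lemma bounded_Es x (v : 'rV[R]_n) (C : R) : Lambda x ->
  (forall k, gnorm X (iter k f x) (v *m Dn X f k x) <= C) -> (v <= Es x)%MS.
Proof.
move=> Lx vC; have [s [u [ss uu vE]]] := hyp_split H v Lx.
have [chi0 chi1] : 0 < chi /\ chi < 1 by have /andP[] := hyp_chi H.
pose B := `|C| + gnorm X x s + 1.
have B0 : 0 < B by rewrite /B ltr_wpDl// addr_ge0// gnormE qnorm_ge0.
have uB k : gnorm X x u <= chi ^+ k * B.
  have [_ h1] := Eu_Dn k Lx uu; have [_ h2] := Es_Dn k Lx ss.
  apply: (le_trans h1); rewrite ler_wpM2l ?exprn_ge0 ?(ltW chi0)//.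
  have -> : u *m Dn X f k x = v *m Dn X f k x - s *m Dn X f k x.
    by rewrite -mulmxBl vE [s + u]addrC addrK.
  rewrite gnormE; apply: le_trans (qnormD _ _ (gramx_posdef (rchart_self X _))) _.
  rewrite qnormN -!gnormE /B -addrA lerD//.
    by apply: le_trans (vC k) _; exact: ler_norm.
  apply: le_trans h2 _; apply: (@le_trans _ _ (gnorm X x s)); last by rewrite lerDl.
  apply: ler_piMl; first by rewrite gnormE qnorm_ge0.
  by apply: exprn_ile1; exact: ltW.
have u0 : gnorm X x u = 0.
  apply/eqP; rewrite eq_le gnormE qnorm_ge0 andbT -gnormE.
  have cv : (chi ^+ k * B) @[k --> \oo] --> 0 * B.
    by apply: cvgM; [apply: cvg_expr; rewrite ger0_norm ?ltW|exact: cvg_cst].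
  rewrite mul0r in cv; rewrite -(cvg_lim (@norm_hausdorff _ _) cv).
  by apply: limr_ge; [apply/cvg_ex; exists 0|exact: nearW].
have [u00|u00] := eqVneq u 0; first by rewrite vE u00 addr0.
have := qnorm_gt0 (gramx_posdef (rchart_self X x)) u00.
by rewrite -gnormE u0 ltxx.
Qed.

End Growth.
End Hyperbolic.

(** * Limits of secant directions *)

Section Normalization.
Context {R : realType} {n : nat}.

Lemma normalized_cvg T (F : set_system T) (v : T -> 'rV[R]_n) :
  UltraFilter F -> (\forall t \near F, v t != 0) ->
  exists2 a : 'rV[R]_n, `|a| = 1 & `|v t|^-1 *: v t @[t --> F] --> a.
Proof.
move=> FU v0; have FP : ProperFilter F by exact: ultra_proper.
have norm1 t : v t != 0 -> `| `|v t|^-1 *: v t | = 1.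
  by move=> vt; rewrite normrZ normfV normr_id mulVf// normr_eq0.
have vb t : `| `|v t|^-1 *: v t | <= 1.
  have [->|/norm1->//] := eqVneq (v t) 0; by rewrite scaler0 normr0.
have [a va] := bounded_cvg FU vb.
exists a => //.
have na : `| `|v t|^-1 *: v t | @[t --> F] --> `|a| by exact: cvg_norm.
rewrite -(cvg_lim (@norm_hausdorff _ _) na).
apply: lim_near_cst; first exact: norm_hausdorff.
by apply: filterS v0 => t; exact: norm1.
Qed.

End Normalization.

Lemma cvg_near (T : Type) (U : topologicalType) (F : set_system T) (x : T -> U)
    (p : U) (N : set U) : x t @[t --> F] --> p -> nbhs p N -> \forall t \near F, N (x t).
Proof. by move=> xp; exact: xp. Qed.

(** * Convergence, distances and the growth of secants *)

Section LocalDynamics.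
Context {R : realType} {n : nat} {M : topologicalType} (X : riemannian R n M).
Implicit Types (p q x y z : M) (v w : 'rV[R]_n).

Local Notation dom p := (cdom (rchart X p)).

Lemma qball_basis p N : nbhs p N -> exists2 s : R, 0 < s & qball X p s `<=` N.
Proof.
move=> pN; have pp := rchart_self X p.
have /nbhs_ballP[d /= d0 dH] : nbhs (coord X p p) (cinv (rchart X p) @^-1` N).
  exact: cinv_cvg.
have [k k0 kN] := qnorm_lower (pnorm_posdef X p).
exists (k * d); first by rewrite mulr_gt0.
move=> x [px xs]; rewrite -(coordK px); apply: dH.
rewrite -ball_normE/= distrC -(ltr_pM2l k0); exact: le_lt_trans (kN _) xs.
Qed.

Lemma cvg_qball T (F : set_system T) {FF : Filter F} (x : T -> M) p :
  (forall s : R, 0 < s -> \forall t \near F, qball X p s (x t)) ->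
  x t @[t --> F] --> p.
Proof.
move=> H N /qball_basis[s s0 sN]; apply: filterS (H s s0) => t; exact: sN.
Qed.

Lemma gnorm_cvg T (F : set_system T) {FF : Filter F} p (x : T -> M)
    (v : T -> 'rV[R]_n) w : x t @[t --> F] --> p ->
  v t *m trans X (x t) p (x t) @[t --> F] --> w ->
  gnorm X (x t) (v t) @[t --> F] --> gnorm X p w.
Proof.
move=> xp vw; have pp := rchart_self X p.
have E : \forall t \near F, gnorm X (x t) (v t) =
    qnorm (gramx X p (x t)) (v t *m trans X (x t) p (x t)).
  apply: filterS (cvg_near xp (dom_nbhs pp)) => t pt.
  by rewrite gnormE; apply: gnorm_trans => //; exact: rchart_self.
have H : qnorm (gramx X p (x t)) (v t *m trans X (x t) p (x t)) @[t --> F]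
    --> gnorm X p w.
  by apply: cvg_qnorm => //; exact: (cvg_comp _ _ xp (gramx_cts pp)).
apply: cvg_trans H; apply: near_eq_cvg; apply: filterS E => t Et; exact: esym.
Qed.

Lemma rdist_cvg T (F : set_system T) {FF : Filter F} p (x y : T -> M) (e : R) :
  0 < e -> x t @[t --> F] --> p -> y t @[t --> F] --> p ->
  \forall t \near F, (rdist X (x t) (y t) < e%:E)%E.
Proof.
move=> e0 xp yp; have [s s0 gs] := good_radius_ex X p.
pose s' := Num.min s (e / 4).
have s'0 : 0 < s' by rewrite lt_min s0 divr_gt0.
have gs' : good_radius X p s' by apply: good_radiusW gs; rewrite ge_min lexx.
have xs := cvg_near xp (qball_nbhs X p s'0); have ys := cvg_near yp (qball_nbhs X p s'0).
apply: filterS2 xs ys => t xt yt.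
apply: le_lt_trans (rdist_upper gs' xt yt) _; rewrite lte_fin.
have [_ h1] := xt; have [_ h2] := yt.
have s'e : s' <= e / 4 by rewrite ge_min lexx orbT.
have := pnorm_tri X p (coord X p (x t)) (coord X p p) (coord X p (y t)).
rewrite (pnormC X p (coord X p p)); lra.
Qed.

Lemma cvg_rdist T (F : set_system T) {FF : Filter F} p (x y : T -> M) :
  x t @[t --> F] --> p ->
  (forall e : R, 0 < e -> \forall t \near F, (rdist X (x t) (y t) < e%:E)%E) ->
  y t @[t --> F] --> p.
Proof.
move=> xp xy; have [s s0 gs] := good_radius_ex X p.
apply: cvg_qball => r r0; pose s' := Num.min s r / 4.
have s'0 : 0 < s' by rewrite divr_gt0// lt_min s0.
have s's : 4 * s' = Num.min s r by rewrite mulrC divfK.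
have gs' : good_radius X p (4 * s') by apply: good_radiusW gs; rewrite s's ge_min lexx.
have xs := cvg_near xp (qball_nbhs X p s'0).
apply: filterS2 xs (xy s' s'0) => t xt xyt; apply: (@qballW _ _ _ X p (4 * s')).
  by rewrite s's ge_min lexx orbT.
apply: contrapT => nyt; have := rdist_exit gs' xt nyt.
rewrite leNgt => /negP; apply; apply: (lt_le_trans xyt).
by rewrite lee_fin; lra.
Qed.

Lemma rdist_eq0 x y : (rdist X x y <= 0)%E -> x = y.
Proof.
move=> xy0; have [s s0 gs] := good_radius_ex X x.
pose s' := s / 16; have s'0 : 0 < s' by rewrite divr_gt0.
have gs' : good_radius X x (4 * s') by apply: good_radiusW gs; rewrite /s'; lra.
have gs'' : good_radius X x (4 * (4 * s')) by apply: good_radiusW gs; rewrite /s'; lra.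
have xx := qball_center X x s'0.
have yx : qball X x (4 * s') y.
  apply: contrapT => ny; have := le_trans (rdist_exit gs' xx ny) xy0.
  by rewrite lee_fin leNgt mulr_gt0 ?divr_gt0.
have xx' : qball X x (4 * s') x by apply: qball_center; rewrite mulr_gt0.
have := le_trans (rdist_lower gs'' xx' yx) xy0.
rewrite lee_fin pmulr_rle0// => N0.
apply: (coord_inj (rchart_self X x) yx.1); apply/eqP; rewrite -subr_eq0.
apply: contraTT N0 => ne; rewrite -ltNge; exact: qnorm_gt0.
Qed.

(* Replaces the triangle inequality for [rdist] in limits. *)
Definition close (r : R) x y := forall N N', nbhs x N -> nbhs y N' ->
  exists x' y', [/\ N x', N' y' & (rdist X x' y' < r%:E)%E].

(** Coordinates are continuous, so the lower bound of [rdist] passes to the limit and puts [x] and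
    [y] at frozen distance at most [2 * r]; the upper bound doubles it. That [y] lies in the chart
    is a consequence, since short distances do not lead out of the ball of radius [4 * s]. *)
Lemma close_near p : exists2 s : R, 0 < s &
  \forall x \near p, forall r y, 0 < r <= s -> close r x y ->
    (rdist X x y <= (4 * r)%:E)%E.
Proof.
have [s0 s00 gs0] := good_radius_ex X p.
(* The lower bound is applied on the ball of radius [4 * s], and takes a good radius four times as
   large. *)
pose s := s0 / 16; have s_gt0 : 0 < s by rewrite divr_gt0.
have gs4 : good_radius X p (4 * s) by apply: good_radiusW gs0; rewrite /s; lra.
have gs5 : good_radius X p (5 * s) by apply: good_radiusW gs0; rewrite /s; lra.
have gs16 : good_radius X p (4 * (4 * s)) by apply: good_radiusW gs0; rewrite /s; lra.
exists s => //; apply: filterS (qball_nbhs X p s_gt0) => x xs r y /andP[r0 rs] cl.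
have px := xs.1.
have y4 : [set y | dom p y /\ pnorm X p (coord X p y - coord X p p) <= 4 * s] y.
  apply: (closed_qball gs4) => N Ny.
  have [x' [y' [x's Ny' xy']]] := cl _ _ (qball_open xs) Ny.
  exists y'; split => //; suff [py /ltW] : qball X p (4 * s) y' by [].
  apply: contrapT => ny; have := rdist_exit gs4 x's ny; rewrite leNgt => /negP; apply.
  by apply: (lt_le_trans xy'); rewrite lee_fin; lra.
have [py yn] := y4.
have x5 : qball X p (5 * s) x by apply: qballW xs; lra.
have y5 : qball X p (5 * s) y by split => //; apply: le_lt_trans yn _; lra.
apply: le_trans (rdist_upper gs5 x5 y5) _; rewrite lee_fin.
suff : pnorm X p (coord X p x - coord X p y) <= 2 * r by lra.
apply/ler_addgt0Pl => e e0.
pose D a := [set b | dom p b /\ pnorm X p (coord X p b - coord X p a) < e / 2].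
have Dn a : dom p a -> nbhs a (D a).
  move=> pa; have c : {for a, continuous (fun b => pnorm X p (coord X p b - coord X p a))}.
    apply: (@cvg_qnorm _ _ _ (nbhs a)); first exact: cvg_cst.
    by apply: cvgB; [exact: coord_cts|exact: cvg_cst].
  have cD : nbhs a (fun b => pnorm X p (coord X p b - coord X p a) < e / 2).
    apply: (c [set r | r < e / 2]).
    by apply: open_nbhs_nbhs; split; [exact: open_lt|rewrite /= subrr /pnorm qnorm0 divr_gt0].
  exact: filterI (dom_nbhs pa) cD.
have [x' [y' [[x's Dx'] Dy' xy']]] :=
  cl _ _ (filterI (qball_open xs) (Dn _ px)) (Dn _ py).
have y'4 : qball X p (4 * s) y'.
  apply: contrapT => ny; have := rdist_exit gs4 x's ny; rewrite leNgt => /negP; apply.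
  by apply: (lt_le_trans xy'); rewrite lee_fin; lra.
have x'4 : qball X p (4 * s) x' by apply: qballW x's; lra.
have := le_lt_trans (rdist_lower gs16 x'4 y'4) xy'; rewrite lte_fin => h.
have t1 := pnorm_tri X p (coord X p x) (coord X p x') (coord X p y).
have t2 := pnorm_tri X p (coord X p x') (coord X p y') (coord X p y).
have d1 := Dx'.2; have d2 := Dy'.2; rewrite pnormC in d1; lra.
Qed.

Lemma close_compact (K : set M) : compact K -> exists2 s : R, 0 < s &
  forall r x y, 0 < r <= s -> K x -> close r x y -> (rdist X x y <= (4 * r)%:E)%E.
Proof.
move=> /compact_near_coveringP cK.
have := cK R (0^'+) (fun s x => forall r y, 0 < r <= s -> close r x y ->
    (rdist X x y <= (4 * r)%:E)%E) _.
case.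
  move=> p Kp; have [s s0 Hs] := close_near p.
  exists ([set x | forall r y, 0 < r <= s -> close r x y -> (rdist X x y <= (4 * r)%:E)%E], [set t | t <= s]).
    by split => //=; apply: nbhs_right_le.
  move=> [x t] [/= Hx ts] r y /andP[r0 rt]; apply: Hx.
  by rewrite r0 (le_trans rt).
move=> d /= d0 dH; exists (d / 2); first by rewrite divr_gt0.
move=> r x y rd Kx; apply: (dH (d / 2) _ _ x Kx r y rd).
  by rewrite /ball_/= sub0r normrN gtr0_norm ?divr_gt0// ltr_pdivrMr// ltr_pMr// ltr1n.
by rewrite divr_gt0.
Qed.

(* The factor 4 is the loss in comparing [rdist] with [pnorm] twice. *)
Lemma secant_growth T (F : set_system T) {FF : ProperFilter F} f k p (y z : T -> M)
    (v : 'rV[R]_n) (C : R) : continuous f ->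
  (forall y, secant X y (f y) f y (tmx X f y)) ->
  y t @[t --> F] --> p -> z t @[t --> F] --> p ->
  `|coord X p (y t) - coord X p (z t)|^-1 *: (coord X p (y t) - coord X p (z t))
     @[t --> F] --> v ->
  (\forall t \near F, (rdist X (iter k f (y t)) (iter k f (z t)) <=
                       C%:E * rdist X (y t) (z t))%E) -> 0 <= C ->
  gnorm X (iter k f p) (v *m Dn X f k p) <= 4 * C * gnorm X p v.
Proof.
move=> cf sf yp zp xiv Hk C0; set q := iter k f p.
have cfk : {for p, continuous (iter k f)} by exact: iter_cts.
have fy : iter k f (y t) @[t --> F] --> q by exact: (cvg_comp _ _ yp cfk).
have fz : iter k f (z t) @[t --> F] --> q by exact: (cvg_comp _ _ zp cfk).
have lim := secant_lim (secant_Dn k p cf sf) yp zp xiv.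
have [s s0 gs] := good_radius_ex X p; have [r r0 gr] := good_radius_ex X q.
have s4 : 0 < r / 4 by rewrite divr_gt0.
have gr' : good_radius X q (4 * (r / 4)) by apply: good_radiusW gr; lra.
have limq : qnorm (gramx X q q) (`|coord X p (y t) - coord X p (z t)|^-1 *:
    (coord X q (iter k f (y t)) - coord X q (iter k f (z t)))) @[t --> F] -->
    gnorm X q (v *m Dn X f k p).
  by apply: cvg_qnorm; [exact: cvg_cst|exact: lim].
have limp : 4 * C * qnorm (gramx X p p) (`|coord X p (y t) - coord X p (z t)|^-1 *:
    (coord X p (y t) - coord X p (z t))) @[t --> F] -->
    4 * C * gnorm X p v.
  by apply: cvgM; [exact: cvg_cst|apply: cvg_qnorm; [exact: cvg_cst|exact: xiv]].
rewrite -subr_ge0; apply: (cvgr_to_ge (cvgB limp limq)).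
have ys := cvg_near yp (qball_nbhs X p s0); have zs := cvg_near zp (qball_nbhs X p s0).
have fys := cvg_near fy (qball_nbhs X q s4); have fzs := cvg_near fz (qball_nbhs X q s4).
apply: filterS (filterI (filterI ys zs) (filterI (filterI fys fzs) Hk)).
move=> t [[yt zt] [[fyt fzt] h3]].
rewrite fctE subr_ge0 !qnormZ !ger0_norm ?invr_ge0// mulrCA.
apply: ler_wpM2l; first by rewrite invr_ge0.
have h1 := rdist_lower gr' fyt fzt; have h2 := rdist_upper gs yt zt.
have C0' : (0 <= C%:E)%E by rewrite lee_fin.
have := le_trans h1 (le_trans h3 (lee_wpmul2l C0' h2)).
by rewrite -EFinM lee_fin /pnorm -/q; lra.
Qed.

End LocalDynamics.

(** * Expansivity *)

(** The pairs of [m]-th iterates for [m] in the integers, generated inductively: the relation treats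
    future and past alike, and can be restarted at any of its members. *)
Inductive orbit_pair (T : Type) (f finv : T -> T) (a b : T) : T -> T -> Prop :=
| orbit_pair_refl : orbit_pair f finv a b a b
| orbit_pair_f x y : orbit_pair f finv a b x y -> orbit_pair f finv a b (f x) (f y)
| orbit_pair_finv x y :
    orbit_pair f finv a b x y -> orbit_pair f finv a b (finv x) (finv y).

Section OrbitPair.
Context {T : Type} {f finv : T -> T}.

Lemma orbit_pair_iter a b k : orbit_pair f finv a b (iter k f a) (iter k f b).
Proof. by elim: k => [|k IH] /=; constructor. Qed.

Lemma orbit_pair_iterV a b k : orbit_pair f finv a b (iter k finv a) (iter k finv b).
Proof. by elim: k => [|k IH] /=; constructor. Qed.

Lemma orbit_pair_trans a b x y z w : orbit_pair f finv a b x y ->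
  orbit_pair f finv x y z w -> orbit_pair f finv a b z w.
Proof. by move=> ab; elim => // *; constructor. Qed.

Lemma orbit_pair_back a b x y : cancel f finv -> cancel finv f ->
  orbit_pair f finv a b x y -> orbit_pair f finv x y a b.
Proof.
move=> fK finvK; elim => [|{}x {}y _ IH|{}x {}y _ IH]; first exact: orbit_pair_refl.
- have := orbit_pair_finv (orbit_pair_refl f finv (f x) (f y)); rewrite !fK => h.
  exact: orbit_pair_trans h IH.
- have := orbit_pair_f (orbit_pair_refl f finv (finv x) (finv y)); rewrite !finvK => h.
  exact: orbit_pair_trans h IH.
Qed.

Lemma orbit_pair_iterE a b x y : cancel f finv -> cancel finv f ->
  orbit_pair f finv a b x y ->
  (exists k, x = iter k f a /\ y = iter k f b) \/
  (exists k, x = iter k finv a /\ y = iter k finv b).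
Proof.
move=> fK finvK; elim => [|{}x {}y _ [[k [-> ->]]|[k [-> ->]]]|{}x {}y _ [[k [-> ->]]|[k [-> ->]]]].
- by left; exists 0%N.
- by left; exists k.+1.
- case: k => [|k]; first by left; exists 1%N.
  by right; exists k; rewrite !iterS !finvK.
- case: k => [|k]; first by right; exists 1%N.
  by left; exists k; rewrite !iterS !fK.
- by right; exists k.+1.
Qed.

End OrbitPair.

Lemma mulmx_cancel (R : realType) (n : nat) (v : 'rV[R]_n) (A B C D : 'M[R]_n) :
  v *m A *m B = v -> v *m A *m (B *m C *m D) = v *m C *m D.
Proof. by move=> vAB; rewrite -(mulmxA B) !mulmxA vAB. Qed.

Section HyperbolicDynamics.
Context {R : realType} {n : nat} {M : topologicalType} (X : riemannian R n M).
Implicit Types (p q x y z : M).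

(** [Es] is characterised by bounds on the iterates, one for each [k], and each of them passes to
    the limit. This is how the continuity of the splitting enters. *)
Lemma Es_closed f finv Lambda Es Eu chi : hyperbolic X f finv Lambda Es Eu chi ->
  forall T (F : set_system T) {FF : ProperFilter F} p (x : T -> M) (v : T -> 'rV[R]_n) (w : 'rV[R]_n),
  Lambda p -> x t @[t --> F] --> p ->
  (\forall t \near F, Lambda (x t) /\ (v t <= Es (x t))%MS) ->
  v t *m trans X (x t) p (x t) @[t --> F] --> w -> (w <= Es p)%MS.
Proof.
move=> H T F FF p x v w Lp xp LE vw.
apply: (@bounded_Es _ _ _ _ _ _ _ _ _ _ H p w (gnorm X p w) Lp) => k.
have pp := rchart_self X p; set q := iter k f p.
have cfk : {for p, continuous (iter k f)} by apply: iter_cts; exact: (hyp_f_cts H).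
have fxq : iter k f (x t) @[t --> F] --> q by exact: (cvg_comp _ _ xp cfk).
have px := cvg_near xp (dom_nbhs pp).
have qfx := cvg_near fxq (dom_nbhs (rchart_self X q)).
(* The derivative of the iterate at [x t], brought to the fixed charts at [p] and [q], where
   matrices at different points can be compared. *)
pose J t := trans X p (x t) (x t) *m Dn X f k (x t) *m
  trans X (iter k f (x t)) q (iter k f (x t)).
have JD : J t @[t --> F] --> Dn X f k p.
  apply: (secant_cvg pp (secant_Dn k p (hyp_f_cts H) (hyp_f_secant H)) xp).
  apply: filterS (filterI px qfx) => t [pt qt].
  apply: (@secant_comp _ _ _ X _ (iter k f (x t)) _ (iter k f) id).
  - by apply: iter_cts; exact: (hyp_f_cts H).
  - apply: (@secant_comp _ _ _ X _ (x t) _ id (iter k f)).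
    + exact: cvg_id.
    + by apply: secant_trans => //; exact: rchart_self.
    + exact: (secant_Dn k (x t) (hyp_f_cts H) (hyp_f_secant H)).
  - by apply: secant_trans => //; exact: rchart_self.
have lim1 : gnorm X (iter k f (x t)) (v t *m Dn X f k (x t)) @[t --> F] -->
    gnorm X q (w *m Dn X f k p).
  apply: gnorm_cvg => //.
  have E : \forall t \near F, v t *m trans X (x t) p (x t) *m J t =
      v t *m Dn X f k (x t) *m trans X (iter k f (x t)) q (iter k f (x t)).
    apply: filterS px => t pt.
    have K := mul_transK (v t) (rchart_self X (x t)) pt.
    exact: (mulmx_cancel _ _ K).
  apply: (@cvg_trans _ ((v t *m trans X (x t) p (x t) *m J t) @[t --> F])).
    exact: near_eq_cvg.
  exact: cvg_mulmx.
have lim2 : gnorm X (x t) (v t) @[t --> F] --> gnorm X p w by exact: gnorm_cvg.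
rewrite -subr_ge0; apply: (cvgr_to_ge (cvgB lim2 lim1)).
apply: filterS LE => t [Lt vt]; rewrite fctE subr_ge0.
have [_ h] := Es_Dn H k Lt vt; apply: (le_trans h).
apply: ler_piMl; first by rewrite gnormE qnorm_ge0.
have /andP[chi0 chi1] := hyp_chi H.
by apply: exprn_ile1; exact: ltW.
Qed.

(** If the angle between [Es] at [q] and [Eu] at [a] were not bounded below near [p], normalised
    vectors would converge to a unit vector in both [Es p] and [Eu p]. The base points are
    independent because one use has the stable space at the base of a local manifold and the
    unstable space at another of its points. *)
Lemma transversality f finv Lambda Es Eu chi : hyperbolic X f finv Lambda Es Eu chi ->
  forall p, Lambda p -> exists2 e : R, 0 < e & exists2 N, nbhs p N &
  forall q a (u s : 'rV[R]_n), Lambda q -> N q -> Lambda a -> N a -> (u <= Eu a)%MS -> (s <= Es q)%MS ->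
    `|u *m trans X a p a - s *m trans X q p q| <= e * `|u *m trans X a p a| ->
    u *m trans X a p a = 0.
Proof.
move=> H p Lp; apply: contrapT => Hn.
pose T := ((M * M) * ('rV[R]_n * 'rV[R]_n))%type.
pose hu (t : T) := t.2.1 *m trans X t.1.2 p t.1.2.
pose hs (t : T) := t.2.2 *m trans X t.1.1 p t.1.1.
(* The counterexamples for all [(e, N)] form the base of a filter, so that no sequence has to be
   chosen. *)
pose B (i : R * set M) : set T := [set t |
  [/\ Lambda t.1.1 /\ i.2 t.1.1, Lambda t.1.2 /\ i.2 t.1.2,
      (t.2.1 <= Eu t.1.2)%MS /\ (t.2.2 <= Es t.1.1)%MS,
      `|hu t - hs t| <= i.1 * `|hu t| & hu t != 0]].
pose D := [set i : R * set M | 0 < i.1 /\ nbhs p i.2].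
pose F := filter_from D B.
have FF : ProperFilter F.
  apply: filter_from_proper.
    apply: filter_from_filter; first by exists (1, setT); split => //=; exact: filterT.
    move=> [e N] [e' N'] [/= e0 pN] [/= e'0 pN'].
    exists (Num.min e e', N `&` N'); first by split => /=; [rewrite lt_min e0|exact: filterI].
    move=> t [/= [Lq [Nq Nq']] [La [Na Na']] Et ht ht0].
    by split; split => //=; apply: (le_trans ht); rewrite ler_wpM2r// ge_min lexx ?orbT.
  move=> [e N] [/= e0 pN]; apply: contrapT => BN; apply: Hn.
  exists e => //; exists N => // q a u s Lq Nq La Na uu ss us.
  apply/eqP; apply: contrapT => /negP ne; apply: BN.
  by exists ((q, a), (u, s)).
have [G [GU FG]] := ultraFilterLemma FF.
have GP : ProperFilter G by exact: ultra_proper.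
have GB e N : 0 < e -> nbhs p N -> G (B (e, N)).
  by move=> e0 pN; apply: FG; exists (e, N).
have qp : t.1.1 @[t --> G] --> p.
  by move=> N pN; apply: (@filterS _ G _ _ _ _ (GB 1 N ltr01 pN)) => t [[_ ?]].
have ap : t.1.2 @[t --> G] --> p.
  by move=> N pN; apply: (@filterS _ G _ _ _ _ (GB 1 N ltr01 pN)) => t [_ [_ ?]].
have pT : nbhs p (setT : set M) by exact: filterT.
have GB1 := GB 1 setT ltr01 pT.
have hu0 : G [set t | hu t != 0] by apply: (@filterS _ G _ _ _ _ GB1) => t [].
have [v v1 huv] := normalized_cvg GU hu0.
have hsv : `|hu t|^-1 *: hs t @[t --> G] --> v.
  have d0 : (`|hu t|^-1 *: (hu t - hs t)) @[t --> G] --> (0 : 'rV[R]_n).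
    apply/cvgrPdist_le => e e0; apply: (@filterS _ G _ _ _ _ (GB e setT e0 pT)) => t [_ _ _ ht ht0].
    rewrite sub0r normrN normrZ normfV normr_id ler_pdivrMl ?normr_gt0//.
    by rewrite mulrC.
  have -> : (fun t => `|hu t|^-1 *: hs t) =
    (fun t => `|hu t|^-1 *: hu t - `|hu t|^-1 *: (hu t - hs t)).
    by apply/funext => t; rewrite scalerBr opprB addrC subrK.
  by rewrite -[v]subr0; exact: cvgB.
have vu : (v <= Eu p)%MS.
  apply: (Es_closed (hyperbolic_inv H) (x := fun t : T => t.1.2)
    (v := fun t : T => `|hu t|^-1 *: t.2.1) Lp ap).
    by apply: (@filterS _ G _ _ _ _ GB1) => t [_ [La _] [ut _] _ _]; split => //; exact: scalemx_sub.
  by under eq_fun do rewrite -scalemxAl; exact: huv.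
have vs : (v <= Es p)%MS.
  apply: (Es_closed H (x := fun t : T => t.1.1)
    (v := fun t : T => `|hu t|^-1 *: t.2.2) Lp qp).
    by apply: (@filterS _ G _ _ _ _ GB1) => t [[Lq _] _ [_ st] _ _]; split => //; exact: scalemx_sub.
  by under eq_fun do rewrite -scalemxAl; exact: hsv.
have v0 := hyp_direct H Lp vs vu.
by move: v1; rewrite v0 normr0 => /eqP; rewrite eq_sym oner_eq0.
Qed.

Section Expansivity.
Context {f finv : M -> M} {Lambda : set M} {Es Eu : M -> 'M[R]_n} {chi : R}.
Hypothesis H : hyperbolic X f finv Lambda Es Eu chi.

Lemma orbit_pair_L x y z w : orbit_pair f finv x y z w -> Lambda x -> Lambda y ->
  Lambda z /\ Lambda w.
Proof.
move=> xy Lx Ly; elim: xy => [//|{}z {}w _ []|{}z {}w _ []].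
  by move=> Lz Lw; split; exact: (hyp_fL H).
by move=> Lz Lw; split; exact: (hyp_finvL H).
Qed.

(** The distances along the whole orbit are bounded, so some pair of iterates comes within a factor
    2 of their supremum. Seen from it, neither future nor past increases the distance by more than
    this factor. *)
Lemma near_sup_pair x y (r : R) : x <> y ->
  (forall z w, orbit_pair f finv x y z w -> (rdist X z w <= r%:E)%E) ->
  exists x' y', [/\ orbit_pair f finv x y x' y', x' <> y' &
    forall z w, orbit_pair f finv x' y' z w -> (rdist X z w <= 2%:E * rdist X x' y')%E].
Proof.
move=> xy xyr.
pose S := [set fine (rdist X zw.1 zw.2) | zw in [set zw | orbit_pair f finv x y zw.1 zw.2]].
have d0 z w : (0 <= rdist X z w)%E.
  apply: le_ereal_inf_tmp => _ [c _ <-]; apply: integral_ge0 => t _.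
  by rewrite lee_fin; exact: qnorm_ge0.
have dfin z w : orbit_pair f finv x y z w -> rdist X z w \is a fin_num.
  by move=> /xyr h; rewrite ge0_fin_numE// (le_lt_trans h)// ltry.
have hS : has_sup S.
  split; first by exists (fine (rdist X x y)); exists (x, y) => //; exact: orbit_pair_refl.
  exists r => _ [[z w] /= zw <-].
  by rewrite -lee_fin fineK ?dfin//; exact: xyr.
have Sub z w : orbit_pair f finv x y z w -> fine (rdist X z w) <= sup S.
  by move=> zw; apply: ub_le_sup; [have [] := hS|exists (z, w)].
have s0 : 0 < sup S.
  apply: (@lt_le_trans _ _ (fine (rdist X x y))); last first.
    by apply: Sub; exact: orbit_pair_refl.
  rewrite lt_neqAle fine_ge0// andbT; apply/eqP => h; apply: xy.
  apply: (@rdist_eq0 _ _ _ X).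
  by rewrite -(fineK (dfin _ _ (orbit_pair_refl _ _ _ _))) -h.
have s20 : 0 < sup S / 2 by rewrite divr_gt0.
have [_ [[x' y'] /= x'y' <-] hx'] := sup_adherent s20 hS.
exists x', y'; split => //.
  move=> E; apply: xy; have := orbit_pair_back (hyp_fK H) (hyp_finvK H) x'y'.
  by rewrite E; elim=> // ? ? _ ->.
move=> z w zw; have zw' := orbit_pair_trans x'y' zw.
rewrite -(fineK (dfin _ _ zw')) -(fineK (dfin _ _ x'y')) -EFinM lee_fin.
by have := Sub _ _ zw'; lra.
Qed.

(** For radii [s / m.+1], near-maximal pairs of counterexamples converge to one point of [Lambda],
    and their directions to a unit vector with bounded future and bounded past. The hypothesis is
    stated with [close], which is what a bound on [rdist] becomes in the limit. *)
Lemma expansive : exists2 r : R, 0 < r & forall x y, Lambda x -> Lambda y ->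
  (forall z w, orbit_pair f finv x y z w -> close X r z w) -> x = y.
Proof.
have [s s0 Hs] := close_compact X (hyp_compact H).
apply: contrapT => Hn.
have Hm (m : nat) : exists xy : M * M, [/\ Lambda xy.1, Lambda xy.2, xy.1 <> xy.2,
    (rdist X xy.1 xy.2 <= (4 * (s / m.+1%:R))%:E)%E &
    forall z w, orbit_pair f finv xy.1 xy.2 z w -> (rdist X z w <= 2%:E * rdist X xy.1 xy.2)%E].
  apply: contrapT => Hnm; apply: Hn.
  have rm0 : 0 < s / m.+1%:R by rewrite divr_gt0.
  exists (s / m.+1%:R) => // x y Lx Ly cl; apply: contrapT => xy.
  have bd z w : orbit_pair f finv x y z w -> (rdist X z w <= (4 * (s / m.+1%:R))%:E)%E.
    move=> zw; have [Lz _] := orbit_pair_L zw Lx Ly.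
    apply: Hs (cl _ _ zw) => //; rewrite rm0/= ler_pdivrMr// ler_peMr ?(ltW s0)//.
    by rewrite ler1n.
  have [x' [y' [x'y' nxy hxy]]] := near_sup_pair xy bd.
  apply: Hnm; exists (x', y'); have [Lx' Ly'] := orbit_pair_L x'y' Lx Ly.
  by split => //=; exact: bd.
have [xy Hxy] := choice Hm.
have [G [GU FG]] := @ultraFilterLemma _ (\oo : set_system nat) _.
have GP : ProperFilter G by exact: ultra_proper.
have [p [Lp xp]] : Lambda `&` [set p | (xy m).1 @[m --> G] --> p] !=set0.
  have := hyp_compact H; rewrite compact_ultra; apply; first exact: ultra_fmap.
  by apply: (@filterE _ G) => m; have [] := Hxy m.
have yp : (xy m).2 @[m --> G] --> p.
  apply: (@cvg_rdist _ _ _ X _ G _ p (fun m => (xy m).1) _ xp) => e e0; apply: FG.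
  near=> m; have [_ _ _ h _] := Hxy m; apply: (le_lt_trans h); rewrite lte_fin.
  rewrite mulrA ltr_pdivrMr// -ltr_pdivrMl//.
  apply: (@lt_trans _ _ m%:R); last by rewrite ltr_nat.
  by near: m; exact: nbhs_infty_gtr.
have pp := rchart_self X p.
have xd := cvg_near xp (dom_nbhs pp); have yd := cvg_near yp (dom_nbhs pp).
have ne : \forall m \near G, coord X p (xy m).1 - coord X p (xy m).2 != 0.
  apply: filterS (filterI xd yd) => m [px py]; rewrite subr_eq0.
  by have [_ _ nxy _ _] := Hxy m; apply/eqP => /(coord_inj px py).
have [v v1 hv] := normalized_cvg GU ne.
have bd k : \forall m \near G, (rdist X (iter k f (xy m).1) (iter k f (xy m).2)
    <= 2%:E * rdist X (xy m).1 (xy m).2)%E.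
  by apply: (@filterE _ G) => m; have [_ _ _ _] := Hxy m; apply; exact: orbit_pair_iter.
have bd' k : \forall m \near G, (rdist X (iter k finv (xy m).1) (iter k finv (xy m).2)
    <= 2%:E * rdist X (xy m).1 (xy m).2)%E.
  by apply: (@filterE _ G) => m; have [_ _ _ _] := Hxy m; apply; exact: orbit_pair_iterV.
have vs : (v <= Es p)%MS.
  apply: (@bounded_Es _ _ _ _ _ _ _ _ _ _ H p v _ Lp) => k.
  exact: (secant_growth (hyp_f_cts H) (hyp_f_secant H) xp yp hv (bd k)).
have vu : (v <= Eu p)%MS.
  apply: (@bounded_Es _ _ _ _ _ _ _ _ _ _ (hyperbolic_inv H) p v _ Lp) => k.
  exact: (secant_growth (hyp_finv_cts H) (hyp_finv_secant H) xp yp hv (bd' k)).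
have v0 := hyp_direct H Lp vs vu.
by move: v1; rewrite v0 normr0 => /eqP; rewrite eq_sym oner_eq0.
Unshelve. all: by end_near. Qed.

(* Otherwise, in the limit, two distinct points have orbits that stay close in the
   future by assumption and in the past by contraction. *)
Lemma uniform_shrinking : exists2 r0 : R, 0 < r0 & forall (r : R) (W : set M),
  0 < r <= r0 ->
  (forall y z k, W y -> W z ->
     (rdist X (iter k finv y) (iter k finv z) <= rdist X y z)%E) ->
  forall e : R, 0 < e -> exists N, forall k y z, (N <= k)%N ->
    Lambda y -> Lambda z -> W y -> W z ->
    (forall i, (i < k)%N -> (rdist X (iter i f y) (iter i f z) < r%:E)%E) ->
    (rdist X y z < e%:E)%E /\ (rdist X z y < e%:E)%E.
Proof.
have [r0 r00 Hr0] := expansive.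
exists r0 => // r W /andP[r_gt0 rr0] WW e e0; apply: contrapT => Hn.
have Hm (m : nat) : exists yz : M * M, [/\ Lambda yz.1, Lambda yz.2, W yz.1 /\ W yz.2,
    (forall i, (i <= m)%N -> (rdist X (iter i f yz.1) (iter i f yz.2) < r%:E)%E) &
    ~ ((rdist X yz.1 yz.2 < e%:E)%E /\ (rdist X yz.2 yz.1 < e%:E)%E)].
  apply: contrapT => Hnm; apply: Hn; exists m.+1 => k y z mk Ly Lz Wy Wz Hi.
  apply: contrapT => ne; apply: Hnm; exists (y, z); split => //= i im.
  by apply: Hi; exact: leq_trans mk.
have [yz Hyz] := choice Hm.
have [G [GU FG]] := @ultraFilterLemma _ (\oo : set_system nat) _.
have GP : ProperFilter G by exact: ultra_proper.
have [a [La ya]] : Lambda `&` [set p | (yz m).1 @[m --> G] --> p] !=set0.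
  have := hyp_compact H; rewrite compact_ultra; apply; first exact: ultra_fmap.
  by apply: (@filterE _ G) => m; have [] := Hyz m.
have [b [Lb zb]] : Lambda `&` [set p | (yz m).2 @[m --> G] --> p] !=set0.
  have := hyp_compact H; rewrite compact_ultra; apply; first exact: ultra_fmap.
  by apply: (@filterE _ G) => m; have [] := Hyz m.
have ab : a = b.
  apply: Hr0 => // z w zw.
  have clos (g : nat -> M -> M) k : continuous (g k) ->
      (\forall m \near G, (rdist X (g k (yz m).1) (g k (yz m).2) < r0%:E)%E) ->
      close X r0 (g k a) (g k b).
    move=> cg hg N N' aN bN'.
    have h1 : \forall m \near G, N (g k (yz m).1) by exact: (cvg_comp _ _ ya (cg a)) aN.
    have h2 : \forall m \near G, N' (g k (yz m).2) by exact: (cvg_comp _ _ zb (cg b)) bN'.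
    have [m [[h1m h2m] h3m]] := filter_ex (filterI (filterI h1 h2) hg).
    by exists (g k (yz m).1), (g k (yz m).2).
  have [[k [-> ->]]|[k [-> ->]]] := orbit_pair_iterE (hyp_fK H) (hyp_finvK H) zw.
    apply: (clos (fun k => iter k f)); first by apply: iter_cts; exact: (hyp_f_cts H).
    apply: FG; exists k => // m /= km; have [_ _ _ + _] := Hyz m => /(_ k km).
    by move=> /lt_le_trans; apply; rewrite lee_fin.
  apply: (clos (fun k => iter k finv)); first by apply: iter_cts; exact: (hyp_finv_cts H).
  apply: (@filterE _ G) => m; have [_ _ [Wy Wz] + _] := Hyz m => /(_ 0%N (leq0n _))/= h.
  by apply: (le_lt_trans (WW _ _ k Wy Wz)); apply: (lt_le_trans h); rewrite lee_fin.
rewrite -ab in zb.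
have h1 : \forall m \near G, (rdist X (yz m).1 (yz m).2 < e%:E)%E by apply: (@rdist_cvg _ _ _ X _ G _ a _ _ e e0).
have h2 : \forall m \near G, (rdist X (yz m).2 (yz m).1 < e%:E)%E by apply: (@rdist_cvg _ _ _ X _ G _ a _ _ e e0).
have [m [h1m h2m]] := filter_ex (filterI h1 h2).
by have [_ _ _ _] := Hyz m; apply.
Qed.

End Expansivity.
End HyperbolicDynamics.

(** * Ordinary differential equations *)

Section Clamp.
Context {R : realType}.
Implicit Types a b x y : R.

Definition clamp a b x : R := Num.max a (Num.min b x).

Lemma max_lipschitz a x y : `|Num.max a x - Num.max a y| <= `|x - y|.
Proof.
case: (leP a x) => ?; case: (leP a y) => ?; rewrite ?subrr ?normr0//.
  by rewrite !ger0_norm; lra.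
by rewrite !ler0_norm; lra.
Qed.

Lemma min_lipschitz a x y : `|Num.min a x - Num.min a y| <= `|x - y|.
Proof.
case: (leP a x) => ?; case: (leP a y) => ?; rewrite ?subrr ?normr0//.
  by rewrite !ger0_norm; lra.
by rewrite !ler0_norm; lra.
Qed.

Lemma clamp_lipschitz a b x y : `|clamp a b x - clamp a b y| <= `|x - y|.
Proof. exact: le_trans (max_lipschitz _ _ _) (min_lipschitz _ _ _). Qed.

Lemma clamp_in a b x : a <= b -> a <= clamp a b x <= b.
Proof. by move=> ab; rewrite /clamp le_max lexx/= ge_max ab ge_min lexx. Qed.

Lemma clamp_id a b x : a <= x <= b -> clamp a b x = x.
Proof. by rewrite /clamp => /andP[ax xb]; rewrite (min_r xb) (max_r ax). Qed.

Lemma clamp_cts a b : continuous (clamp a b).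
Proof.
move=> x; apply/cvgrPdist_lt => e e0; near=> y.
apply: le_lt_trans (clamp_lipschitz _ _ _ _) _.
by near: y; apply: cvgr_dist_lt => //; exact: cvg_id.
Unshelve. all: by end_near. Qed.

(** Balls of the maximum norm are boxes, so that the entrywise clamp is a 1-Lipschitz retraction: it
    extends a field that is Lipschitz on a ball to the whole space, with the same constant. *)
Definition mclamp m n (z0 : 'M[R]_(m, n)) (rho : R) (z : 'M[R]_(m, n)) :=
  \matrix_(i, j) clamp (z0 i j - rho) (z0 i j + rho) (z i j).

Lemma mclamp_lipschitz m n (z0 : 'M[R]_(m, n)) rho (y z : 'M[R]_(m, n)) :
  `|mclamp z0 rho y - mclamp z0 rho z| <= `|y - z|.
Proof.
apply: mxnorm_le => // i j; rewrite !mxE; apply: le_trans (clamp_lipschitz _ _ _ _) _.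
by have := entry_le_norm (y - z) i j; rewrite !mxE.
Qed.

Lemma mclamp_in m n (z0 : 'M[R]_(m, n)) rho z : 0 <= rho ->
  `|mclamp z0 rho z - z0| <= rho.
Proof.
move=> r0; apply: mxnorm_le => // i j; rewrite !mxE ler_norml.
have : z0 i j - rho <= z0 i j + rho by lra.
by move=> /(clamp_in (z i j))/andP[]; lra.
Qed.

Lemma mclamp_id m n (z0 : 'M[R]_(m, n)) rho z : `|z - z0| <= rho ->
  mclamp z0 rho z = z.
Proof.
move=> zr; apply/matrixP => i j; rewrite mxE clamp_id//.
have := le_trans (entry_le_norm (z - z0) i j) zr.
by rewrite !mxE ler_norml => /andP[? ?]; apply/andP; split; lra.
Qed.

End Clamp.

Section Antiderivative.
Context {R : realType} {m n : nat}.

(** The primitive that vanishes at 0. Integrating from [-3] keeps all times above [-3] in the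
    interior, where the fundamental theorem gives a two-sided derivative. *)
Definition antider (h : R -> 'M[R]_(m, n)) (t : R) : 'M[R]_(m, n) :=
  \matrix_(i, j) (\int[lebesgue_measure]_(s in `[(-3)%R, t]) h s i j -
                  \int[lebesgue_measure]_(s in `[(-3)%R, 0%R]) h s i j).

Lemma antider0 h : antider h 0 = 0.
Proof. by apply/matrixP => i j; rewrite !mxE subrr. Qed.

Lemma is_derive_antider (h : R -> 'M[R]_(m, n)) (t : R) : continuous h ->
  -3 < t -> is_derive t 1 (antider h) (h t).
Proof.
move=> ch t3; apply: is_derive_mx => i j.
have chij : continuous (fun s => h s i j).
  by move=> s; apply: cvg_coord; exact: ch.
have tu : t < t + 1 by rewrite ltrDl.
have int : lebesgue_measure.-integrable `[(-3)%R, t + 1] (EFin \o (fun s => h s i j)).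
  apply: continuous_compact_integrable; first exact: segment_compact.
  exact: continuous_subspaceT.
have [dF FE] := continuous_FTC1_closed tu int t3 (chij t).
have -> : (fun x => antider h x i j) =
    (fun x => \int[lebesgue_measure]_(s in `[(-3)%R, x]) h s i j) -
    cst (\int[lebesgue_measure]_(s in `[(-3)%R, 0%R]) h s i j).
  by apply/funext => x; rewrite mxE.
rewrite -[h t i j]subr0; apply: is_deriveB.
by apply: DeriveDef => //; rewrite -derive1E.
Qed.

End Antiderivative.

Lemma mvt_norm_abs {R : realType} {m n : nat} (g dg : R -> 'M[R]_(m, n)) (t K a : R) :
  `|t| < a ->
  (forall s : R, `|s| < a -> is_derive s 1 g (dg s)) ->
  (forall s : R, `|s| < a -> `|dg s| <= K) -> `|g t - g 0| <= K * `|t|.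
Proof.
move=> ta gd gK; have [t0|t0] := lerP 0 t.
  rewrite (ger0_norm t0) in ta *; rewrite -[X in _ <= _ * X]subr0.
  apply: (@mvt_norm _ _ _ g dg 0 t K t0) => s /andP[s0 st].
    by apply: gd; rewrite ger0_norm//; lra.
  by apply: gK; rewrite gtr0_norm//; lra.
rewrite (ltr0_norm t0) in ta *.
rewrite distrC -[- t]add0r; apply: (@mvt_norm _ _ _ g dg t 0 K (ltW t0)) => s /andP[s0 st].
  by apply: gd; rewrite ler0_norm//; lra.
by apply: gK; rewrite ltr0_norm//; lra.
Qed.

Lemma near_dist {R : realType} {V : normedModType R} (z : V) (d : R) :
  0 < d -> \forall y \near z, `|z - y| < d.
Proof.
by move=> d0; apply/nbhs_ballP; exists d => // y; rewrite -ball_normE.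
Qed.

Section Picard.
Context {R : realType} {m n : nat}.
Implicit Types (z : 'M[R]_(m, n)).
Variables (Q : 'M[R]_(m, n) -> 'M[R]_(m, n)) (K : R) (z0 : 'M[R]_(m, n)).
Hypotheses (K0 : 0 <= K) (K6 : 6 * K <= 1).
Hypothesis QK : forall y z, `|Q y - Q z| <= K * `|y - z|.

(** The iterates are under control at times of modulus below 3 only; with the time clamped, the
    integrands are continuous on the whole line. *)
Let tau : R -> R := clamp (-2) 2.

Let tau_in s : `|tau s| < 3.
Proof.
have /(clamp_in s)/andP[h1 h2] : (-2 : R) <= 2 by lra.
by rewrite ltr_norml /tau; lra.
Qed.

Fixpoint picard_iter k : R -> 'M[R]_(m, n) :=
  if k is k'.+1 then fun t => z0 + antider (fun s => Q (picard_iter k' (tau s))) t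
  else fun=> z0.

Let Q_cts : continuous Q.
Proof.
move=> z; apply/(@cvgrPdist_lt _ _ _ (nbhs z)) => e e0.
have K1 : 0 < `|K| + 1 by rewrite ltr_wpDl.
have e'0 : 0 < e / (`|K| + 1) by rewrite divr_gt0.
apply: filterS (near_dist z e'0) => y yz; apply: le_lt_trans (QK _ _) _.
apply: (@le_lt_trans _ _ ((`|K| + 1) * `|z - y|)).
  by apply: ler_wpM2r => //; apply: le_trans (ler_norm _) _; rewrite lerDl.
by rewrite mulrC -ltr_pdivlMr.
Qed.

Let clamped_cts (g : R -> 'M[R]_(m, n)) :
  (forall t : R, `|t| < 3 -> {for t, continuous g}) ->
  continuous (fun s => Q (g (tau s))).
Proof.
move=> cg s; apply: (@cvg_comp _ _ _ (fun s => g (tau s)) Q); last exact: Q_cts.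
by apply: (@cvg_comp _ _ _ tau g); [exact: clamp_cts|exact: cg].
Qed.

Let is_derive_step (h : R -> 'M[R]_(m, n)) (t : R) : continuous h -> `|t| < 3 ->
  is_derive t 1 (fun t => z0 + antider h t) (h t).
Proof.
move=> ch; rewrite ltr_norml => /andP[t3 _].
rewrite -[h t]add0r; apply: (@is_deriveD _ _ _ (cst z0) (antider h)).
exact: is_derive_antider.
Qed.

Let iter_der k (t : R) : `|t| < 3 ->
  is_derive t 1 (picard_iter k.+1) (Q (picard_iter k (tau t))).
Proof.
move=> t3; apply: (is_derive_step _ t3); elim: k {t t3} => [|k IH].
  by apply: clamped_cts => t _; exact: cvg_cst.
apply: (@clamped_cts (picard_iter k.+1)) => t t3; have := is_derive_step IH t3.
by move=> /is_derive_continuous.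
Qed.

Let iter0 k : picard_iter k 0 = z0.
Proof. by case: k => //= k; rewrite antider0 addr0. Qed.

Let picard_iter_cts k t : `|t| < 3 -> {for t, continuous (picard_iter k)}.
Proof.
case: k => [|k] t3; first exact: cvg_cst.
by have /is_derive_continuous := iter_der k t3.
Qed.

Let C := 3 * `|Q z0|.

Let C0 : 0 <= C. Proof. by rewrite mulr_ge0. Qed.

(** Integration over times below 3 multiplies an error by at most [3 * K <= 1 / 2]; this is the
    purpose of [6 * K <= 1]. *)
Let halving (u v : R -> 'M[R]_(m, n)) (du dv : R -> 'M[R]_(m, n)) (D t : R) :
  `|t| < 3 -> u 0 = v 0 -> 0 <= D ->
  (forall s : R, `|s| < 3 -> is_derive s 1 u (Q (du (tau s)))) ->
  (forall s : R, `|s| < 3 -> is_derive s 1 v (Q (dv (tau s)))) ->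
  (forall s : R, `|s| < 3 -> `|du s - dv s| <= D) ->
  `|u t - v t| <= D / 2.
Proof.
move=> t3 uv0 D0 Du Dv duv.
have := @mvt_norm_abs _ _ _ (fun t => u t - v t)
  (fun s => Q (du (tau s)) - Q (dv (tau s))) t (`|K| * D) 3 t3.
rewrite uv0 subrr subr0 => H; apply: le_trans (H _ _) _.
- by move=> s s3; apply: is_deriveB; [exact: Du|exact: Dv].
- move=> s s3; apply: le_trans (QK _ _) _.
  apply: (@le_trans _ _ (`|K| * `|du (tau s) - dv (tau s)|)).
    by apply: ler_wpM2r => //; exact: ler_norm.
  by apply: ler_wpM2l => //; exact: duv.
rewrite ger0_norm//.
have h1 : K * `|t| <= 2^-1.
  have : K * `|t| <= K * 3 by rewrite ler_wpM2l// ltW.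
  by have := K6; lra.
by rewrite mulrAC mulrC ler_wpM2l.
Qed.

Let iter_dist k t : `|t| < 3 ->
  `|picard_iter k.+1 t - picard_iter k t| <= C / 2 ^+ k.
Proof.
elim: k t => [|k IH] t t3.
  rewrite expr0 divr1 -[X in `|_ - X|](iter0 1).
  have := @mvt_norm_abs _ _ _ (picard_iter 1) (fun s => Q z0) t `|Q z0| 3 t3.
  move=> H; apply: le_trans (H _ _) _ => //; first by move=> s; exact: iter_der.
  by rewrite mulrC /C ler_wpM2r// ltW.
have -> : C / 2 ^+ k.+1 = C / 2 ^+ k / 2 by rewrite exprSr invfM mulrA.
apply: (@halving _ _ (picard_iter k.+1) (picard_iter k)) => //.
- by rewrite !iter0.
- by rewrite divr_ge0// exprn_ge0.
- by move=> s; exact: iter_der.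
- by move=> s; exact: iter_der.
Qed.

Let iter_cauchy k l t : `|t| < 3 ->
  `|picard_iter (k + l) t - picard_iter k t| <= 2 * C / 2 ^+ k - 2 * C / 2 ^+ (k + l).
Proof.
move=> t3; elim: l => [|l IH]; first by rewrite addn0 !subrr normr0.
rewrite addnS -(subrKA (picard_iter (k + l) t)); apply: le_trans (ler_normD _ _) _.
apply: le_trans (lerD (iter_dist _ t3) IH) _.
rewrite (_ : C / 2 ^+ (k + l) = 2 * C / 2 ^+ (k + l).+1); last first.
  by rewrite exprS invfM mulrA [2 * C]mulrC mulfK.
rewrite addrC -addrA lerD2l exprS invfM.
set a := 2 ^- (k + l); have : 0 <= C * a by rewrite mulr_ge0// invr_ge0 exprn_ge0.
lra.
Qed.

Let geo_small (e : R) : 0 < e -> exists k, 2 * C / 2 ^+ k < e.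
Proof.
move=> e0; have c : (geometric (2 * C) (2^-1) k) @[k --> \oo] --> (0 : R).
  by apply: cvg_geometric; rewrite ger0_norm// invf_lt1// ltr1n.
have /cvgrPdist_lt/(_ e e0)[k _ Hk] := c; exists k.
have := Hk k (leqnn k); rewrite sub0r normrN /geometric/= exprVn; apply: le_lt_trans.
exact: ler_norm.
Qed.

Let iter_is_cvg t : `|t| < 3 -> cvg (picard_iter k t @[k --> \oo]).
Proof.
move=> t3; apply/cauchy_cvgP; apply: cauchy_exP => e e0.
have [k ke] := geo_small e0; exists (picard_iter k t).
exists k => // l /= kl; rewrite -ball_normE/= distrC -(subnKC kl).
apply: le_lt_trans (iter_cauchy _ _ t3) _; apply: le_lt_trans ke.
by rewrite gerBl// divr_ge0// ?mulr_ge0// exprn_ge0.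
Qed.

Let Z t : 'M[R]_(m, n) := lim (picard_iter k t @[k --> \oo]).

Let Z_dist k t : `|t| < 3 -> `|Z t - picard_iter k t| <= 2 * C / 2 ^+ k.
Proof.
move=> t3; have c : `|picard_iter l t - picard_iter k t| @[l --> \oo] -->
    `|Z t - picard_iter k t|.
  by apply: cvg_norm; apply: cvgB; [exact: iter_is_cvg|exact: cvg_cst].
apply: (cvgr_to_le c); exists k => // l /= kl; rewrite -(subnKC kl).
apply: le_trans (iter_cauchy _ _ t3) _.
by rewrite gerBl// divr_ge0// ?mulr_ge0// exprn_ge0.
Qed.

Let Z_cts t : `|t| < 3 -> {for t, continuous Z}.
Proof.
move=> t3; apply/cvgrPdist_lt => e e0.
have [k ke] := geo_small (divr_gt0 e0 (ltr0n R 3)).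
have n3 : \forall s \near t, `|s| < 3.
  have : {for t, continuous (fun s : R => `|s|)} by exact: norm_continuous.
  by move=> /(_ [set r | r < 3]); apply; apply: open_nbhs_nbhs; split => //; exact: open_lt.
have nk : \forall s \near t, `|picard_iter k t - picard_iter k s| < e / 3.
  by have /cvgrPdist_lt := @picard_iter_cts k t t3; apply; rewrite divr_gt0.
apply: filterS2 n3 nk => s s3 sk.
have -> : Z t - Z s = (Z t - picard_iter k t) + (picard_iter k t - picard_iter k s) -
   (Z s - picard_iter k s).
  by rewrite subrKA opprB addrA subrK.
apply: le_lt_trans (ler_normB _ _) _.
have -> : e = e / 3 + e / 3 + e / 3 by field.
apply: ler_ltD; last exact: le_lt_trans (Z_dist k s3) ke.
apply: le_trans (ler_normD _ _) _; apply: lerD; last exact: ltW.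
by apply: (le_trans (Z_dist k t3)); exact: ltW.
Qed.

(** Limit and integral need not be exchanged: the right-hand side is within half the error of an
    iterate from the next iterate, and this error tends to 0. *)
Let Z_eq t : `|t| < 3 -> Z t = z0 + antider (fun s => Q (Z (tau s))) t.
Proof.
move=> t3; have cZ := clamped_cts Z_cts.
set Y := fun t => z0 + antider (fun s => Q (Z (tau s))) t; rewrite -/(Y t).
have YZ k : `|Y t - picard_iter k.+1 t| <= 2 * C / 2 ^+ k / 2.
  apply: (@halving Y _ Z (picard_iter k)) => //.
  - by rewrite iter0 /Y antider0 addr0.
  - by rewrite divr_ge0// ?mulr_ge0// exprn_ge0.
  - by move=> s s3; exact: is_derive_step.
  - by move=> s; exact: iter_der.
  - by move=> s s3; exact: Z_dist.
apply/eqP; rewrite eq_sym -subr_eq0 -normr_eq0 eq_le normr_ge0 andbT.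
apply/ler_addgt0Pl => e e0; rewrite addr0.
have [k ke] := geo_small e0.
rewrite -(subrKA (picard_iter k.+1 t)); apply: le_trans (ler_normD _ _) _.
rewrite [`|_ - Z t|]distrC.
have h2 := Z_dist k.+1 t3.
have E : 2 * C / 2 ^+ k.+1 = 2 * C / 2 ^+ k / 2 by rewrite exprSr invfM mulrA.
rewrite E in h2; have := YZ k; lra.
Qed.

Lemma picard_global : exists z : R -> 'M[R]_(m, n), z 0 = z0 /\ forall t : R, `|t| <= 2 -> is_derive t 1 z (Q (z t)).
Proof.
have cZ := clamped_cts Z_cts.
exists (fun t => z0 + antider (fun s => Q (Z (tau s))) t); split.
  by rewrite antider0 addr0.
move=> t t2; have t3 : `|t| < 3 by lra.
rewrite -(Z_eq t3); have := is_derive_step cZ t3.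
by rewrite /tau clamp_id// -ler_norml.
Qed.

End Picard.

(** The clamped field is globally Lipschitz. Its solution moves by at most [2 * B <= rho] up to time
    2, hence never leaves the ball, on which clamping changes nothing. *)
Lemma picard {R : realType} {m n : nat} (Q : 'M[R]_(m, n) -> 'M[R]_(m, n))
    (z0 : 'M[R]_(m, n)) (rho K B : R) :
  0 <= K -> 6 * K <= 1 -> 0 <= rho -> 3 * B <= rho ->
  (forall y z, `|y - z0| <= rho -> `|z - z0| <= rho -> `|Q y - Q z| <= K * `|y - z|) ->
  (forall y, `|y - z0| <= rho -> `|Q y| <= B) ->
  exists z : R -> 'M[R]_(m, n), z 0 = z0 /\ forall t : R, `|t| < 2 -> is_derive t 1 z (Q (z t)) /\ `|z t - z0| <= rho.
Proof.
move=> K0 K6 rho0 Brho QK QB.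
pose Q' z := Q (mclamp z0 rho z).
have QK' y z : `|Q' y - Q' z| <= K * `|y - z|.
  apply: le_trans (QK _ _ (mclamp_in _ _ rho0) (mclamp_in _ _ rho0)) _.
  by rewrite ler_wpM2l// mclamp_lipschitz.
have [z [z00 zd]] := picard_global z0 K0 K6 QK'.
exists z; split => //.
have zr t : `|t| < 2 -> `|z t - z0| <= rho.
  move=> t2; rewrite -z00.
  have H := @mvt_norm_abs R m n z (fun s => Q' (z s)) t B 2 t2.
  apply: le_trans (H _ _) _; first by move=> s /ltW; exact: zd.
    by move=> s _; apply: QB; exact: mclamp_in.
  have B0 : 0 <= B by apply: le_trans (QB z0 _); rewrite ?subrr ?normr0.
  have : B * `|t| <= B * 2 by rewrite ler_wpM2l// ltW.
  lra.
move=> t t2; split; last exact: zr.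
by have := zd t (ltW t2); rewrite /Q' mclamp_id//; exact: zr.
Qed.

(** * Second order equations with quadratic right-hand side *)

Section Spray.
Context {R : realType} {n : nat}.
Implicit Types (u w x : 'rV[R]_n).

(* Local bounds satisfied by the quadratic right-hand side of the geodesic
   equation [g'' = F g g'] on the ball of radius [rho] around [u0]. *)
Record spray (F : 'rV[R]_n -> 'rV[R]_n -> 'rV[R]_n) (u0 : 'rV[R]_n) (rho K : R) :
    Prop := Spray {
  spray_rho : 0 < rho;
  spray_K : 0 < K;
  spray_bounded : forall u w, `|u - u0| <= rho -> `|F u w| <= K * `|w| ^+ 2;
  spray_lipschitz : forall u u' w w' (m : R), `|u - u0| <= rho -> `|u' - u0| <= rho ->
    `|w| <= m -> `|w'| <= m ->
    `|F u w - F u' w'| <= K * (`|u - u'| * m ^+ 2 + m * `|w - w'|);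
  spray_homog : forall u w (c : R), F u (c *: w) = c ^+ 2 *: F u w }.

Definition spray_sol (F : 'rV[R]_n -> 'rV[R]_n -> 'rV[R]_n) (g h : R -> 'rV[R]_n) (t : R) :=
  is_derive t 1 g (h t) /\ is_derive t 1 h (F (g t) (h t)).

Context {F : 'rV[R]_n -> 'rV[R]_n -> 'rV[R]_n} {u0 : 'rV[R]_n} {rho K : R}.
Hypothesis S : spray F u0 rho K.

Let usub_le (z : 'M[R]_(1 + 1, n)) : `|usubmx z| <= `|z|.
Proof. by apply: mxnorm_le => // i j; rewrite mxE entry_le_norm. Qed.

Let dsub_le (z : 'M[R]_(1 + 1, n)) : `|dsubmx z| <= `|z|.
Proof. by apply: mxnorm_le => // i j; rewrite mxE entry_le_norm. Qed.

Let col_le (c : R) (a b : 'rV[R]_n) : `|a| <= c -> `|b| <= c ->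
  `|col_mx a b : 'M[R]_(1 + 1, n)| <= c.
Proof.
move=> ac bc; have c0 : 0 <= c by exact: le_trans ac.
apply: mxnorm_le => // i j; rewrite mxE; case: (fintype.split i) => k.
  exact: le_trans (entry_le_norm _ _ _) ac.
exact: le_trans (entry_le_norm _ _ _) bc.
Qed.

(** By homogeneity a small velocity amounts to a slow system: for [h = d *: om] the equations are
    [g' = d *: om] and [om' = d *: F g om]. A small [d] makes both this field and its Lipschitz
    constant small, so that solutions last beyond time 1. *)
Lemma spray_exists : exists2 d : R, 0 < d & forall x w, `|x - u0| <= rho / 2 ->
  `|w| <= d -> exists g h, [/\ g 0 = x, h 0 = w &
    forall t : R, `|t| < 2 -> spray_sol F g h t /\ `|g t - u0| <= rho].
Proof.
have K0 := spray_K S; have rho0 := spray_rho S.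
pose rr := Num.min (rho / 2) 1.
have rr0 : 0 < rr by rewrite lt_min ltr01 divr_gt0.
have rr1 : rr <= 1 by rewrite ge_min lexx orbT.
have rrr : rr <= rho / 2 by rewrite ge_min lexx.
(* As [d * (12 + 36 * K) = rr <= 1], both conditions of [picard] hold: [6 * d * (1 + 6 * K) <= 1]
   and [3 * d * (2 + 4 * K) <= rr]. *)
pose d := rr / (6 * (2 + 6 * K)).
have D0 : 0 < 6 * (2 + 6 * K) by lra.
have d0 : 0 < d by rewrite divr_gt0.
have dE : d * (12 + 36 * K) = rr.
  have -> : 12 + 36 * K = 6 * (2 + 6 * K) by lra.
  by rewrite divfK// gt_eqF.
have dK0 : 0 < d * K by rewrite mulr_gt0.
clearbody d.
exists d => // x w xu wd.
pose om := d^-1 *: w.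
have om1 : `|om| <= 1 by rewrite normrZ gtr0_norm ?invr_gt0// ler_pdivrMl// mulr1.
pose z0 : 'M[R]_(1 + 1, n) := col_mx x om.
pose Q (z : 'M[R]_(1 + 1, n)) : 'M[R]_(1 + 1, n) :=
  col_mx (d *: dsubmx z) (d *: F (usubmx z) (dsubmx z)).
have dom z : `|z - z0| <= rr -> `|usubmx z - u0| <= rho /\ `|dsubmx z| <= 2.
  move=> zr; have hu := le_trans (usub_le _) zr; have hd := le_trans (dsub_le _) zr.
  rewrite linearB/= /z0 col_mxKu in hu; rewrite linearB/= /z0 col_mxKd in hd.
  split.
    by rewrite -(subrKA x); apply: le_trans (ler_normD _ _) _; lra.
  by rewrite -(subrK om (dsubmx z)); apply: le_trans (ler_normD _ _) _; lra.
have [||||||z [z00 Hz]] := @picard R (1 + 1) n Q z0 rr (d * (1 + 6 * K)) (d * (2 + 4 * K)).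
- by rewrite mulr_ge0 ?(ltW d0)//; lra.
- lra.
- exact: ltW.
- lra.
- move=> y z /dom[yu yd] /dom[zu zd].
  rewrite /Q opp_col_mx add_col_mx -!scalerBr; apply: col_le; rewrite normrZ gtr0_norm//.
    rewrite -mulrA ler_pM2l// -linearB/=; apply: le_trans (dsub_le _) _.
    by rewrite ler_peMl// lerDl mulr_ge0// ltW.
  rewrite -mulrA ler_pM2l//; apply: le_trans (spray_lipschitz S yu zu yd zd) _.
  rewrite -!linearB/=; have h1 := usub_le (y - z); have h2 := dsub_le (y - z).
  have : K * (`|usubmx (y - z)| * 2 ^+ 2 + 2 * `|dsubmx (y - z)|) <=
     K * (6 * `|y - z|) by rewrite ler_pM2l//; lra.
  have := normr_ge0 (y - z); lra.
- move=> y /dom[yu yd]; rewrite /Q; apply: col_le; rewrite normrZ gtr0_norm// ler_pM2l//.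
    lra.
  apply: le_trans (spray_bounded S _ yu) _.
  have : `|dsubmx y| ^+ 2 <= 2 ^+ 2 by rewrite ler_pXn2r ?nnegrE.
  by rewrite -(ler_pM2l K0); lra.
exists (fun t => usubmx (z t)), (fun t => d *: dsubmx (z t)); split.
- by rewrite z00 col_mxKu.
- by rewrite z00 col_mxKd scalerA mulfV ?gt_eqF// scale1r.
- move=> t t2; have [dz zr] := Hz t t2; have [zu zd] := dom _ zr.
  split => //; split.
    apply: is_derive_mx => i j; rewrite mxE.
    have := is_derive_entry (lshift 1 i) j dz; rewrite /Q col_mxEu mxE.
    by have -> : (fun t => z t (lshift 1 i) j) = (fun t => usubmx (z t) i j)
      by apply/funext => s; rewrite mxE.
  apply: is_derive_mx => i j.
  have := is_derive_entry (rshift 1 i) j dz; rewrite /Q col_mxEd mxE => dd.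
  rewrite (spray_homog S) expr2 -scalerA mxE mxE.
  have -> : (fun t => (d *: dsubmx (z t)) i j) = (d *: (fun t => z t (rshift 1 i) j)).
    by apply/funext => s; rewrite !mxE.
  exact: is_deriveZ.
Qed.

(** The maximum [A] over time of the difference of velocities also bounds the difference of
    positions. The equation keeps the difference of velocities within [2 * K * m * A <= A / 2] of
    its initial value, whence [A] is at most twice this value: no Gronwall inequality is called
    for. *)
Lemma spray_near_id g1 h1 g2 h2 (m : R) : 0 < m <= 1 -> 4 * K * m <= 1 ->
  (forall t : R, 0 <= t <= 1 ->
    [/\ spray_sol F g1 h1 t, `|g1 t - u0| <= rho & `|h1 t| <= m]) ->
  (forall t : R, 0 <= t <= 1 ->
    [/\ spray_sol F g2 h2 t, `|g2 t - u0| <= rho & `|h2 t| <= m]) ->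
  g1 0 = g2 0 ->
  `|g1 1 - g2 1 - (h1 0 - h2 0)| <= 4 * K * m * `|h1 0 - h2 0|.
Proof.
move=> /andP[m0 m1] Km sol1 sol2 g0; have K0 := spray_K S.
pose D t := h1 t - h2 t.
have cD t : 0 <= t <= 1 -> {for t, continuous (fun t => `|D t|)}.
  move=> t01; have [[_ d1] _ _] := sol1 t t01; have [[_ d2] _ _] := sol2 t t01.
  have cD : {for t, continuous D}.
    by apply: cvgB; [exact: is_derive_continuous d1|exact: is_derive_continuous d2].
  exact: (cvg_norm cD).
have [s] := @EVT_max R (fun t => `|D t|) 0 1 ler01 (continuous_within_cc cD).
rewrite in_itv/= => s01 Ds.
set A := `|D s| in Ds.
have DA t : 0 <= t <= 1 -> `|D t| <= A by move=> t01; apply: Ds; rewrite in_itv.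
have A0 : 0 <= A by exact: normr_ge0.
have gA t : 0 <= t <= 1 -> `|g1 t - g2 t| <= A.
  move=> /andP[t0 t1].
  have := @mvt_norm _ _ _ (fun t => g1 t - g2 t) D 0 t A t0.
  rewrite g0 subrr !subr0 => H; apply: le_trans (H _ _) _; last by rewrite ler_piMr.
    move=> r /andP[r0 rt]; have r01 : 0 <= r <= 1 by rewrite r0 (le_trans rt).
    by apply: is_deriveB; [have [[]] := sol1 r r01|have [[]] := sol2 r r01].
  by move=> r /andP[r0 rt]; apply: DA; rewrite ltW//= (le_trans (ltW rt)).
have hD t : 0 <= t <= 1 -> `|D t - D 0| <= 2 * K * m * A.
  move=> /andP[t0 t1].
  have H := @mvt_norm _ _ _ D (fun t => F (g1 t) (h1 t) - F (g2 t) (h2 t)) 0 t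
    (2 * K * m * A) t0.
  apply: le_trans (H _ _) _.
  - move=> r /andP[r0 rt]; have r01 : 0 <= r <= 1 by rewrite r0 (le_trans rt).
    by apply: is_deriveB; [have [[]] := sol1 r r01|have [[]] := sol2 r r01].
  - move=> r /andP[r0 rt].
    have r01 : 0 <= r <= 1 by rewrite (ltW r0) (le_trans (ltW rt)).
    have [_ u1 w1] := sol1 r r01; have [_ u2 w2] := sol2 r r01.
    apply: le_trans (spray_lipschitz S u1 u2 w1 w2) _.
    have := gA r r01; have := DA r r01; rewrite /D => hw hg.
    have -> : 2 * K * m * A = K * (A * m + m * A) by ring.
    rewrite ler_pM2l//; apply: lerD; last by rewrite ler_pM2l.
    apply: (@le_trans _ _ (A * m ^+ 2)); first by rewrite ler_wpM2r// sqr_ge0.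
    by rewrite ler_wpM2l// expr2 ler_piMl// ltW.
  - by rewrite subr0 ler_piMr// !mulr_ge0// ltW.
have A2 : A <= 2 * `|D 0|.
  have h := hD s s01; have : A <= `|D s - D 0| + `|D 0|.
    by rewrite /A -{1}(subrK (D 0) (D s)) ler_normD.
  have : 2 * K * m * A <= 2^-1 * A by rewrite ler_wpM2r//; lra.
  lra.
have dl (t : R) : is_derive t 1 (fun t : R => t *: D 0) (D 0).
  have := is_derive_line 0 (D 0) t.
  by under eq_fun do rewrite add0r.
have := @mvt_norm _ _ _ (fun t => g1 t - g2 t - t *: D 0)
  (fun t => D t - D 0) 0 1 (2 * K * m * A) ler01.
rewrite g0 !subrr scale0r subr0 scale1r subr0 subr0 mulr1 => H.
apply: le_trans (H _ _) _.
- move=> t t01; apply: is_deriveB.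
  by apply: is_deriveB; [have [[]] := sol1 t t01|have [[]] := sol2 t t01].
- by move=> t /andP[t0 t1]; apply: hD; rewrite !ltW.
- have -> : 4 * K * m * `|h1 0 - h2 0| = 2 * K * m * (2 * `|D 0|) by rewrite /D; ring.
  by rewrite ler_wpM2l// !mulr_ge0// ltW.
Qed.

End Spray.

(** * Geodesics in a chart *)

Section CurveCalculus.
Context {R : realType}.

Lemma is_derive_curve (V W : normedModType R) (F : V -> W) (g : R -> V) (t : R) (w : V) :
  is_derive t 1 g w -> differentiable F (g t) ->
  is_derive t 1 (F \o g) ('d F (g t) w).
Proof.
move=> [/derivable1_diffP dg wE] dF.
have dc : differentiable (F \o g) t by exact: differentiable_comp.
apply: DeriveDef; first exact: diff_derivable.
rewrite (deriveE _ dc) (diff_comp dg dF) /=; congr ('d F (g t) _).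
by rewrite -(deriveE _ dg).
Qed.

Lemma is_derive_mulmx {m n p : nat} (A : R -> 'M[R]_(m, n)) (B : R -> 'M[R]_(n, p))
    (t : R) (dA : 'M[R]_(m, n)) (dB : 'M[R]_(n, p)) :
  is_derive t 1 A dA -> is_derive t 1 B dB ->
  is_derive t 1 (fun s => A s *m B s) (dA *m B t + A t *m dB).
Proof.
move=> hA hB; apply: is_derive_mx => i j.
rewrite (_ : (fun s => _) = \sum_k (fun s => A s i k * B s k j)); last first.
  by apply/funext => s; rewrite mxE fct_sumE.
rewrite !mxE -big_split /=; apply: is_derive_sum => k.
have [D1 D2] := is_deriveM (is_derive_entry i k hA) (is_derive_entry k j hB).
apply: DeriveDef; first exact: D1.
by apply: etrans D2 _; rewrite /GRing.scale/= addrC [B t k j * _]mulrC.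
Qed.

Lemma is_derive_trmx {m n : nat} (A : R -> 'M[R]_(m, n)) (t : R) (dA : 'M[R]_(m, n)) :
  is_derive t 1 A dA -> is_derive t 1 (fun s => (A s)^T) dA^T.
Proof.
move=> hA; apply: is_derive_mx => i j; rewrite mxE.
rewrite (_ : (fun s => _) = (fun s => A s j i)); first exact: is_derive_entry.
by apply/funext => s; rewrite mxE.
Qed.

End CurveCalculus.

(** * Symmetry of second derivatives *)

Section Schwarz.
Context {R : realType} {n m : nat}.
Implicit Types (T : 'rV[R]_n -> 'rV[R]_m) (u v w h : 'rV[R]_n).

Lemma is_derive_dir (W : normedModType R) (F : 'rV[R]_n -> W) u h (t : R) :
  differentiable F (u + t *: h) ->
  is_derive t 1 (fun s : R => F (u + s *: h)) ('D_h F (u + t *: h)).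
Proof.
move=> dF; rewrite (deriveE _ dF).
exact: (is_derive_curve (is_derive_line u h t)).
Qed.

(** The mean value inequality is applied twice: in the direction [w] to the derivative along [v],
    then in the direction [v]. *)
Let second_difference T u v w (A : 'rV[R]_m) (e s t : R) : 0 <= s -> 0 <= t ->
  (forall a b, 0 <= a <= s -> 0 <= b <= t ->
    [/\ differentiable T (u + a *: v + b *: w),
        differentiable ('D_v T) (u + a *: v + b *: w) &
        `|'D_w ('D_v T) (u + a *: v + b *: w) - A| <= e]) ->
  `|T (u + s *: v + t *: w) - T (u + s *: v) - (T (u + t *: w) - T u) - (s * t) *: A|
    <= e * t * s.
Proof.
move=> s0 t0 H.
have t00 b : u + b *: w = u + 0 *: v + b *: w by rewrite scale0r addr0.
have H1 a : 0 <= a <= s ->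
    `|'D_v T (u + a *: v + t *: w) - 'D_v T (u + a *: v) - t *: A| <= e * t.
  move=> a0s.
  have := @mvt_norm _ _ _ (fun b => 'D_v T (u + a *: v + b *: w) - b *: A)
    (fun b => 'D_w ('D_v T) (u + a *: v + b *: w) - A) 0 t e t0.
  rewrite !scale0r addr0 !subr0 addrAC; apply.
    move=> b bt; apply: is_deriveB; last first.
      by have := is_derive_line 0 A b; under eq_fun do rewrite add0r.
    by apply: is_derive_dir; have [] := H a b a0s bt.
  by move=> b /andP[b0 bt]; have [|//] := H a b a0s _; rewrite !ltW.
have swap a b : u + a *: v + b *: w = u + b *: w + a *: v by rewrite addrAC.
have := @mvt_norm _ _ _
  (fun a => T (u + a *: v + t *: w) - T (u + a *: v) - (a * t) *: A)
  (fun a => 'D_v T (u + a *: v + t *: w) - 'D_v T (u + a *: v) - t *: A) 0 s (e * t) s0.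
rewrite scale0r addr0 mul0r scale0r !subr0 => K.
apply: le_trans (K _ _).
- by rewrite addrAC.
- move=> a a0s.
  have ht : 0 <= t <= t by rewrite t0 lexx.
  have h0 : 0 <= (0 : R) <= t by rewrite lexx.
  apply: is_deriveB; first apply: is_deriveB.
  + under eq_fun do rewrite swap.
    by rewrite swap; apply: is_derive_dir; rewrite -swap; have [] := H a t a0s ht.
  + apply: is_derive_dir; have [+ _ _] := H a 0 a0s h0.
    by rewrite scale0r addr0.
  + have := is_derive_line 0 (t *: A) a.
    by under eq_fun do rewrite add0r scalerA.
- by move=> a /andP[a0 a_s]; apply: H1; rewrite !ltW.
Qed.

Lemma schwarz T (U : set 'rV[R]_n) u v w : open U -> Ck_on 2 U T -> U u ->
  'D_w ('D_v T) u = 'D_v ('D_w T) u.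
Proof.
move=> oU [dT cT] Uu.
apply/eqP; rewrite -subr_eq0 -normr_eq0 eq_le normr_ge0 andbT.
apply/ler_addgt0Pl => e e0; rewrite addr0.
have near1 (a b : 'rV[R]_n) : \forall x \near u, [/\ differentiable T x,
    differentiable ('D_a T) x & `|'D_b ('D_a T) x - 'D_b ('D_a T) u| <= e / 2].
  have UU : \forall x \near u, U x by exact: open_nbhs_nbhs.
  have c : {for u, continuous ('D_b ('D_a T))} by have [_ /(_ b)] := cT a; apply.
  have /cvgrPdist_le/(_ (e / 2)) c' := c.
  apply: filterS2 UU (c' (divr_gt0 e0 (ltr0n R 2))) => x Ux xe.
  by split; [exact: dT|have [+ _] := cT a; exact|rewrite distrC].
have near2 (a b : 'rV[R]_n) : \forall s \near (0 : R)^'+, forall x y,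
    0 <= x <= s -> 0 <= y <= s -> [/\ differentiable T (u + x *: a + y *: b),
    differentiable ('D_a T) (u + x *: a + y *: b) &
    `|'D_b ('D_a T) (u + x *: a + y *: b) - 'D_b ('D_a T) u| <= e / 2].
  have /nbhs_ballP[d /= d0 dH] := near1 a b.
  have k0 : 0 < `|a| + `|b| + 1 by rewrite ltr_wpDl// addr_ge0.
  near=> s => x y /andP[x0 xs] /andP[y0 ys]; apply: dH.
  rewrite -ball_normE/= -addrA opprD addrA subrr sub0r normrN.
  have sd : s < d / (`|a| + `|b| + 1).
    by near: s; apply: nbhs_right_lt; rewrite divr_gt0.
  rewrite ltr_pdivlMr// in sd; apply: le_lt_trans sd.
  apply: le_trans (ler_normD _ _) _; rewrite !normrZ !ger0_norm//.
  have h1 : x * `|a| <= s * `|a| by rewrite ler_wpM2r.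
  have h2 : y * `|b| <= s * `|b| by rewrite ler_wpM2r.
  have s0 : 0 <= s by exact: le_trans xs.
  lra.
have [s [s0 [N1 N2]]] := @filter_ex _ (0^'+) _ _
  (filterI (nbhs_right_gt (0 : R)) (filterI (near2 v w) (near2 w v))).
have E1 := @second_difference T u v w ('D_w ('D_v T) u) (e / 2) s s (ltW s0) (ltW s0) N1.
have E2 := @second_difference T u w v ('D_v ('D_w T) u) (e / 2) s s (ltW s0) (ltW s0) N2.
set D := T _ - _ - _ in E1; set D' := T _ - _ - _ in E2.
(* The second difference does not depend on the order of the two directions. *)
have DD : D = D'.
  by rewrite /D /D' [u + s *: w + s *: v]addrAC; apply/rowP => i; rewrite !mxE; ring.
rewrite -DD in E2; move: D E1 E2 {D' DD N1 N2 near1 near2}.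
move: ('D_w ('D_v T) u) ('D_v ('D_w T) u) => A B D E1 E2.
have H : `|(s * s) *: (A - B)| <= e * s * s.
  have aux (c : R) (a b d : 'rV[R]_m) : c *: (a - b) = (d - c *: b) - (d - c *: a).
    by apply/rowP => i; rewrite !mxE; ring.
  rewrite (aux _ _ _ D); apply: le_trans (ler_normB _ _) _; lra.
rewrite normrZ gtr0_norm ?mulr_gt0// in H.
by rewrite -(ler_pM2l (mulr_gt0 s0 s0)) mulrC -mulrA; lra.
Unshelve. all: by end_near. Qed.

End Schwarz.

(** * Christoffel symbols and change of charts *)

Section ChristoffelContraction.
Context {R : realType} {n : nat} {M : topologicalType} (X : riemannian R n M).
Implicit Types (p q x : M) (u v w z h : 'rV[R]_n).

(** The geodesic equation in the chart at [p] is [g'' = - gam p g g']. *)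
Definition gam p u w : 'rV[R]_n :=
  \row_k \sum_(i < n) \sum_(j < n) christoffel X p u k i j * w 0 i * w 0 j.

Definition dgram p u h : 'M[R]_n := 'D_h (gram X p) u.

Lemma gram_diff p u : ccod (rchart X p) u -> differentiable (gram X p) u.
Proof. by move=> cu; have [dG _] := gram_smooth X p 1; exact: dG. Qed.

Lemma dgram_linear p u h : ccod (rchart X p) u ->
  dgram p u h = \sum_(i < n) h 0 i *: dgram p u (delta_mx 0 i).
Proof.
move=> cu; have dG := gram_diff cu.
rewrite /dgram (deriveE _ dG) {1}(row_sum_delta h) linear_sum.
by apply: eq_bigr => i _; rewrite linearZ (deriveE _ dG).
Qed.

Lemma posdef_unitmx (G : 'M[R]_n) : posdef G -> G \in unitmx.
Proof.
move=> [Gs Gp]; rewrite -row_free_unit -kermx_eq0; apply/eqP/row_matrixP => i.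
rewrite row0; apply/eqP; apply: contraT => ri0.
have := Gp _ ri0; rewrite /bform -row_mul mulmx_ker row0 mul0mx mxE ltxx.
by [].
Qed.

(** Lowering the index removes the inverse Gram matrix: only derivatives of the metric remain, and
    the product rule gives their behaviour under a change of charts. *)
Lemma bform_gam p u w z : ccod (rchart X p) u ->
  bform (gram X p u) (gam p u w) z =
  bform (dgram p u w) w z - 2^-1 * bform (dgram p u z) w w.
Proof.
move=> cu; set G := gram X p u.
have Gp : posdef G by split; [exact: gram_sym|move=> v; exact: gram_pos].
have Gu := posdef_unitmx Gp; have [Gs _] := Gp.
(* Twice the coefficients with lowered index: [gam p u w] is half of [b *m invmx G]. *)
pose b : 'rV[R]_n := \row_l (2 * bform (dgram p u w) w (delta_mx 0 l)
   - bform (dgram p u (delta_mx 0 l)) w w).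
have iG : (invmx G)^T = invmx G by rewrite trmx_inv Gs.
have dE i j k : partial (gram X p) i u j k = dgram p u (delta_mx 0 i) j k by [].
have bE (A : 'M[R]_n) v v' : bform A v v' = \sum_i \sum_j v 0 i * A i j * v' 0 j.
  rewrite /bform mxE exchange_big /=; apply: eq_bigr => j _.
  by rewrite mxE big_distrl /=; apply: eq_bigr => i _; rewrite mxE.
have gE : gam p u w = 2^-1 *: (b *m invmx G).
  apply/rowP => k; rewrite !mxE.
  have S1 i j : christoffel X p u k i j * w 0 i * w 0 j =
    \sum_l 2^-1 * invmx G k l * ((dgram p u (delta_mx 0 i) j l +
       dgram p u (delta_mx 0 j) i l - dgram p u (delta_mx 0 l) i j) * w 0 i * w 0 j).
    rewrite /christoffel -!mulrA mulr_suml mulr_sumr; apply: eq_bigr => l _.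
    by rewrite !dE; ring.
  under eq_bigr do under eq_bigr do rewrite S1.
  under eq_bigr do rewrite exchange_big /=.
  rewrite exchange_big /= mulr_sumr; apply: eq_bigr => l _.
  have iGlk : invmx G l k = invmx G k l by rewrite -{1}iG mxE.
  transitivity (2^-1 * invmx G k l * b 0 l); last by rewrite iGlk; ring.
  under eq_bigr do rewrite -mulr_sumr.
  rewrite -mulr_sumr; congr (_ * _); rewrite mxE.
  have dl : bform (dgram p u w) w (delta_mx 0 l) =
      \sum_i \sum_j w 0 i * w 0 j * dgram p u (delta_mx 0 i) j l.
    rewrite /bform -mulmxA.
    have -> : dgram p u w *m (delta_mx 0 l)^T = \col_j (dgram p u w j l).
      by rewrite trmx_delta -colE; apply/colP => j; rewrite !mxE.
    rewrite mxE exchange_big /=; apply: eq_bigr => j _.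
    rewrite mxE (dgram_linear w cu) summxE mulr_sumr; apply: eq_bigr => i _.
    by rewrite mxE; ring.
  have dl' : bform (dgram p u w) w (delta_mx 0 l) =
      \sum_i \sum_j w 0 i * w 0 j * dgram p u (delta_mx 0 j) i l.
    by rewrite dl exchange_big /=; do 2 (apply: eq_bigr => ? _); ring.
  rewrite mulr_natl mulr2n {1}dl dl' bE -!big_split /= -sumrB.
  apply: eq_bigr => i _; rewrite -big_split /= -sumrB; apply: eq_bigr => j _.
  by ring.
rewrite gE bformZl /bform -mulmxA -[b *m _ *m _]mulmxA [invmx G *m _]mulmxA mulVmx// mul1mx.
have zT : z^T = \sum_l z 0 l *: (delta_mx 0 l)^T.
  by rewrite {1}(row_sum_delta z) linear_sum; apply: eq_bigr => l _; rewrite linearZ.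
have b1 (A : 'M[R]_n) : \sum_l z 0 l * bform A w (delta_mx 0 l) = bform A w z.
  rewrite /bform zT mulmx_sumr summxE; apply: eq_bigr => l _.
  by rewrite -scalemxAr [in RHS]mxE.
have b2 : \sum_l z 0 l * bform (dgram p u (delta_mx 0 l)) w w = bform (dgram p u z) w w.
  rewrite [in RHS]/bform (dgram_linear z cu) mulmx_sumr mulmx_suml summxE.
  by apply: eq_bigr => l _; rewrite -scalemxAr -scalemxAl [in RHS]mxE.
have -> : (b *m z^T) 0 0 = 2 * bform (dgram p u w) w z - bform (dgram p u z) w w.
  rewrite -b1 -b2 mxE mulr_sumr -sumrB; apply: eq_bigr => l _.
  by rewrite !mxE; ring.
by rewrite mulrBr mulrA mulVf ?mul1r ?pnatr_eq0.
Qed.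

End ChristoffelContraction.

(** [geodesic_at] refers to the chart at the current point, which moves along the curve; here the
    chart is fixed, as the theory of differential equations requires. *)
Definition geo_chart {R : realType} {n : nat} {M : topologicalType}
    (X : riemannian R n M) (p : M) (c : R -> M) (t : R) : Prop :=
  [/\ {for t, continuous c}, cdom (rchart X p) (c t),
   \forall s \near t, is_derive (s : R) 1 (coord X p \o c) (derive1 (coord X p \o c) s) &
   is_derive t 1 (derive1 (coord X p \o c))
     (- gam X p (coord X p (c t)) (derive1 (coord X p \o c) t))].

Section ChartChange.
Context {R : realType} {n : nat} {M : topologicalType} (X : riemannian R n M).
Implicit Types (x : M) (u v w z h : 'rV[R]_n).
Variables p q : M.

Local Notation dom p := (cdom (rchart X p)).

Let T : 'rV[R]_n -> 'rV[R]_n := coord X q \o cinv (rchart X p).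
Let U : set 'rV[R]_n := cmap (rchart X p) @` (dom p `&` dom q).

Let U_open : open U. Proof. exact: overlap_open. Qed.

Let T_smooth k : Ck_on k U T. Proof. exact: rchart_smooth. Qed.

Let T_diff u : U u -> differentiable T u.
Proof. by have [dT _] := T_smooth 1; exact: dT. Qed.

Let DT_diff u v : U u -> differentiable ('D_v T) u.
Proof. by have [_ /(_ v)[dT _]] := T_smooth 2; exact: dT. Qed.

Let U_coord x : dom p x -> dom q x -> U (coord X p x).
Proof. by move=> px qx; exists x. Qed.

Let jac_row u w : U u -> w *m jac T u = 'D_w T u.
Proof. by move=> Uu; rewrite (deriveE _ (T_diff Uu)); exact: mul_jac. Qed.

Let jacE u i j : U u -> jac T u i j = ('D_(delta_mx 0 i) T u) 0 j.
Proof. by move=> Uu; rewrite -mul_delta_row (jac_row (delta_mx 0 i) Uu). Qed.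

(** The derivative of the Jacobian matrix of the coordinate change in the direction [h]. *)
Let hess u h : 'M[R]_n := \matrix_(i, j) ('D_h ('D_(delta_mx 0 i) T) u) 0 j.

Let mul_hess u h w : U u -> w *m hess u h =
  \sum_i \sum_k (w 0 i * h 0 k) *: 'D_(delta_mx 0 k) ('D_(delta_mx 0 i) T) u.
Proof.
move=> Uu; rewrite [LHS]mulmx_sum_row; apply: eq_bigr => i _.
have -> : row i (hess u h) = 'D_h ('D_(delta_mx 0 i) T) u.
  by apply/rowP => j; rewrite mxE /hess mxE.
have dD := DT_diff (delta_mx 0 i) Uu.
have -> : 'D_h ('D_(delta_mx 0 i) T) u =
    \sum_k h 0 k *: 'D_(delta_mx 0 k) ('D_(delta_mx 0 i) T) u.
  rewrite (deriveE _ dD) {1}(row_sum_delta h) linear_sum.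
  by apply: eq_bigr => k _; rewrite linearZ (deriveE _ dD).
by rewrite scaler_sumr; apply: eq_bigr => k _; rewrite scalerA.
Qed.

Let hess_sym u h w : U u -> w *m hess u h = h *m hess u w.
Proof.
move=> Uu; rewrite (mul_hess h w Uu) (mul_hess w h Uu) exchange_big /=.
apply: eq_bigr => i _; apply: eq_bigr => k _.
by rewrite (schwarz _ _ U_open (T_smooth 2) Uu) mulrC.
Qed.

Let is_derive_jac (g : R -> 'rV[R]_n) (t : R) w : U (g t) -> is_derive t 1 g w ->
  is_derive t 1 (fun s => jac T (g s)) (hess (g t) w).
Proof.
move=> Ut dg; apply: is_derive_mx => i j; rewrite mxE.
have dD := DT_diff (delta_mx 0 i) Ut.
have D := is_derive_entry 0 j (is_derive_curve dg dD).
have cg : {for t, continuous g} by exact: is_derive_continuous dg.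
have E : \forall s \near t, (('D_(delta_mx 0 i) T) \o g) s 0 j = jac T (g s) i j.
  have UU : nbhs (g t) U by exact: open_nbhs_nbhs.
  by apply: filterS (cvg_near cg UU) => s Us; rewrite jacE.
have := near_eq_is_derive E D.
by rewrite (deriveE _ dD).
Qed.

Let gram_change u : U u ->
  gram X p u = jac T u *m gram X q (T u) *m (jac T u)^T.
Proof.
move=> [x [px qx] <-]; rewrite -/(coord X p x).
apply/matrixP => i j.
have := gramx_trans (delta_mx 0 i) (delta_mx 0 j) px qx.
have -> (A : 'M[R]_n) : bform A (delta_mx 0 i) (delta_mx 0 j) = A i j.
  by rewrite /bform trmx_delta -mulmxA -colE -rowE !mxE.
rewrite /gramx => ->; rewrite /bform /trans -/T.
have -> : T (coord X p x) = coord X q x by rewrite /T /= coordK.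
rewrite trmx_mul trmx_delta !mulmxA -[_ *m delta_mx j 0]mulmxA.
rewrite -!mulmxA -rowE mxE !mulmxA -colE mxE.
by [].
Qed.

(** The formula [gram_change] is differentiated along the line [u + s *: h]. *)
Let dgram_change u h : U u -> dgram X p u h =
  hess u h *m gram X q (T u) *m (jac T u)^T +
  jac T u *m dgram X q (T u) (h *m jac T u) *m (jac T u)^T +
  jac T u *m gram X q (T u) *m (hess u h)^T.
Proof.
move=> Uu.
have [x [px qx] xE] := Uu.
have cu : ccod (rchart X p) u by exists x.
have Tu : T u = coord X q x by rewrite /T /= -xE -/(coord X p x) coordK.
have cTu : ccod (rchart X q) (T u) by rewrite Tu; exact: coord_cod.
have g0 : u + (0 : R) *: h = u by rewrite scale0r addr0.
have dg := is_derive_line u h (0 : R).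
have cg : {for (0 : R), continuous (fun s : R => u + s *: h)}.
  by exact: is_derive_continuous dg.
have Ug : U (u + (0 : R) *: h) by rewrite g0.
have dT : differentiable T (u + (0 : R) *: h) by rewrite g0; exact: T_diff.
have dTg := is_derive_curve dg dT.
have dG : differentiable (gram X q) ((T \o (fun s : R => u + s *: h)) 0).
  by rewrite /= g0; exact: gram_diff.
have dGTg := is_derive_curve dTg dG.
have dJ := is_derive_jac Ug dg.
have dR := is_derive_mulmx (is_derive_mulmx dJ dGTg) (is_derive_trmx dJ).
have dp : differentiable (gram X p) (u + (0 : R) *: h) by rewrite g0; exact: gram_diff.
have dL := is_derive_dir dp.
have E : \forall s \near (0 : R), gram X p (u + s *: h) =
  jac T (u + s *: h) *m (gram X q \o (T \o (fun s : R => u + s *: h))) s *m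
    (jac T (u + s *: h))^T.
  have UU : nbhs (u + (0 : R) *: h) U by exact: open_nbhs_nbhs.
  by apply: filterS (cvg_near cg UU) => s; exact: gram_change.
have dL' := near_eq_is_derive E dL.
have [_ E1] := dL'; have [_ E2] := dR.
move: (etrans (esym E1) E2); rewrite /= !g0 -/(dgram X p u h) => ->.
have -> : 'd (gram X q) (T u) ('d T u h) = dgram X q (T u) (h *m jac T u).
  rewrite /dgram (deriveE _ (gram_diff cTu)); congr ('d (gram X q) (T u) _).
  exact: (esym (mul_jac T u h)).
by congr (_ + _); exact: mulmxDl.
Qed.

Let bform_mulmx (A B C : 'M[R]_n) v w : bform (A *m B *m C^T) v w = bform B (v *m A) (w *m C).
Proof. by rewrite /bform trmx_mul !mulmxA. Qed.

Let bform3 (A G J D : 'M[R]_n) v w :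
  bform (A *m G *m J^T + J *m D *m J^T + J *m G *m A^T) v w =
  bform G (v *m A) (w *m J) + bform D (v *m J) (w *m J) + bform G (v *m J) (w *m A).
Proof.
rewrite -!bform_mulmx /bform !mulmxDr !mulmxDl.
by rewrite mxE [X in X + _ = _]mxE.
Qed.

Let bform_dgram u h v w : U u -> bform (dgram X p u h) v w =
  bform (gram X q (T u)) (v *m hess u h) (w *m jac T u) +
  bform (dgram X q (T u) (h *m jac T u)) (v *m jac T u) (w *m jac T u) +
  bform (gram X q (T u)) (v *m jac T u) (w *m hess u h).
Proof.
move=> Uu; have E := f_equal (fun A => bform A v w) (dgram_change h Uu).
exact: (etrans E (bform3 _ _ _ _ _ _)).
Qed.

(** The cancellation in [gam_change]: of the four terms with second derivatives of the coordinate
    change, [a], [b], [c] and [d], only [a] survives. *)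
Let arith (g0 g1 g2 P1 P2 Q1 Q2 a b b' c d : R) : g0 = g1 ->
  g1 = P1 - 2^-1 * P2 -> g2 = Q1 - 2^-1 * Q2 ->
  P1 = a + Q1 + b -> P2 = c + Q2 + d -> d = b -> c = b' -> b' = b ->
  g0 + (-1) * (g2 + a) = 0.
Proof. by move=> *; lra. Qed.

(** The transformation law of Christoffel symbols. Both sides are paired with the vectors [z *m J],
    which exhaust the tangent space; [bform_gam] computes the pairings in the two charts, and the
    symmetry of second derivatives makes the extra terms cancel. *)
Lemma gam_change x w : dom p x -> dom q x ->
  gam X p (coord X p x) w *m trans X p q x =
  gam X q (coord X q x) (w *m trans X p q x) + w *m hess (coord X p x) w.
Proof.
move=> px qx; set u := coord X p x; set J := trans X p q x.
have JE : jac T u = J by [].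
have Uu : U u by exact: U_coord.
have Tu : T u = coord X q x by rewrite /T /= coordK.
have Gp : posdef (gram X q (coord X q x)) by exact: gramx_posdef.
apply/eqP; rewrite -subr_eq0; apply: contraT => d0.
set d := _ - _ in d0.
have := Gp.2 _ d0.
suff dz z : bform (gram X q (coord X q x)) d (z *m J) = 0.
  have := dz (d *m trans X q p x); rewrite mul_transK// => ->.
  by rewrite ltxx.
rewrite /d bformDl -scaleN1r bformZl bformDl.
have e1 : bform (gram X q (coord X q x)) (gam X p u w *m J) (z *m J) =
   bform (gram X p u) (gam X p u w) z by rewrite -(gramx_trans _ _ px qx).
have [Gs _] := Gp.
have h1 := bform_gam w z (coord_cod px).
have h2 := bform_gam (w *m J) (z *m J) (coord_cod qx).
have h3 := bform_dgram w w z Uu; have h4 := bform_dgram z w w Uu.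
have h5 := f_equal (fun a => bform (gram X q (T u)) (w *m J) a) (hess_sym z w Uu).
have h6 := f_equal (fun a => bform (gram X q (T u)) a (w *m J)) (hess_sym z w Uu).
rewrite JE Tu in h3 h4 h5 h6; rewrite -/u in h1 h3 h4.
have h7 := bformC (z *m hess u w) (w *m J) Gs.
exact: (arith e1 h1 h2 h3 h4 h5 h6 h7).
Qed.

(** Velocities transform by the Jacobian matrix. Differentiating this matrix along the curve
    produces a term with [hess], which [gam_change] absorbs. *)
Lemma geo_change (c : R -> M) (t : R) : (\forall s \near t, {for s, continuous c}) ->
  dom q (c t) -> geo_chart X p c t -> geo_chart X q c t.
Proof.
move=> cn qt [ct pt dn dd].
have pn := cvg_near ct (dom_nbhs pt); have qn := cvg_near ct (dom_nbhs qt).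
have Hs : \forall s \near t, is_derive (s : R) 1 (coord X q \o c)
    (derive1 (coord X p \o c) s *m jac T ((coord X p \o c) s)).
  apply: filterS (filterI (filterI pn qn) (filterI cn dn)) => s [[ps qs] [cs ds]].
  exact: (curve_chart cs ps qs ds).
have E : \forall s \near t, derive1 (coord X p \o c) s *m jac T ((coord X p \o c) s) =
    derive1 (coord X q \o c) s.
  by apply: filterS Hs => s [_ Es]; rewrite [RHS]derive1E; exact: esym.
have dt := nbhs_singleton dn.
have Ut : U ((coord X p \o c) t) by exact: U_coord.
have D := near_eq_is_derive E (is_derive_mulmx dd (is_derive_jac Ut dt)).
split => //.
  apply: filterS2 Hs E => s ds Es; rewrite -Es; exact: ds.
have Et := nbhs_singleton E.
have G := gam_change (derive1 (coord X p \o c) t) pt qt.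
have JE : jac T ((coord X p \o c) t) = trans X p q (c t) by [].
rewrite JE in Et D.
have [D1 D2] := D; apply: DeriveDef; first exact: D1.
apply: (etrans D2); rewrite -Et.
move: G; set a := gam X p _ _ *m _; set b := gam X q _ _; set h := _ *m hess _ _ => G.
by rewrite mulNmx -/a G opprD subrK.
Qed.

End ChartChange.

(** * The geodesic equation as a spray *)

Section LocallyLipschitz.
Context {R : realType} {n : nat}.
Implicit Types (u v w h : 'rV[R]_n).

(** The bound on the values is part of the notion because products of Lipschitz functions need
    it. *)
Definition lipnear {m p : nat} (F : 'rV[R]_n -> 'M[R]_(m, p)) u :=
  exists2 K : R, 0 <= K & exists2 O, nbhs u O & forall v w, O v -> O w ->
    `|F v - F w| <= K * `|v - w| /\ `|F v| <= K.

Definition lipnear1 (f : 'rV[R]_n -> R) u :=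
  exists2 K : R, 0 <= K & exists2 O, nbhs u O & forall v w, O v -> O w ->
    `|f v - f w| <= K * `|v - w| /\ `|f v| <= K.

Lemma lipnear_entry {m p : nat} (F : 'rV[R]_n -> 'M[R]_(m, p)) u i j :
  lipnear F u -> lipnear1 (fun v => F v i j) u.
Proof.
move=> [K K0 [ O Ou HO]]; exists K => //; exists O => // v w Ov Ow.
have [h1 h2] := HO v w Ov Ow; split.
  by have := entry_le_norm (F v - F w) i j; rewrite !mxE => /le_trans; apply.
exact: le_trans (entry_le_norm _ _ _) h2.
Qed.

Lemma lipnear1_cst c u : lipnear1 (fun=> c) u.
Proof.
exists `|c| => //; exists setT; first exact: filterT.
by move=> v w _ _; rewrite subrr normr0 mulr_ge0.
Qed.

Lemma lipnear1D f g u : lipnear1 f u -> lipnear1 g u -> lipnear1 (fun v => f v + g v) u.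
Proof.
move=> [K K0 [ O Ou HO]] [K' K'0 [ O' Ou' HO']].
exists (K + K'); first exact: addr_ge0.
exists (O `&` O'); first exact: filterI.
move=> v w [Ov O'v] [Ow O'w]; have [h1 h2] := HO v w Ov Ow.
have [h1' h2'] := HO' v w O'v O'w; split.
  have -> : f v + g v - (f w + g w) = (f v - f w) + (g v - g w) by ring.
  by rewrite mulrDl; apply: le_trans (ler_normD _ _) _; exact: lerD.
by apply: le_trans (ler_normD _ _) _; exact: lerD.
Qed.

Lemma lipnear1M f g u : lipnear1 f u -> lipnear1 g u -> lipnear1 (fun v => f v * g v) u.
Proof.
move=> [K K0 [ O Ou HO]] [K' K'0 [ O' Ou' HO']].
exists (2 * (K * K')); first by rewrite !mulr_ge0.
exists (O `&` O'); first exact: filterI.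
move=> v w [Ov O'v] [Ow O'w]; have [h1 h2] := HO v w Ov Ow.
have [_ h3] := HO w v Ow Ov; have [h1' h2'] := HO' v w O'v O'w; split.
  have -> : f v * g v - f w * g w = (f v - f w) * g v + f w * (g v - g w) by ring.
  apply: le_trans (ler_normD _ _) _; rewrite !normrM.
  apply: (@le_trans _ _ (K * `|v - w| * K' + K * (K' * `|v - w|))).
    by apply: lerD; apply: ler_pM.
  by rewrite le_eqVlt; apply/orP; left; apply/eqP; ring.
rewrite normrM; apply: (@le_trans _ _ (K * K')); first exact: ler_pM.
by have := mulr_ge0 K0 K'0; lra.
Qed.

Lemma lipnear1_sum (I : Type) (s : seq I) (f : I -> 'rV[R]_n -> R) u :
  (forall i, lipnear1 (f i) u) -> lipnear1 (fun v => \sum_(i <- s) f i v) u.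
Proof.
move=> Hf; elim: s => [|i s IH].
  rewrite (_ : (fun v => _) = (fun=> 0)); first exact: lipnear1_cst.
  by apply/funext => v; rewrite big_nil.
rewrite (_ : (fun v => _) = (fun v => f i v + \sum_(j <- s) f j v)).
  exact: lipnear1D.
by apply/funext => v; rewrite big_cons.
Qed.

Lemma diff_norm_le {m p : nat} (F : 'rV[R]_n -> 'M[R]_(m, p)) x h (B : R) :
  differentiable F x -> (forall i, `|'D_(delta_mx 0 i) F x| <= B) ->
  `|'d F x h| <= n%:R * B * `|h|.
Proof.
move=> dF HB.
have -> : 'd F x h = \sum_i h 0 i *: 'D_(delta_mx 0 i) F x.
  rewrite {1}(row_sum_delta h) linear_sum; apply: eq_bigr => i _.
  by rewrite linearZ (deriveE _ dF).
apply: le_trans (ler_norm_sum _ _ _) _.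
apply: (@le_trans _ _ (\sum_(i < n) B * `|h|)).
  apply: ler_sum => i _; rewrite normrZ mulrC; apply: ler_pM => //.
  exact: entry_le_norm.
by rewrite sumr_const card_ord -mulrA mulr_natl.
Qed.

Lemma Ck1_lipnear {m p : nat} (U : set 'rV[R]_n) (F : 'rV[R]_n -> 'M[R]_(m, p)) u :
  open U -> Ck_on 1 U F -> U u -> lipnear F u.
Proof.
move=> oU [dF cF] Uu.
have UU : \forall v \near u, U v by exact: open_nbhs_nbhs.
pose B := \sum_(i < n) `|'D_(delta_mx 0 i) F u| + 1.
have Bi i : `|'D_(delta_mx 0 i) F u| + 1 <= B.
  by rewrite /B (bigD1 i)//= lerD2r lerDl sumr_ge0.
have B0 : 0 <= B by rewrite addr_ge0// sumr_ge0.
clearbody B.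
have near1 (G : 'rV[R]_n -> 'M[R]_(m, p)) : {for u, continuous G} ->
    \forall v \near u, `|G v| <= `|G u| + 1.
  move=> cG; have /cvgrPdist_le/(_ 1 ltr01) c' := cG.
  apply: filterS c' => v vi; rewrite -(subrK (G u) (G v)).
  by apply: le_trans (ler_normD _ _) _; rewrite addrC lerD2l distrC.
have H : \forall v \near u, forall i : 'I_n, `|'D_(delta_mx 0 i) F v| <= B.
  apply: (@filter_forall _ _ (fun (i : 'I_n) v => `|'D_(delta_mx 0 i) F v| <= B) (nbhs u)) => i.
  have c : {for u, continuous ('D_(delta_mx 0 i) F)} by exact: (cF (delta_mx 0 i) u Uu).
  by apply: filterS (near1 _ c) => v vi; exact: le_trans (Bi i).
have H2 := near1 F (differentiable_continuous (dF u Uu)).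
have /nbhs_ballP[d /= d0 dH] : \forall v \near u, U v /\
    (forall i : 'I_n, `|'D_(delta_mx 0 i) F v| <= B) /\ `|F v| <= `|F u| + 1.
  exact: filterI UU (filterI H H2).
exists (n%:R * B + (`|F u| + 1)); first by rewrite !addr_ge0// mulr_ge0.
exists (ball u d); first exact: nbhsx_ballx.
move=> v w uv uw; have [_ [_ hv]] := dH _ uv; split; last first.
  by apply: (le_trans hv); rewrite lerDr mulr_ge0.
move: uv uw; rewrite -!ball_normE/= => uv uw.
have seg t : 0 <= t <= 1 -> ball u d (w + t *: (v - w)).
  by move=> t01; rewrite -ball_normE/=; exact: ball_segment.
have := @mvt_norm _ _ _ (fun t : R => F (w + t *: (v - w)))
  (fun t => 'd F (w + t *: (v - w)) (v - w)) 0 1 (n%:R * B * `|v - w|) ler01.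
rewrite scale1r scale0r addr0 subr0 mulr1 [w + _]addrC subrK => E.
apply: le_trans (E _ _) _.
- move=> t t01; have [Ut _] := dH _ (seg t t01).
  exact: (is_derive_curve (is_derive_line w (v - w) t) (dF _ Ut)).
- move=> t /andP[t0 t1]; have t01 : 0 <= t <= 1 by rewrite !ltW.
  have [Ut [Bt _]] := dH _ (seg t t01).
  by apply: diff_norm_le => //; exact: dF.
- by rewrite ler_wpM2r// lerDl addr_ge0.
Qed.

End LocallyLipschitz.

Section LocalSpray.
Context {R : realType} {n : nat} {M : topologicalType} (X : riemannian R n M).
Implicit Types (p q x : M) (u v w z h : 'rV[R]_n).

(** For [v = w *m invmx G], coercivity bounds the square of [c * |v| / 2] by [bform G v v], which is
    the pairing of [w] with [v] and hence only linear in [v]. *)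
Let invmx_bound (c : R) (G0 G : 'M[R]_n) : 0 < c ->
  (forall v, c * `|v| <= qnorm G0 v) -> posdef G ->
  (forall v, 2^-1 * qnorm G0 v <= qnorm G v) ->
  G \in unitmx /\ `|invmx G| <= 4 * n%:R / c ^+ 2.
Proof.
move=> c0 Hc Gp HG; have Gu := posdef_unitmx Gp; split => //.
have c20 : 0 < c ^+ 2 by rewrite exprn_gt0.
have C0 : 0 <= 4 * n%:R / c ^+ 2 by apply: divr_ge0; [rewrite mulr_ge0|exact: ltW].
apply: mxnorm_op => // w.
set v := w *m invmx G.
have vG : v *m G = w by rewrite /v mulmxKV.
clearbody v.
have [->|v0] := eqVneq v 0; first by rewrite normr0 mulr_ge0.
have nv0 : 0 < `|v| by rewrite normr_gt0.
have h1 : bform G v v <= n%:R * `|w| * `|v|.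
  rewrite /bform vG; apply: le_trans (ler_norm _) _.
  apply: le_trans (entry_le_norm _ _ _) _; apply: le_trans (mxnorm_mul _ _) _.
  by rewrite mxnorm_tr.
have h2 : (c * `|v| / 2) ^+ 2 <= bform G v v.
  have a0 : 0 <= c * `|v| / 2 by rewrite divr_ge0// mulr_ge0// ltW.
  rewrite -(qnorm_sqr _ Gp) ler_pXn2r ?nnegrE ?qnorm_ge0//.
  by have := HG v; have := Hc v; lra.
have h3 : c ^+ 2 * `|v| * `|v| <= 4 * n%:R * `|w| * `|v|.
  by move: (le_trans h2 h1); rewrite !expr2; lra.
rewrite ler_pM2r// in h3.
by rewrite mulrAC ler_pdivlMr// mulrC.
Qed.

Lemma invmx_lipnear p : lipnear (fun u => invmx (gram X p u)) (coord X p p).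
Proof.
have pp := rchart_self X p; set u0 := coord X p p.
have cu0 := coord_cod pp.
have [K K0 [ O Ou HO]] := Ck1_lipnear (@cod_open _ _ _ X p) (gram_smooth X p 1) cu0.
have [c c0 Hc] := qnorm_lower (pnorm_posdef X p).
have cg : {for u0, continuous (gram X p)} by exact: (gram_smooth X p 0 _ cu0).
have N1 := cvg_near cg (qnorm_perturb (pnorm_posdef X p)).
have bound G := @invmx_bound c (gramx X p p) G c0 Hc.
have C0 : 0 <= 4 * n%:R / c ^+ 2.
  by apply: divr_ge0; [rewrite mulr_ge0|rewrite exprn_ge0// ltW].
move: (4 * n%:R / c ^+ 2) C0 bound => C C0 bound.
exists (C + n%:R * (n%:R * C * K) * C).
  by rewrite addr_ge0 ?mulr_ge0.
exists (O `&` ([set u | posdef (gram X p u) -> forall v,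
   2^-1 * qnorm (gramx X p p) v <= qnorm (gram X p u) v <= 2 * qnorm (gramx X p p) v] `&`
   ccod (rchart X p))).
  apply: filterI => //; apply: filterI; first exact: N1.
  exact: cod_nbhs.
have posu u : ccod (rchart X p) u -> posdef (gram X p u).
  by move=> cu; split; [exact: gram_sym|move=> v; exact: gram_pos].
move=> v w [Ov [Pv cv]] [Ow [Pw cw]].
have [vu vC] : gram X p v \in unitmx /\ `|invmx (gram X p v)| <= C.
  by apply: bound; [exact: posu|move=> z; have /andP[] := Pv (posu v cv) z].
have [wu wC] : gram X p w \in unitmx /\ `|invmx (gram X p w)| <= C.
  by apply: bound; [exact: posu|move=> z; have /andP[] := Pw (posu w cw) z].
split; last by apply: (le_trans vC); rewrite lerDl !mulr_ge0.
have [h1 _] := HO w v Ow Ov; rewrite [`|w - v|]distrC in h1.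
move: (gram X p v) (gram X p w) vu wu vC wC h1 => A B Au Bu AC BC h1.
have -> : invmx A - invmx B = invmx A *m (B - A) *m invmx B.
  by rewrite mulmxBr mulmxBl (mulVmx Au) mul1mx -mulmxA (mulmxV Bu) mulmx1.
have h2 : `|invmx A *m (B - A)| <= n%:R * C * (K * `|v - w|).
  apply: le_trans (mxnorm_mul _ _) _.
  by apply: ler_pM => //; rewrite ler_wpM2l.
apply: le_trans (mxnorm_mul _ _) _.
apply: (@le_trans _ _ (n%:R * (n%:R * C * (K * `|v - w|)) * C)).
  by apply: ler_pM => //; rewrite ler_wpM2l.
have -> : n%:R * (n%:R * C * (K * `|v - w|)) * C = (n%:R * (n%:R * C * K) * C) * `|v - w|.
  by ring.
by rewrite ler_wpM2r// lerDr.
Qed.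

Lemma christoffel_lipnear p k i j :
  lipnear1 (fun u => christoffel X p u k i j) (coord X p p).
Proof.
have pp := rchart_self X p.
have part a b c : lipnear1 (fun u => partial (gram X p) a u b c) (coord X p p).
  apply: lipnear_entry; apply: (Ck1_lipnear (@cod_open _ _ _ X p)); last exact: coord_cod.
  by have [_ /(_ (delta_mx 0 a))] := gram_smooth X p 2.
have neg f : lipnear1 f (coord X p p) -> lipnear1 (fun u => - f u) (coord X p p).
  move=> Hf; rewrite (_ : (fun u => _) = (fun u => (-1) * f u)).
    by apply: lipnear1M => //; exact: lipnear1_cst.
  by apply/funext => u; rewrite mulN1r.
apply: lipnear1M; first exact: lipnear1_cst.
apply: lipnear1_sum => l; apply: lipnear1M.
  exact: lipnear_entry (invmx_lipnear p).
by apply: lipnear1D; [exact: lipnear1D|exact: neg].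
Qed.

Let sum2_le (a : 'I_n -> 'I_n -> R) (c : R) : (forall i j, `|a i j| <= c) ->
  `|\sum_i \sum_j a i j| <= n%:R * n%:R * c.
Proof.
move=> ac; apply: le_trans (ler_norm_sum _ _ _) _.
apply: (@le_trans _ _ (\sum_(i < n) n%:R * c)).
  apply: ler_sum => i _; apply: le_trans (ler_norm_sum _ _ _) _.
  apply: (@le_trans _ _ (\sum_(j < n) c)); first exact: ler_sum.
  by rewrite sumr_const card_ord mulr_natl.
by rewrite sumr_const card_ord -[leLHS]mulr_natl mulrA.
Qed.

Let quad_le (g w1 w2 L m : R) : `|g| <= L -> `|w1| <= m -> `|w2| <= m ->
  `|g * w1 * w2| <= L * (m * m).
Proof.
move=> gL w1m w2m; rewrite !normrM -mulrA; apply: ler_pM => //.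
exact: ler_pM.
Qed.

Let quad_lip (g g' w1 w2 w1' w2' L m d e : R) : 0 <= m -> 0 <= e ->
  `|g - g'| <= d -> `|g'| <= L ->
  `|w1| <= m -> `|w2| <= m -> `|w1'| <= m ->
  `|w1 - w1'| <= e -> `|w2 - w2'| <= e ->
  `|g * w1 * w2 - g' * w1' * w2'| <= d * (m * m) + L * (2 * (m * e)).
Proof.
move=> m0 e0 gd gL h1 h2 h1' d1 d2.
have -> : g * w1 * w2 - g' * w1' * w2' =
    (g - g') * w1 * w2 + g' * ((w1 - w1') * w2 + w1' * (w2 - w2')) by ring.
apply: le_trans (ler_normD _ _) _; apply: lerD; first exact: quad_le.
rewrite normrM; apply: ler_pM => //; apply: le_trans (ler_normD _ _) _.
rewrite !normrM; have a1 : `|w1 - w1'| * `|w2| <= e * m by exact: ler_pM.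
by have a2 : `|w1'| * `|w2 - w2'| <= m * e by [exact: ler_pM]; lra.
Qed.

Lemma local_spray p : exists rho K : R,
  spray (fun u w => - gam X p u w) (coord X p p) rho K.
Proof.
set u0 := coord X p p.
have H (kij : 'I_n * 'I_n * 'I_n) : exists KO : R * set 'rV[R]_n, [/\ 0 <= KO.1, nbhs u0 KO.2 &
    forall v w, KO.2 v -> KO.2 w ->
    `|christoffel X p v kij.1.1 kij.1.2 kij.2 - christoffel X p w kij.1.1 kij.1.2 kij.2|
       <= KO.1 * `|v - w| /\ `|christoffel X p v kij.1.1 kij.1.2 kij.2| <= KO.1].
  have [K K0 [ O Ou HO]] := christoffel_lipnear p kij.1.1 kij.1.2 kij.2.
  by exists (K, O).
have [KO HKO] := choice H.
pose L : R := \sum_kij (KO kij).1.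
have L0 : 0 <= L by apply: sumr_ge0 => i _; have [] := HKO i.
have KL kij : (KO kij).1 <= L.
  by rewrite /L (bigD1 kij)//= lerDl; apply: sumr_ge0 => i _; have [] := HKO i.
clearbody L.
have Nall : \forall u \near u0, forall kij, (KO kij).2 u.
  apply: (@filter_forall _ _ (fun kij u => (KO kij).2 u) (nbhs u0)) => kij.
  by have [] := HKO kij.
have /nbhs_ballP[d /= d0 dH] := Nall.
have inball u : `|u - u0| <= d / 2 -> forall kij, (KO kij).2 u.
  move=> ud; apply: dH; rewrite -ball_normE/= distrC; apply: (le_lt_trans ud).
  by rewrite ltr_pdivrMr// ltr_pMr// ltr1n.
have lip u u' k i j : `|u - u0| <= d / 2 -> `|u' - u0| <= d / 2 ->
    `|christoffel X p u k i j - christoffel X p u' k i j| <= L * `|u - u'| /\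
    `|christoffel X p u k i j| <= L.
  move=> ud ud'; have [_ _ /(_ u u' (inball u ud _) (inball u' ud' _))[h1 h2]] := HKO (k, i, j).
  split; last exact: (le_trans h2 (KL _)).
  by apply: (le_trans h1); rewrite ler_wpM2r.
have gamE u w k : gam X p u w 0 k =
    \sum_i \sum_j christoffel X p u k i j * w 0 i * w 0 j by rewrite mxE.
move: (christoffel X p) lip gamE {H HKO inball Nall dH KL} => Chr lip gamE.
move: (gam X p) gamE => ga gamE.
pose N : R := n%:R * n%:R.
have N0 : 0 <= N by rewrite mulr_ge0.
have NL0 := mulr_ge0 N0 L0.
(* [N] counts the pairs of indices, the factor 2 comes from the two velocities in each term, and the
   [+ 1] makes the constant positive. *)
exists (d / 2), (2 * (N * L) + 1); split.
- by rewrite divr_gt0.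
- by rewrite ltr_wpDl// mulr_ge0.
- move=> u w ud; rewrite normrN.
  have w20 : 0 <= `|w| ^+ 2 by exact: sqr_ge0.
  apply: mxnorm_le => [|i k]; first by rewrite mulr_ge0// addr_ge0// mulr_ge0.
  rewrite ord1 gamE; apply: (@le_trans _ _ (N * (L * (`|w| * `|w|)))).
    apply: sum2_le => a b; have [_ h] := lip u u k a b ud ud.
    by apply: quad_le => //; exact: entry_le_norm.
  rewrite -expr2 mulrA; apply: ler_wpM2r => //; lra.
- move=> u u' w w' m ud ud' wm wm'.
  have m0 : 0 <= m by exact: le_trans wm.
  have hA : 0 <= `|u - u'| * m ^+ 2 by rewrite mulr_ge0// sqr_ge0.
  have hB : 0 <= m * `|w - w'| by rewrite mulr_ge0.
  rewrite -opprD normrN; apply: mxnorm_le => [|i k].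
    by rewrite mulr_ge0 ?addr_ge0 ?mulr_ge0.
  have -> : (ga u w - ga u' w') i k = \sum_a \sum_b
      (Chr u k a b * w 0 a * w 0 b - Chr u' k a b * w' 0 a * w' 0 b).
    rewrite ord1 [LHS]mxE [X in _ + X]mxE !gamE -sumrB.
    by apply: eq_bigr => a _; rewrite sumrB.
  have wk a : `|w 0 a| <= m by exact: le_trans (entry_le_norm _ _ _) wm.
  have wk' a : `|w' 0 a| <= m by exact: le_trans (entry_le_norm _ _ _) wm'.
  have dk a : `|w 0 a - w' 0 a| <= `|w - w'|.
    by have := entry_le_norm (w - w') 0 a; rewrite !mxE.
  apply: (@le_trans _ _ (N * (L * `|u - u'| * (m * m) + L * (2 * (m * `|w - w'|))))).
    apply: sum2_le => a b; have [h1 _] := lip u u' k a b ud ud'.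
    have [_ h2] := lip u' u k a b ud' ud.
    exact: quad_lip.
  move: hA hB; rewrite expr2; set D := `|u - u'|; set E := m * `|w - w'|.
  move=> hA hB; have p1 := mulr_ge0 NL0 hA; have p2 := mulr_ge0 NL0 hB.
  have -> : N * (L * D * (m * m) + L * (2 * E)) = N * L * (D * (m * m)) + 2 * (N * L * E).
    by ring.
  have -> : (2 * (N * L) + 1) * (D * (m * m) + E) =
      2 * (N * L * (D * (m * m))) + 2 * (N * L * E) + (D * (m * m) + E) by ring.
  lra.
- move=> u w c; rewrite scalerN; congr (- _); apply/rowP => k.
  rewrite gamE mxE gamE mulr_sumr.
  apply: eq_bigr => a _; rewrite mulr_sumr; apply: eq_bigr => b _.
  by rewrite !mxE; ring.
Qed.

End LocalSpray.

(** * The exponential map *)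

Section LocalExponential.
Context {R : realType} {n : nat} {M : topologicalType} (X : riemannian R n M).
Implicit Types (p q x y : M) (u v w : 'rV[R]_n) (c : R -> M).

Local Notation dom p := (cdom (rchart X p)).
Local Notation F p := (fun u w => - gam X p u w).

Lemma geo_chart_center c (t : R) : (\forall s \near t, {for s, continuous c}) ->
  geo_chart X (c t) c t <-> geodesic_at X c t.
Proof.
move=> cn; split.
  move=> [ct _ dn [dd dE]]; split => //.
    by apply: filterS dn => s [].
  have E : derive1 (derive1 (coord X (c t) \o c)) t =
    - gam X (c t) (coord X (c t) (c t)) (derive1 (coord X (c t) \o c) t).
    exact: etrans (derive1E _ _) dE.
  by move=> k; rewrite E mxE /gam mxE addNr.
move=> [ct dn dd E]; split => //.
  by apply: filterS dn => s ds; rewrite derive1E; exact: derivableP.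
apply: DeriveDef => //; apply: etrans (esym (derive1E _ _)) _; apply/rowP => k.
by rewrite mxE /gam mxE; apply/eqP; rewrite -addr_eq0; apply/eqP; exact: E.
Qed.

Lemma geodesic_chart p c (t : R) : (\forall s \near t, geodesic_at X c s) ->
  dom p (c t) -> geo_chart X p c t.
Proof.
move=> gn pt.
have cn : \forall s \near t, {for s, continuous c} by apply: filterS gn => s [].
apply: (geo_change cn pt); apply/(geo_chart_center cn); exact: nbhs_singleton gn.
Qed.

Lemma geo_chart_sol p c (t : R) : geo_chart X p c t ->
  spray_sol (F p) (coord X p \o c) (derive1 (coord X p \o c)) t.
Proof. by move=> [_ _ dn dd]; split; [exact: nbhs_singleton dn|]. Qed.

Lemma sprayW (G : 'rV[R]_n -> 'rV[R]_n -> 'rV[R]_n) u0 (r r' K : R) :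
  0 < r' <= r -> spray G u0 r K -> spray G u0 r' K.
Proof.
move=> /andP[r'0 r'r] S; split => //.
- exact: spray_K S.
- by move=> u w ur; apply: (spray_bounded S); exact: le_trans r'r.
- by move=> u u' w w' m ur ur'; apply: (spray_lipschitz S); exact: le_trans r'r.
- exact: spray_homog S.
Qed.

Lemma chart_spray p : exists rho K : R,
  spray (F p) (coord X p p) rho K /\
  [set u | `|u - coord X p p| <= rho] `<=` ccod (rchart X p).
Proof.
have [r [K S]] := local_spray X p.
have /nbhs_ballP[d /= d0 dH] := cod_nbhs (rchart_self X p).
have r0 := spray_rho S.
exists (Num.min r (d / 2)), K; split.
  by apply: sprayW S; rewrite ge_min lexx lt_min r0 divr_gt0.
move=> u /= ur; apply: dH; rewrite -ball_normE/= distrC; apply: le_lt_trans ur _.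
by rewrite gt_min ltr_pdivrMr// ltr_pMr// ltr1n orbT.
Qed.

Section FixedChart.
Context (p : M) (rho K : R).
Hypotheses (S : spray (F p) (coord X p p) rho K)
  (rho_cod : [set u | `|u - coord X p p| <= rho] `<=` ccod (rchart X p)).

Let u0 := coord X p p.

Let closed_ball_chart : closed [set x | dom p x /\ `|coord X p x - u0| <= rho].
Proof.
apply: (@closed_coord_preimage _ _ _ X p [set u | `|u - u0| <= rho]) => //.
apply: bounded_closed_compact.
  exists (rho + `|u0|); split; first exact: num_real.
  move=> r rs u /= ur; apply: le_trans (ltW rs).
  rewrite -(subrK u0 u); apply: le_trans (ler_normD _ _) _.
  by rewrite lerD2r.
rewrite (_ : [set u | `|u - u0| <= rho] = (fun u => `|u - u0|) @^-1` [set r | r <= rho])//.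
apply: preimage_closed; last exact: closed_le.
by move=> u _; exact: (cvg_norm (@cvgB _ _ _ (nbhs u) _ id _ _ _ cvg_id (cvg_cst _))).
Qed.

(** A geodesic on [M] is not known beforehand to stay in the chart. As long as it does with velocity
    at most [m], the equation changes the velocity by at most [K * m ^+ 2 <= m / 4] and the position
    by at most [m <= rho / 4], so the bounds in [P] are never attained. *)
Lemma is_exp_sol q v y (m : R) : 0 < m -> 4 * m <= rho -> 4 * K * m <= 1 ->
  dom p q -> `|coord X p q - u0| < rho / 2 -> `|v| <= m / 2 ->
  is_exp X q (v *m trans X p q q) y ->
  exists g h, [/\ g (0 : R) = coord X p q, h (0 : R) = v, dom p y /\ g 1 = coord X p y &
    forall t : R, 0 <= t <= 1 ->
      [/\ spray_sol (F p) g h t, `|g t - u0| <= rho & `|h t| <= m]].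
Proof.
move=> m0 m4 Km pq qrho vm [c [gc c0 vc c1]].
have K0 := spray_K S; have rho0 := spray_rho S.
pose g := coord X p \o c; pose h := derive1 g.
have cc t : 0 <= t <= 1 -> {for t, continuous c} by move=> /gc/nbhs_singleton[].
have sol t : 0 <= t <= 1 -> dom p (c t) -> spray_sol (F p) g h t.
  by move=> /gc gt pt; apply: geo_chart_sol; exact: geodesic_chart.
have z01 : 0 <= (0 : R) <= 1 by rewrite lexx ler01.
have g0 : g 0 = coord X p q by rewrite /g /= c0.
have h0 : h 0 = v.
  have gq : geo_chart X q c 0.
    by apply: geodesic_chart; [exact: gc|rewrite c0; exact: rchart_self].
  have [_ _ dn _] := gq; have d := nbhs_singleton dn.
  have qc0 : dom q (c 0) by rewrite c0; exact: rchart_self.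
  have pc0 : dom p (c 0) by rewrite c0.
  have [_ E] := curve_chart (cc 0 z01) qc0 pc0 d.
  rewrite /h derive1E E.
  have -> : derive1 (coord X q \o c) 0 = v *m trans X p q q by rewrite -vc /velocity c0.
  by rewrite c0 mul_transK//; exact: rchart_self.
clearbody h.
pose P t := dom p (c t) /\ `|g t - u0| < rho /\ `|h t| < m.
have P0 : P 0 by split; [rewrite c0|rewrite g0 h0; split; lra].
have cgh t : 0 <= t <= 1 -> dom p (c t) ->
    {for t, continuous g} /\ {for t, continuous h}.
  move=> t01 pt; have [d1 d2] := sol t t01 pt.
  by split; [exact: is_derive_continuous d1|exact: is_derive_continuous d2].
have oP t : 0 <= t <= 1 -> P t -> \forall s \near t, P s.
  move=> t01 [pt [gt ht]]; have [cg ch] := cgh t t01 pt.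
  have N1 : \forall s \near t, dom p (c s) by exact: cvg_near (cc t t01) (dom_nbhs pt).
  have cg' : {for t, continuous (fun s => `|g s - u0|)}.
    by apply: cvg_norm; apply: cvgB; [exact: cg|exact: cvg_cst].
  have ch' : {for t, continuous (fun s => `|h s|)} by exact: cvg_norm ch.
  have N2 : \forall s \near t, `|g s - u0| < rho.
    exact: cvg_near cg' (open_nbhs_nbhs (conj (@open_lt _ rho) gt)).
  have N3 : \forall s \near t, `|h s| < m.
    exact: cvg_near ch' (open_nbhs_nbhs (conj (@open_lt _ m) ht)).
  by apply: filterS (filterI N1 (filterI N2 N3)) => s [? [? ?]].
have allP t : 0 <= t <= 1 -> P t.
  move=> t01; apply: contrapT => nPt.
  have [s [/andP[s0 s1] ns bs]] := first_exit t01 P0 nPt oP.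
  have s01 : 0 <= s <= 1 by rewrite ltW.
  have [ps gs] : [set x | dom p x /\ `|coord X p x - u0| <= rho] (c s).
    apply: (@closed_cvg _ _ (s^'-) _ (fun r => c r)); first exact: closed_ball_chart.
      near=> r; have [] : P r.
        apply: bs; apply/andP; split; last by near: r; exact: nbhs_left_lt.
        by near: r; apply: nbhs_left_ge.
      by move=> pr [gr _]; split => //; exact: ltW.
    by apply: cvg_at_left_filter; exact: cc.
  have in01 r : 0 <= r <= s -> 0 <= r <= 1.
    by move=> /andP[r0 rs]; rewrite r0 (le_trans rs).
  have domr r : 0 <= r <= s -> dom p (c r).
    move=> /andP[r0]; rewrite le_eqVlt => /predU1P[->//|rs].
    by have [] : P r by apply: bs; rewrite r0.
  have solr r : 0 <= r <= s -> spray_sol (F p) g h r.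
    by move=> rs; apply: sol; [exact: in01|exact: domr].
  have dg : `|g s - g 0| <= m * (s - 0).
    apply: (@mvt_norm _ _ _ g h 0 s m (ltW s0)); first by move=> r /solr[].
    move=> r /andP[r0 rs]; have [_ [_ hr]] : P r by apply: bs; rewrite (ltW r0).
    exact: ltW.
  have dh : `|h s - h 0| <= m / 4 * (s - 0).
    apply: (@mvt_norm _ _ _ h (fun t => F p (g t) (h t)) 0 s _ (ltW s0)).
      by move=> r /solr[].
    move=> r /andP[r0 rs]; have [_ [gr hr]] : P r by apply: bs; rewrite (ltW r0).
    apply: le_trans (spray_bounded S _ (ltW gr)) _.
    have : `|h r| ^+ 2 <= m ^+ 2 by rewrite ler_pXn2r ?nnegrE// ltW.
    rewrite -(ler_pM2l K0) => /le_trans; apply.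
    by have := ler_wpM2r (ltW m0) Km; rewrite expr2; lra.
  have msm : m * (s - 0) <= m by rewrite subr0 ler_piMr// ltW.
  have msm4 : m / 4 * (s - 0) <= m / 4 by rewrite subr0 ler_piMr// divr_ge0// ltW.
  apply: ns; split => //; split.
    rewrite -(subrKA (g 0)); apply: le_lt_trans (ler_normD _ _) _.
    rewrite g0 in dg *; lra.
  rewrite -(subrK (h 0) (h s)); apply: le_lt_trans (ler_normD _ _) _.
  rewrite h0 in dh *; lra.
have o01 : 0 <= (1 : R) <= 1 by rewrite lexx ler01.
exists g, h; split => //.
  by have [p1 _] := allP 1 o01; rewrite /g /= c1 in p1 *.
move=> t t01; have [pt [gt ht]] := allP t t01.
by split; [exact: sol|exact: ltW|exact: ltW].
Unshelve. all: by end_near. Qed.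

(** A solution in the chart at [p] is carried to [M]. [geodesic_at] asks for the equation in another
    chart at each time, which [geo_change] provides. *)
Lemma is_exp_exists : exists2 d : R, 0 < d & forall q v, dom p q ->
  `|coord X p q - u0| <= rho / 2 -> `|v| <= d ->
  exists y, is_exp X q (v *m trans X p q q) y.
Proof.
have [d d0 Hd] := spray_exists S.
exists d => // q v pq qrho vd.
have [g [h [g0 h0 Hgh]]] := Hd _ v qrho vd.
pose c t := cinv (rchart X p) (g t).
have gcod (t : R) : `|t| < 2 -> ccod (rchart X p) (g t).
  by move=> /Hgh[_ gr]; exact: rho_cod.
have cts (t : R) : `|t| < 2 -> {for t, continuous c}.
  move=> t2; have [[dg _] _] := Hgh t t2.
  have cg : {for t, continuous g} by exact: is_derive_continuous dg.
  by apply: continuous_comp cg _; apply: cinv_cts; exact: gcod.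
have n2 (t : R) : `|t| < 2 -> \forall s \near t, `|s| < 2.
  move=> t2; have cn : {for t, continuous (fun s : R => `|s|)} by exact: norm_continuous.
  exact: cvg_near cn (open_nbhs_nbhs (conj (@open_lt _ (2 : R)) t2)).
have cg (t : R) : `|t| < 2 -> g t = (coord X p \o c) t.
  by move=> /gcod gt; rewrite /c /= cinvK.
have dc (t : R) : `|t| < 2 -> is_derive t 1 (coord X p \o c) (h t).
  move=> t2; have [[dg _] _] := Hgh t t2.
  by apply: near_eq_is_derive dg; apply: filterS (n2 t t2) => s; exact: cg.
have dc1 (t : R) : `|t| < 2 -> derive1 (coord X p \o c) t = h t.
  by move=> t2; have [_ E] := dc t t2; rewrite derive1E.
have geo (t : R) : `|t| < 2 -> geodesic_at X c t.
  move=> t2; have cn : \forall s \near t, {for s, continuous c}.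
    by apply: filterS (n2 t t2) => s; exact: cts.
  apply/(geo_chart_center cn); apply: (@geo_change _ _ _ X p (c t) c t cn).
    exact: rchart_self.
  split; [exact: cts|by apply: cinv_dom; exact: gcod| |].
    by apply: filterS (n2 t t2) => s s2; rewrite (dc1 s s2); exact: dc.
  have [[_ dh] _] := Hgh t t2.
  have -> : coord X p (c t) = g t by rewrite (cg t t2).
  rewrite (dc1 t t2); apply: near_eq_is_derive dh.
  by apply: filterS (n2 t t2) => s s2; rewrite (dc1 s s2).
have c0 : c 0 = q by rewrite /c g0 coordK.
clearbody c.
exists (c 1), c; split => //.
  move=> t /andP[t0 t1]; have t2 : `|t| < 2 by rewrite ger0_norm//; lra.
  by apply: filterS (n2 t t2) => s; exact: geo.
have z2 : `|0 : R| < 2 by rewrite normr0.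
rewrite /velocity c0.
have qc0 : dom q (c 0) by rewrite c0; exact: rchart_self.
have pc0 : dom p (c 0) by rewrite c0.
have [_ E] := curve_chart (cts 0 z2) pc0 qc0 (dc 0 z2).
apply: etrans (derive1E _ _) _; apply: etrans E _.
exact: (f_equal2 (fun a b => a *m trans X p q b) h0 c0).
Qed.

End FixedChart.

(** In the chart, the exponential map at [q] is a translation up to a Lipschitz error [e], uniformly
    in [q]. With [v = w] the estimate also gives the uniqueness of its values. *)
Lemma local_exp p (e : R) : 0 < e -> exists2 d0 : R, 0 < d0 & exists2 N, nbhs p N &
  forall d q, 0 < d <= d0 -> N q -> dom p q /\
  (forall v, `|v| <= d -> exists y, is_exp X q (v *m trans X p q q) y) /\
  (forall v w y z, `|v| <= d -> `|w| <= d -> is_exp X q (v *m trans X p q q) y ->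
     is_exp X q (w *m trans X p q q) z ->
     [/\ dom p y, dom p z, `|coord X p y - coord X p q| <= 2 * d &
       `|coord X p y - coord X p z - (v - w)| <= e * `|v - w|]).
Proof.
move=> e0; have [rho [K [S rc]]] := chart_spray p.
have K0 := spray_K S; have rho0 := spray_rho S.
have [d1 d10 Hd1] := is_exp_exists S rc.
(* [rho / 4] confines the geodesics to the chart, [2 * d1] gives their existence, [1 / (4 * K)]
   bounds their velocities and [e / (4 * K)] makes the Lipschitz error at most [e]. *)
pose m0 := Num.min (Num.min 1 (rho / 4)) (Num.min (2 * d1) (Num.min 1 e / (4 * K))).
have K40 : 0 < 4 * K by rewrite mulr_gt0.
have m00 : 0 < m0 by rewrite !lt_min ltr01 !divr_gt0 ?mulr_gt0// lt_min ltr01.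
have m1 : m0 <= 1 by rewrite !ge_min lexx.
have m4 : m0 <= rho / 4 by rewrite !ge_min lexx orbT.
have md1 : m0 <= 2 * d1 by rewrite !ge_min lexx !orbT.
have mK : m0 <= Num.min 1 e / (4 * K) by rewrite !ge_min lexx !orbT.
rewrite ler_pdivlMr// le_min in mK; move: mK => /andP[mK1 mKe].
clearbody m0.
pose N := [set q | dom p q /\ `|coord X p q - coord X p p| < rho / 2].
have pN : nbhs p N.
  have pp := rchart_self X p.
  have c : {for p, continuous (fun q => `|coord X p q - coord X p p|)}.
    by apply: cvg_norm; apply: cvgB; [exact: coord_cts|exact: cvg_cst].
  have c0 : `|coord X p p - coord X p p| < rho / 2 by rewrite subrr normr0 divr_gt0.
  have c1 : \forall q \near p, `|coord X p q - coord X p p| < rho / 2.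
    exact: cvg_near c (open_nbhs_nbhs (conj (@open_lt _ (rho / 2)) c0)).
  exact: filterI (dom_nbhs pp) c1.
exists (m0 / 2); first by rewrite divr_gt0.
exists N => // d q /andP[d0 dm] [pq qr]; split => //; split.
  by move=> v vm; apply: Hd1 => //; [exact: ltW|lra].
pose m := 2 * d.
have m0m : m <= m0 by rewrite /m; lra.
have m_gt0 : 0 < m by rewrite /m; lra.
have dE : d = m / 2 by rewrite /m; lra.
have mK1' : m * (4 * K) <= 1 by apply: le_trans mK1; rewrite ler_wpM2r// ltW.
have mKe' : m * (4 * K) <= e by apply: le_trans mKe; rewrite ler_wpM2r// ltW.
clearbody m; rewrite {}dE.
move=> v w y z vm wm ey ez.
have m4r : 4 * m <= rho by lra.
have Km : 4 * K * m <= 1 by rewrite mulrC.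
have [g1 [h1 [g10 h10 [py g11] s1]]] := is_exp_sol S rc m_gt0 m4r Km pq qr vm ey.
have [g2 [h2 [g20 h20 [pz g21] s2]]] := is_exp_sol S rc m_gt0 m4r Km pq qr wm ez.
split => //.
  rewrite -g11 -g10.
  have := @mvt_norm _ _ _ g1 h1 0 1 m ler01; rewrite subr0 mulr1 => H.
  have -> : 2 * (m / 2) = m by lra.
  apply: H; first by move=> t /s1[[]].
  move=> t /andP[t0 t1]; have t01 : 0 <= t <= 1 by rewrite (ltW t0) (ltW t1).
  by have [] := s1 t t01.
have := spray_near_id S _ Km s1 s2.
rewrite m_gt0 (le_trans m0m m1) g10 g20 g11 g21 h10 h20 => /(_ isT erefl) H.
apply: (le_trans H); apply: ler_wpM2r => //.
by rewrite mulrC.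
Qed.

End LocalExponential.

(** * Openness of the image of unstable manifolds *)

HB.instance Definition _ (R : realType) (m n : nat) := Complete.on 'M[R]_(m, n).

(* The solution is the fixed point of [b |-> b - (G b - y) *m pi]. *)
Lemma transverse_fixpoint (R : realType) (n : nat) (pi : 'M[R]_n)
    (G : 'rV[R]_n -> 'rV[R]_n) (b0 y : 'rV[R]_n) (rho : R) :
  0 <= rho -> pi *m pi = pi -> b0 *m pi = b0 ->
  (forall b b', b *m pi = b -> b' *m pi = b' -> `|b - b0| <= rho -> `|b' - b0| <= rho ->
     `|(G b - G b' - (b - b')) *m pi| <= 2^-1 * `|b - b'|) ->
  `|(G b0 - y) *m pi| <= rho / 2 ->
  exists b, [/\ b *m pi = b, `|b - b0| <= rho & (G b - y) *m pi = 0].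
Proof.
move=> rho0 pipi b0pi HG Hy.
pose U := [set b : 'rV[R]_n | b *m pi = b /\ `|b - b0| <= rho].
pose H b := b - (G b - y) *m pi.
have HC b b' : U b -> U b' -> `|H b - H b'| <= 2^-1 * `|b - b'|.
  move=> [bpi br] [bpi' br']; have := HG b b' bpi bpi' br br'.
  suff -> : H b - H b' = - ((G b - G b' - (b - b')) *m pi) by rewrite normrN.
  rewrite /H !mulmxBl bpi bpi'.
  move: (G b *m pi) (G b' *m pi) (y *m pi) => x1 x2 x3.
  by apply/rowP => i; rewrite !mxE; ring.
have Ub0 : U b0 by split; rewrite ?subrr ?normr0.
have HU : {homo H : b / U b >-> U b}.
  move=> b Ub; have [bpi br] := Ub; split.
    by rewrite /H mulmxBl bpi -(mulmxA _ pi) pipi.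
  have -> : H b - b0 = (H b - H b0) + (H b0 - b0).
    by move: (H b) (H b0) => x1 x2; rewrite addrA subrK.
  apply: le_trans (ler_normD _ _) _.
  have E : H b0 - b0 = - ((G b0 - y) *m pi) by rewrite /H addrAC subrr add0r.
  rewrite E normrN; have := HC b b0 Ub Ub0; lra.
have cU : closed U.
  have -> : U = (fun b => b *m pi - b) @^-1` [set 0] `&` (fun b => `|b - b0|) @^-1` [set r | r <= rho].
    apply/seteqP; split=> b.
      by move=> [b1 b2]; split => //=; rewrite b1 subrr.
    by move=> [/= /eqP + b2]; rewrite subr_eq0 => /eqP.
  apply: closedI; apply: preimage_closed.
  - move=> b _; apply: (@cvgB _ _ _ (nbhs b)); last exact: cvg_id.
    by apply: cvg_mulmx; [exact: cvg_id|exact: cvg_cst].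
  - exact: (@accessible_closed_set1 _ (@hausdorff_accessible _ (@norm_hausdorff _ _))).
  - by move=> b _; exact: (cvg_norm (@cvgB _ _ _ (nbhs b) _ id _ _ _ cvg_id (cvg_cst _))).
  - exact: closed_le.
have [||b [bpi br] bH] := @banach_fixed_point R 'rV[R]_n U (mkfun_fun HU) _ cU; last first.
- exists b; split => //; move/eqP: bH; rewrite /= /H -subr_eq0 opprB addrCA subrr addr0.
  by move=> /eqP.
- by exists b0.
- have h2 : 0 <= 2^-1 :> R by rewrite invr_ge0.
  exists (NngNum h2); split => /=; first by rewrite invf_lt1// ltr1n.
  by move=> [b b'] [/= Ub Ub']; exact: HC.
Qed.

Lemma powR_small (R : realType) (alpha C : R) : 0 < alpha -> 0 <= C ->
  exists2 t0 : R, 0 < t0 & forall t, 0 <= t <= t0 -> C * t `^ alpha <= 1.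
Proof.
move=> a0 C0; have C1 : 0 < C + 1 by lra.
exists ((C + 1)^-1 `^ alpha^-1); first by rewrite powR_gt0 ?invr_gt0.
move=> t /andP[t_ge0 tt].
have : t `^ alpha <= ((C + 1)^-1 `^ alpha^-1) `^ alpha.
  by apply: ge0_ler_powR => //; rewrite ?nnegrE ?powR_ge0 ?(ltW a0).
rewrite -powRrM mulVf ?gt_eqF// powRr1 ?invr_ge0 ?(ltW C1)// => h.
have : C * t `^ alpha <= C * (C + 1)^-1 by rewrite ler_wpM2l.
move=> /le_trans; apply; rewrite ler_pdivrMr//; lra.
Qed.

Section ConjugateProjection.
Context {F : fieldType} {n : nat}.
Variables (T T' U V : 'M[F]_n).

(** [U] and [V] are meant in the tangent coordinates at a moving point, vectors in those of a fixed
    chart; [T] and [T'] are the two coordinate changes. *)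
Definition conj_proj : 'M[F]_n := T *m proj_mx U V *m T'.

Lemma mul_conj_proj (v : 'rV[F]_n) : v *m conj_proj = v *m T *m proj_mx U V *m T'.
Proof. by rewrite /conj_proj; move: (proj_mx U V) => P; rewrite !mulmxA. Qed.

Hypotheses (TT' : T *m T' = 1%:M) (T'T : T' *m T = 1%:M) (UV0 : (U :&: V = 0)%MS).

Lemma conj_proj_proj : conj_proj *m conj_proj = conj_proj.
Proof.
have PP := proj_mx_proj UV0; rewrite /conj_proj; move: (proj_mx U V) PP => P PP.
by rewrite !mulmxA -[_ *m T' *m T]mulmxA T'T mulmx1 -[T *m P *m P]mulmxA PP.
Qed.

Lemma conj_projP (v : 'rV[F]_n) : v *m conj_proj = v <-> (v *m T <= U)%MS.
Proof.
split=> [<-|vU]; last by rewrite mul_conj_proj proj_mx_id// -mulmxA TT' mulmx1.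
by rewrite mul_conj_proj -mulmxA T'T mulmx1 proj_mx_sub.
Qed.

Lemma conj_proj_stable (v : 'rV[F]_n) : (v <= V)%MS -> v *m T' *m conj_proj = 0.
Proof.
move=> vV; rewrite mul_conj_proj -[v *m _ *m _]mulmxA T'T mulmx1.
by rewrite proj_mx_0// mul0mx.
Qed.

Lemma conj_proj0 (v : 'rV[F]_n) : (v *m T <= U + V)%MS -> v *m conj_proj = 0 ->
  exists2 s : 'rV[F]_n, (s <= V)%MS & v = s *m T'.
Proof.
move=> vUV; rewrite mul_conj_proj => v0.
exists (v *m T); last by rewrite -mulmxA TT' mulmx1.
have := proj_mx_compl_sub vUV.
by rewrite -[X in _ - X]mulmx1 -T'T mulmxA v0 mul0mx subr0.
Qed.

End ConjugateProjection.

Section UnstableGraphs.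
Context {R : realType} {n : nat} {M : topologicalType} (X : riemannian R n M).
Implicit Types (p q x y z : M) (v w : 'rV[R]_n).

Local Notation dom p := (cdom (rchart X p)).

Lemma gnorm_equiv p : exists2 k : R, 0 < k & exists2 N, nbhs p N & forall q, N q ->
  dom p q /\ forall v, gnorm X q v <= k * `|v *m trans X q p q| /\
    `|v *m trans X q p q| <= k * gnorm X q v.
Proof.
have pp := rchart_self X p.
have [c c0 Hc] := qnorm_lower (gramx_posdef pp).
pose C := Num.sqrt (n%:R ^+ 2 * `|gramx X p p|).
exists (2 * C + 2 / c).
  by rewrite ltr_wpDl ?mulr_ge0 ?sqrtr_ge0// divr_gt0.
exists [set q | dom p q /\
   forall v, 2^-1 * qnorm (gramx X p p) v <= qnorm (gramx X p q) v <= 2 * qnorm (gramx X p p) v].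
  apply: filterS (filterI (dom_nbhs pp) (cvg_near (gramx_cts pp) (qnorm_perturb (gramx_posdef pp)))).
  by move=> q [pq h]; split => //; apply: h; exact: gramx_posdef.
move=> q [pq Hq]; split => // v.
rewrite gnormE (gnorm_trans (p := q) (q := p))//.
move: (v *m _) => w; have /andP[h1 h2] := Hq w.
have h3 := qnorm_upper (gramx X p p) w.
have h4 := Hc w; have w0 := normr_ge0 w.
have C0 : 0 <= C by exact: sqrtr_ge0.
have ic0 : 0 < c^-1 by rewrite invr_gt0.
have q0 : 0 <= qnorm (gramx X p q) w by exact: qnorm_ge0.
rewrite -/C in h3; clearbody C; split.
  apply: le_trans h2 _; rewrite mulrDl.
  have : 0 <= 2 / c * `|w| by rewrite !mulr_ge0// ltW.
  lra.
rewrite mulrDl; have h5 : 0 <= 2 * C * qnorm (gramx X p q) w by rewrite !mulr_ge0.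
have h6 : `|w| <= c^-1 * qnorm (gramx X p p) w by rewrite ler_pdivlMl.
have h7 : c^-1 * qnorm (gramx X p p) w <= c^-1 * (2 * qnorm (gramx X p q) w).
  by rewrite ler_pM2l//; lra.
by apply: le_trans h6 (le_trans h7 _); rewrite mulrA [c^-1 * 2]mulrC; lra.
Qed.

(** The derivative of [psi] vanishes at 0, so by the Hoelder condition the slope of the graph is of
    order [tau ^ alpha] on the ball: small manifolds are flat. *)
Lemma graph_lipschitz q (E : 'M[R]_n) (psi : 'rV[R]_(\rank E) -> 'rV[R]_n)
    (T : 'M[R]_n) (alpha tau L k : R) :
  let b := row_base E in let D := [set a | gnorm X q (a *m b) < tau] in
  0 < alpha -> 0 < tau -> 0 <= k -> (forall v, `|v *m T| <= k * gnorm X q v) ->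
  (forall a, D a -> differentiable psi a) ->
  (forall a a' (w : 'rV[R]_(\rank E)), D a -> D a' -> gnorm X q ('d psi a w - 'd psi a' w)
     <= L * gnorm X q ((a - a') *m b) `^ alpha * gnorm X q (w *m b)) ->
  (forall w : 'rV[R]_(\rank E), 'd psi 0 w = 0) -> forall a a', D a -> D a' ->
  `|(psi a - psi a') *m T| <= k * `|L| * tau `^ alpha * gnorm X q ((a - a') *m b).
Proof.
move=> b D al0 tau0 k0 Tk dpsi hol psi0 a a' Da Da'.
pose w := a - a'; pose c (t : R) := a' + t *: w.
have G := gramx_posdef (rchart_self X q).
have Dc (t : R) : 0 <= t <= 1 -> D (c t).
  move=> /andP[t0 t1]; rewrite /D /=.
  have -> : c t *m b = (1 - t) *: (a' *m b) + t *: (a *m b).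
    rewrite /c /w; move: (a) (a') => x1 x2.
    rewrite mulmxDl -!scalemxAl mulmxBl scalerBr scalerBl scale1r.
    by rewrite addrA addrAC.
  rewrite !gnormE in Da Da' *.
  apply: le_lt_trans (qnormD _ _ G) _; rewrite !qnormZ ger0_norm ?subr_ge0// ger0_norm//.
  rewrite /D/= gnormE in Da; rewrite /D/= gnormE in Da'.
  case: (ltgtP t 1) t1 => // [t1|->] _; last by lra.
  have h1 : (1 - t) * qnorm (gramx X q q) (a' *m b) < (1 - t) * tau by rewrite ltr_pM2l// subr_gt0.
  have h2 : t * qnorm (gramx X q q) (a *m b) <= t * tau by rewrite ler_wpM2l// ltW.
  lra.
have D0 : D 0 by rewrite /D /= mul0mx gnormE qnorm0.
have L0 (x : 'rV_n) : 0 <= gnorm X q x by exact: qnorm_ge0.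
pose g (t : R) := psi (c t) *m T.
pose dg (t : R) := w *m jac psi (c t) *m T.
have dgP (t : R) : 0 <= t <= 1 -> is_derive t 1 g (dg t).
  move=> t01; rewrite /dg -[_ *m T]addr0.
  have H1 := @is_derive_segment _ _ _ psi a' w t (dpsi _ (Dc t t01)).
  have H2 := @is_derive_mulmx _ _ _ _ (fun s => psi (c s)) (fun=> T) t _ _ H1 (is_derive_cst _ _ _).
  by rewrite mulmx0 in H2.
have := @mvt_norm _ _ _ g dg 0 1 (k * `|L| * tau `^ alpha * gnorm X q (w *m b)) ler01 dgP.
have -> : g 1 = psi a *m T by rewrite /g /c scale1r /w addrC subrK.
have -> : g 0 = psi a' *m T by rewrite /g /c scale0r addr0.
rewrite subr0 mulr1 (mulmxBl (psi a)); apply=> t /andP[t0 t1].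
have Dt : D (c t) by apply: Dc; rewrite !ltW.
clearbody c; rewrite /dg.
suff key (u u' z : 'rV[R]_n) : u = u' -> z = 0 ->
    gnorm X q (u' - z) <= L * gnorm X q ((c t - 0) *m b) `^ alpha * gnorm X q (w *m b) ->
    `|u *m T| <= k * `|L| * tau `^ alpha * gnorm X q (w *m b).
  exact: key (mul_jac psi (c t) w) (psi0 w) (hol (c t) 0 w Dt D0).
move=> -> ->; rewrite subr0 (subr0 (c t)) => h; rewrite /D/= in Dt.
have h1 : gnorm X q (c t *m b) `^ alpha <= tau `^ alpha.
  by apply: ge0_ler_powR => //; rewrite ?nnegrE ?(ltW al0) ?(ltW tau0)// ltW.
have h2 : L * gnorm X q (c t *m b) `^ alpha <= `|L| * tau `^ alpha.
  apply: le_trans (ler_norm _) _; rewrite normrM [X in _ * X]ger0_norm ?powR_ge0//.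
  by rewrite ler_wpM2l.
apply: le_trans (Tk u') _; rewrite -!mulrA ler_wpM2l// mulrA.
by apply: le_trans h _; rewrite ler_wpM2r.
Qed.

Lemma coord_pullback p a (O : set M) : dom p a -> nbhs a O -> exists2 r : R, 0 < r &
  forall y, dom p y -> `|coord X p y - coord X p a| < r -> O y.
Proof.
move=> pa aO; have /nbhs_ballP[r /= r0 rO] := cvg_near (cinv_cvg pa) aO.
exists r => // y py ya; rewrite -(coordK py); apply: rO.
by rewrite -ball_normE /= distrC.
Qed.

Section Projection.
Context {f finv : M -> M} {Lambda : set M} {Es Eu : M -> 'M[R]_n} {chi : R}.
Hypothesis H : hyperbolic X f finv Lambda Es Eu chi.

Lemma hyp_cap q : Lambda q -> (Eu q :&: Es q = 0)%MS.
Proof.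
move=> Lq; apply/eqP/rowV0P => v; rewrite sub_capmx => /andP[vu vs].
exact: (hyp_direct H Lq vs vu).
Qed.

Lemma hyp_full q v : Lambda q -> (v <= Eu q + Es q)%MS.
Proof.
move=> Lq; have [s [u [ss uu ->]]] := hyp_split H v Lq.
by rewrite addmx_sub//; [apply: submx_trans ss _; exact: addsmxSr|apply: submx_trans uu _; exact: addsmxSl].
Qed.

Definition unstable_proj p q : 'M[R]_n :=
  conj_proj (trans X p q q) (trans X q p q) (Eu q) (Es q).

(** Transversality, with both spaces at the same point, bounds the unstable component by the sum of
    the two components, uniformly in [q]. *)
Lemma unstable_proj_bound p : Lambda p -> exists2 e : R, 0 < e & exists2 N, nbhs p N &
  forall q, Lambda q -> N q -> dom p q -> forall v, e * `|v *m unstable_proj p q| <= `|v|.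
Proof.
move=> Lp; have [e e0 [N pN HN]] := transversality H Lp.
exists e => //; exists N => // q Lq Nq pq v; have qq := rchart_self X q.
rewrite leNgt; apply/negP => lt.
pose w := v *m trans X p q q; pose u := w *m proj_mx (Eu q) (Es q).
have uE : (u <= Eu q)%MS by exact: proj_mx_sub.
have sE : (u - w <= Es q)%MS.
  by rewrite -opprB eqmx_opp; exact: proj_mx_compl_sub (hyp_full _ _).
have uT : u *m trans X q p q = v *m unstable_proj p q by rewrite mul_conj_proj.
have := HN q q u (u - w) Lq Nq Lq Nq uE sE.
have -> : u *m trans X q p q - (u - w) *m trans X q p q = v.
  by rewrite -mulmxBl subKr (mul_transK v pq qq).
by rewrite uT => /(_ (ltW lt)) E; move: lt; rewrite E normr0 mulr0 normr_lt0.
Qed.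

(** In the chart at [p] the manifold is the image of the points [v + ps v], [v] unstable, under a
    map close to a translation. The projection [P] kills [ps v], so the unstable component of this
    parametrisation is a perturbation of a translation, and the equation that puts [y'] over [y]
    along the stable space is solved by [transverse_fixpoint]. *)
Lemma graph_transverse p alpha L N0 : Lambda p -> 0 < alpha -> nbhs p N0 ->
  exists2 tau0 : R, 0 < tau0 & exists2 N, nbhs p N & forall q tau V,
  Lambda q -> N q -> 0 < tau <= tau0 -> local_graph X alpha tau L (Eu q) (Es q) q V ->
  [/\ dom p q, forall a, V a -> dom p a /\ N0 a &
  forall a O, V a -> nbhs a O -> exists2 O', nbhs a O' & forall y, O' y ->
    exists y' s, [/\ V y', O y', dom p y /\ dom p y', (s <= Es q)%MS &
      coord X p y' - coord X p y = s *m trans X q p q]].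
Proof.
move=> Lp al0 pN0; have pp := rchart_self X p.
have [ep ep0 [Nt pNt Ht]] := unstable_proj_bound Lp.
have [k k0 [Nk pNk Hk]] := gnorm_equiv p.
(* The exponential map contributes an error [2 * e] times the distance of [v] and [w], since
   [v + ps v] is 2-Lipschitz, and the projection costs a factor [1 / ep]; the product has to be at
   most [1 / 2]. *)
pose e := Num.min 1 (ep / 4).
have e0 : 0 < e by rewrite lt_min ltr01 divr_gt0.
have e1 : e <= 1 by rewrite ge_min lexx.
have e4 : e <= ep / 4 by rewrite ge_min lexx orbT.
clearbody e.
have [d0 d00 [Ne pNe He]] := local_exp X p e0.
have [eta eta0 Heta] := coord_pullback pp pN0.
(* Points of the manifold are within [2 * d <= eta / 4] of [q], itself within [eta / 2] of [p]. *)
pose d := Num.min d0 (eta / 8).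
have dd : 0 < d <= d0 by rewrite lt_min d00 divr_gt0//= ge_min lexx.
have d_gt0 : 0 < d by case/andP: dd.
have d8 : d <= eta / 8 by rewrite ge_min lexx orbT.
clearbody d.
have kLk : 0 <= k * `|L| * k by rewrite !mulr_ge0// ltW.
have [t0 t00 Ht0] := powR_small al0 kLk.
(* [t0] makes [ps] 1-Lipschitz, and [d / (2 * k)] then keeps [v + ps v] where the exponential map is
   controlled. *)
pose tau0 := Num.min t0 (d / (2 * k)).
have k20 : 0 < 2 * k by rewrite mulr_gt0.
exists tau0; first by rewrite lt_min t00 divr_gt0.
have pNn : \forall q \near p, `|coord X p q - coord X p p| < eta / 2.
  have c : {for p, continuous (fun q => `|coord X p q - coord X p p|)}.
    by apply: cvg_norm; apply: cvgB; [exact: coord_cts|exact: cvg_cst].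
  have c0 : `|coord X p p - coord X p p| < eta / 2 by rewrite subrr normr0 divr_gt0.
  exact: cvg_near c (open_nbhs_nbhs (conj (@open_lt _ (eta / 2)) c0)).
exists (Nt `&` Nk `&` Ne `&` [set q | `|coord X p q - coord X p p| < eta / 2]).
  exact: filterI (filterI (filterI pNt pNk) pNe) pNn.
move=> q tau V Lq [[[Ntq Nkq] Neq] /= nq] /andP[tau_gt0]; rewrite le_min => /andP[taut taud].
have [pq [Hex Hcl]] := He d q dd Neq; have [_ Hkq] := Hk q Nkq.
have qq := rchart_self X q.
have HP := Ht q Lq Ntq pq.
have TT' := transK pq qq; have T'T := transK qq pq.
rewrite /local_graph => -[psi [psiE psid psih [psi0 dpsi0] VE]].
have small : k * `|L| * k * tau `^ alpha <= 1 by apply: Ht0; rewrite (ltW tau_gt0).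
have taud2 : 2 * (k * tau) <= d.
  by move: taud; rewrite ler_pdivlMr// mulrC mulrA.
have lip := graph_lipschitz al0 tau_gt0 (ltW k0) (fun v => (Hkq v).2) psid psih dpsi0.
move: psiE VE lip; clear psid psih dpsi0.
set b := row_base (Eu q); set D := [set a | gnorm X q (a *m b) < tau] => psiE VE lip.
have Epr : conj_proj (trans X p q q) (trans X q p q) (Eu q) (Es q) *m
   conj_proj (trans X p q q) (trans X q p q) (Eu q) (Es q) =
   conj_proj (trans X p q q) (trans X q p q) (Eu q) (Es q).
  exact: conj_proj_proj T'T (hyp_cap Lq).
have EP v := conj_projP TT' T'T (hyp_cap Lq) v.
have Est v := conj_proj_stable T'T (hyp_cap Lq) (v := v).
have E0 v := conj_proj0 TT' T'T (hyp_full (v *m trans X p q q) Lq).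
rewrite /unstable_proj in HP.
move: (conj_proj _ _ _ _) Epr EP Est E0 HP => P PP EP Est E0 HP.
move: (trans X p q q) (trans X q p q) TT' T'T Hkq Hex Hcl lip EP Est E0 =>
  T T' TT' T'T Hk' Hex Hcl lip EP Est E0.
have TK v : v *m T *m T' = v by rewrite -mulmxA TT' mulmx1.
have T'K v : v *m T' *m T = v by rewrite -mulmxA T'T mulmx1.
have gk v : gnorm X q (v *m T) <= k * `|v| by have [+ _] := Hk' (v *m T); rewrite TK.
have kg v : `|v| <= k * gnorm X q (v *m T) by have [_] := Hk' (v *m T); rewrite TK.
(* [is_exp] is a relation: values are chosen, with [q] as a default outside the ball. *)
have [E HE] : exists E : 'rV[R]_n -> M, forall v, `|v| <= d -> is_exp X q (v *m T) (E v).
  have : forall v, exists y, `|v| <= d -> is_exp X q (v *m T) y.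
    move=> v; have [vd|nvd] := pselect (`|v| <= d); last by exists q.
    by have [y ?] := Hex v vd; exists y.
  by move=> /choice[E HE]; exists E.
pose A (v : 'rV[R]_n) := v *m T *m pinvmx b.
have Ab v : v *m P = v -> A v *m b = v *m T.
  by move=> /EP vE; rewrite /A mulmxKpV// eq_row_base.
pose ps v := psi (A v) *m T'.
pose Dom v := v *m P = v /\ gnorm X q (v *m T) < tau.
have DA v : Dom v -> D (A v) by move=> [/Ab vP vt]; rewrite /D /= vP.
have psP v : Dom v -> ps v *m P = 0 by move=> /DA/psiE/Est.
have pslip v w : Dom v -> Dom w -> `|ps v - ps w| <= `|v - w|.
  move=> Dv Dw; rewrite /ps -mulmxBl; apply: le_trans (lip _ _ (DA v Dv) (DA w Dw)) _.
  rewrite mulmxBl (Ab v)// ?(Ab w)//; [|by case: Dw|by case: Dv].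
  rewrite -mulmxBl; apply: (@le_trans _ _ (k * `|L| * tau `^ alpha * (k * `|v - w|))).
    by rewrite ler_wpM2l// !mulr_ge0 ?powR_ge0// ltW.
  have := ler_wpM2r (normr_ge0 (v - w)) small; lra.
have Dom0 : Dom 0 by split; rewrite mul0mx// gnormE qnorm0.
have ps0 : ps 0 = 0 by rewrite /ps /A !mul0mx psi0 mul0mx.
have Domd v : Dom v -> `|v + ps v| <= d.
  move=> Dv; have h1 := pslip v 0 Dv Dom0; rewrite ps0 !subr0 in h1.
  have h2 : `|v| <= k * tau.
    by apply: le_trans (kg v) _; rewrite ler_wpM2l ?(ltW k0)// ltW//; case: Dv.
  apply: le_trans (ler_normD _ _) _; lra.
have Darg v : Dom v -> (v + ps v) *m T = A v *m b + psi (A v).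
  by move=> [vP _]; rewrite mulmxDl /ps T'K Ab.
have VEx v : Dom v -> V (E (v + ps v)).
  move=> Dv; rewrite VE; exists (A v); first exact: DA.
  by rewrite -Darg//; apply: HE; exact: Domd.
have Vrep a : V a -> exists2 v, Dom v & is_exp X q ((v + ps v) *m T) a.
  rewrite VE => -[c Dc ca]; exists (c *m b *m T').
    split; last by rewrite T'K.
    by apply/EP; rewrite T'K -(eq_row_base (Eu q)); exact: submxMl.
  have Ac : A (c *m b *m T') = c by rewrite /A T'K mulmxKp// row_base_free.
  rewrite Darg ?Ac//; split; last by rewrite T'K.
  by apply/EP; rewrite T'K -(eq_row_base (Eu q)); exact: submxMl.
have coordE v y z : `|v| <= d -> is_exp X q (v *m T) y -> is_exp X q (v *m T) z ->
    coord X p y = coord X p z.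
  move=> vd vy vz; have [_ _ _] := Hcl v v y z vd vd vy vz.
  by rewrite subrr subr0 normr0 mulr0 normr_le0 subr_eq0 => /eqP.
split => //.
  move=> a /Vrep[v Dv va].
  have vd := Domd v Dv; have [pa _ aq _] := Hcl _ _ _ _ vd vd va va.
  split => //; apply: Heta => //.
  rewrite -(subrK (coord X p q) (coord X p a)) -addrA.
  apply: le_lt_trans (ler_normD _ _) _; lra.
move=> a O Va aO; have [v0 Dv0 va] := Vrep a Va.
have vd0 := Domd v0 Dv0; have [pa _ _ _] := Hcl _ _ _ _ vd0 vd0 va va.
have [r1 r10 Hr1] := coord_pullback pa aO.
pose G v := coord X p (E (v + ps v)).
have Ga : G v0 = coord X p a by exact: coordE (HE _ vd0) va.
have Gdif v w : Dom v -> Dom w ->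
    `|G v - G w - ((v + ps v) - (w + ps w))| <= 2 * e * `|v - w| /\
    `|(v + ps v) - (w + ps w)| <= 2 * `|v - w|.
  move=> Dv Dw; have dv := Domd v Dv; have dw := Domd w Dw.
  have [_ _ _ h] := Hcl _ _ _ _ dv dw (HE _ dv) (HE _ dw).
  have h2 : `|(v + ps v) - (w + ps w)| <= 2 * `|v - w|.
    rewrite opprD addrACA; apply: le_trans (ler_normD _ _) _.
    have := pslip v w Dv Dw; lra.
  split => //; apply: le_trans h _.
  by rewrite [2 * e]mulrC -mulrA ler_wpM2l// ltW.
have [t_lt t_pos] : gnorm X q (v0 *m T) < tau /\ 0 < tau - gnorm X q (v0 *m T).
  by have [_ ?] := Dv0; rewrite subr_gt0.
(* The second bound keeps the ball of radius [rho] around [v0] in the domain of the graph. The first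
   keeps [y'] in [O], as coordinates move by at most [4 * rho < r1]. *)
pose rho := Num.min (r1 / 8) ((tau - gnorm X q (v0 *m T)) / (2 * k)).
have rho0 : 0 < rho by rewrite lt_min !divr_gt0.
have rho1 : rho <= r1 / 8 by rewrite ge_min lexx.
have rhok : rho <= (tau - gnorm X q (v0 *m T)) / (2 * k) by rewrite ge_min lexx orbT.
clearbody rho.
rewrite ler_pdivlMr// in rhok.
have Domr v : v *m P = v -> `|v - v0| <= rho -> Dom v.
  move=> vP vr; split => //.
  have -> : v *m T = (v - v0) *m T + v0 *m T by rewrite -mulmxDl subrK.
  apply: le_lt_trans (_ : _ <= gnorm X q ((v - v0) *m T) + gnorm X q (v0 *m T)) _.
    rewrite !gnormE; exact: qnormD (gramx_posdef qq).
  have h1 := gk (v - v0).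
  have h2 : k * `|v - v0| <= k * rho by rewrite ler_wpM2l// ltW.
  have h3 : rho * (2 * k) = 2 * (k * rho) by ring.
  lra.
have PG v w : v *m P = v -> w *m P = w -> `|v - v0| <= rho -> `|w - v0| <= rho ->
    `|(G v - G w - (v - w)) *m P| <= 2^-1 * `|v - w|.
  move=> vP wP vr wr; have Dv := Domr v vP vr; have Dw := Domr w wP wr.
  have [h _] := Gdif v w Dv Dw.
  have -> : (G v - G w - (v - w)) *m P = (G v - G w - ((v + ps v) - (w + ps w))) *m P.
    rewrite mulmxBl [in RHS]mulmxBl; congr (_ - _).
    by rewrite !mulmxBl !mulmxDl !psP// !addr0.
  rewrite -(ler_pM2l ep0); apply: le_trans (HP _) _; apply: le_trans h _.
  rewrite mulrA ler_wpM2r//; lra.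
exists [set y | dom p y /\ `|coord X p a - coord X p y| < ep * (rho / 2)].
  have c : {for a, continuous (fun y => `|coord X p a - coord X p y|)}.
    by apply: cvg_norm; apply: cvgB; [exact: cvg_cst|exact: coord_cts].
  have c0 : `|coord X p a - coord X p a| < ep * (rho / 2).
    by rewrite subrr normr0 mulr_gt0// divr_gt0.
  apply: filterI (dom_nbhs pa) _.
  exact: cvg_near c (open_nbhs_nbhs (conj (@open_lt _ (ep * (rho / 2))) c0)).
move=> y [py ya].
have hy : `|(G v0 - coord X p y) *m P| <= rho / 2.
  by rewrite -(ler_pM2l ep0); apply: le_trans (HP _) _; rewrite Ga ltW.
have [v [vP vr v_0]] := transverse_fixpoint (ltW rho0) PP Dv0.1 PG hy.
have Dv := Domr v vP vr.
have [s sE vs] := E0 _ v_0.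
have dv := Domd v Dv; have [py' _ _ _] := Hcl _ _ _ _ dv dv (HE _ dv) (HE _ dv).
exists (E (v + ps v)), s; split => //; first exact: VEx.
apply: Hr1 => //; rewrite -Ga.
have [h1 h2] := Gdif v v0 Dv Dv0.
rewrite -(subrK ((v + ps v) - (v0 + ps v0)) (coord X p (E (v + ps v)) - G v0)).
apply: le_lt_trans (ler_normD _ _) _.
have h3 : 2 * e * `|v - v0| <= 2 * rho by rewrite ler_pM//; lra.
move: h1; rewrite /G; lra.
Qed.

Definition unstable_open_at (Vu : M -> set M) x := forall a, Vu (f x) a -> Lambda a ->
  \forall y \near a, (f @` Vu x) y -> Vu (f x) y.

Lemma rdist_ge0 x y : (0 <= rdist X x y)%E.
Proof.
apply: le_ereal_inf_tmp => _ [c _ <-]; rewrite path_lengthE.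
by apply: integral_ge0 => t _; rewrite lee_fin sqrtr_ge0.
Qed.

(** Induction on [k] with varying [x]: [finv] maps [Vu x] into [Vu (finv x)], where the contraction
    applies again. *)
Lemma unstable_contract alpha tau L lambda Vs Vu : 0 <= lambda <= 1 ->
  local_manifolds X f finv Lambda Es Eu alpha tau L lambda Vs Vu ->
  forall x, Lambda x -> forall y z k, Vu x y -> Vu x z ->
  (rdist X (iter k finv y) (iter k finv z) <= rdist X y z)%E.
Proof.
move=> /andP[l0 l1] Hloc x Lx y z k; elim: k x y z Lx => // k ih x y z Lx Vy Vz.
have Lx' := hyp_finvL H Lx.
have [_ _ _ _ Hc] := Hloc x Lx; have [_ _ Vsub _ _] := Hloc _ Lx'.
rewrite (hyp_finvK H) in Vsub.
have [y' Vy' yy'] := Vsub _ Vy; have [z' Vz' zz'] := Vsub _ Vz.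
rewrite !iterSr; apply: le_trans (ih (finv x) _ _ Lx' _ _) _.
- by rewrite -yy' (hyp_fK H).
- by rewrite -zz' (hyp_fK H).
- apply: le_trans (Hc y z Vy Vz) _.
  by rewrite -[leRHS]mul1e lee_wpmul2r ?rdist_ge0// lee_fin.
Qed.

(* Let [y] in [f @` Vu x] be close to [a] and outside [Vu (f x)], and let [y'] be
   the point of [Vu (f x)] over [y] along the stable space of [f x].  As [y] tends
   to [a], the limit of the directions from [y] to [y'] is in [Es (f x)]; it is
   also in [Eu a], because [finv] brings [y] and [y'] together: this contradicts
   transversality. *)
Lemma unstable_open_near p alpha L : Lambda p -> 0 < alpha ->
  exists2 tau0 : R, 0 < tau0 & exists2 N, nbhs p N & forall tau lambda Vs Vu,
  0 < tau <= tau0 -> 0 <= lambda <= 1 ->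
  local_manifolds X f finv Lambda Es Eu alpha tau L lambda Vs Vu ->
  forall x, Lambda x -> N (f x) -> unstable_open_at Vu x.
Proof.
move=> Lp al0; have pp := rchart_self X p.
have [e e0 [Nt pNt Ht]] := transversality H Lp.
have [tau0 tau00 [N pN HN]] := graph_transverse L Lp al0 pNt.
exists tau0 => //; exists (N `&` Nt); first exact: filterI.
move=> tau lambda Vs Vu taut l01 Hloc x Lx [Nq Ntq] a Va La.
have Lq := hyp_fL H Lx; have qq := rchart_self X (f x).
have [[_ gr] _ _ _ _] := Hloc _ Lq.
have [pq HV HO] := HN (f x) tau _ Lq Nq taut gr.
have [pa Nta] := HV a Va.
have [_ _ Vsub _ _] := Hloc _ Lx.
have [b Vb ab] := Vsub a Va; rewrite -{}ab in pa Nta La Va *.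
have Lb : Lambda b by rewrite -(hyp_fK H b); exact: (hyp_finvL H La).
have ff := rchart_self X (f b); have bb := rchart_self X b.
apply: contrapT => Hn.
(* The preimages of [y'] and [y], both in [Vu x]: contraction by [finv] is available there, whereas
   [y] itself is outside [Vu (f x)]. *)
pose B O : set (M * M) := [set t |
  [/\ Vu x t.1 /\ Vu x t.2, O (f t.1) /\ O (f t.2), t.1 <> t.2 &
   exists2 s : 'rV[R]_n, (s <= Es (f x))%MS &
     coord X p (f t.1) - coord X p (f t.2) = s *m trans X (f x) p (f x)]].
pose F := filter_from (nbhs (f b)) B.
have FF : ProperFilter F.
  apply: filter_from_proper.
    apply: filter_from_filter; first by exists setT; exact: filterT.
    move=> O O' aO aO'; exists (O `&` O'); first exact: filterI.
    by move=> t [? [[? ?] [? ?]] ? ?].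
  move=> O aO; apply: contrapT => BO; apply: Hn.
  have [ O' aO' HO'] := HO _ _ Va aO.
  apply: filterS (filterI aO aO') => y [Oy O'y] [z Vz zy]; rewrite -{}zy in Oy O'y *.
  have [y' [s [Vy' Oy' _ sE ys]]] := HO' _ O'y.
  have [z' Vz' zy'] := Vsub _ Vy'; rewrite -{}zy' in Vy' Oy' ys.
  apply: contrapT => nV; apply: BO; exists (z', z); split => //=.
    by move=> zz; rewrite zz in Vy'.
  by exists s.
have [G [GU FG]] := ultraFilterLemma FF.
have GP : ProperFilter G by exact: ultra_proper.
have GB O : nbhs (f b) O -> G (B O) by move=> aO; apply: FG; exists O.
have y1 : f t.1 @[t --> G] --> f b.
  by move=> O aO; apply: (@filterS _ G _ _ _ _ (GB O aO)) => t [_ []].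
have y2 : f t.2 @[t --> G] --> f b.
  by move=> O aO; apply: (@filterS _ G _ _ _ _ (GB O aO)) => t [_ []].
have z1 : t.1 @[t --> G] --> b.
  have h : finv (f t.1) @[t --> G] --> finv (f b).
    exact: (cvg_comp _ _ y1 (@hyp_finv_cts _ _ _ _ _ _ _ _ _ _ H (f b))).
  rewrite (hyp_fK H) in h.
  by rewrite (_ : (fun t => t.1) = (fun t => finv (f t.1)))//; apply/funext => t; rewrite (hyp_fK H).
have z2 : t.2 @[t --> G] --> b.
  have h : finv (f t.2) @[t --> G] --> finv (f b).
    exact: (cvg_comp _ _ y2 (@hyp_finv_cts _ _ _ _ _ _ _ _ _ _ H (f b))).
  rewrite (hyp_fK H) in h.
  by rewrite (_ : (fun t => t.2) = (fun t => finv (f t.2)))//; apply/funext => t; rewrite (hyp_fK H).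
have GT : G (B setT) by apply: GB; exact: filterT.
have ne : \forall t \near G, coord X b t.1 - coord X b t.2 != 0.
  apply: filterS (filterI (filterI (cvg_near z1 (dom_nbhs bb)) (cvg_near z2 (dom_nbhs bb))) GT).
  move=> t [[b1 b2] [_ _ nt _]]; rewrite subr_eq0; apply/eqP => E; apply: nt.
  exact: coord_inj b1 b2 E.
have [w w1 hw] := normalized_cvg GU ne.
have wu : (w <= Eu b)%MS.
  apply: (@bounded_Es _ _ _ _ _ _ _ _ _ _ (hyperbolic_inv H) b w (4 * 1 * gnorm X b w) Lb) => k.
  apply: (secant_growth (hyp_finv_cts H) (hyp_finv_secant H) z1 z2 hw) => //.
  apply: (@filterS _ G _ _ _ _ GT) => t [[V1 V2] _ _ _].
  rewrite mul1e; exact: unstable_contract l01 Hloc x Lx _ _ k V1 V2.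
have FG' : Filter G by exact: filter_filter.
have hw1 := @secant_lim _ _ _ X _ G FG' b (f b) f b _ _ _ _ _ (hyp_f_secant H b) z1 z2 hw.
have hw2 := @secant_lim _ _ _ X _ G FG' (f b) p id (f b) _ (fun t => f t.1) (fun t => f t.2) _ _ (secant_trans ff pa) y1 y2 hw1.
pose u := w *m tmx X f b.
have uu : (u <= Eu (f b))%MS by exact: (hyp_f_Eu H Lb wu).
pose s0 := u *m trans X (f b) p (f b) *m trans X p (f x) (f x).
have s0E : (s0 <= Es (f x))%MS.
  (* Membership in a row space is the vanishing of the product with [cokermx], a closed
     condition. *)
  rewrite submxE; apply/eqP.
  have h1 : (`|coord X b t.1 - coord X b t.2|^-1 *:
      (coord X p (f t.1) - coord X p (f t.2))) *m trans X p (f x) (f x) *m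
      cokermx (Es (f x)) @[t --> G] --> s0 *m cokermx (Es (f x)).
    by apply: cvg_mulmx (cvg_cst _); apply: cvg_mulmx hw2 (cvg_cst _).
  have h2 : (fun=> 0) t @[t --> G] --> s0 *m cokermx (Es (f x)).
    apply: cvg_trans h1; apply: near_eq_cvg.
    apply: (@filterS _ G _ _ _ _ GT) => t [_ _ _ [s sE E]]; rewrite E.
    apply/eqP; rewrite -submxE -!scalemxAl; apply: scalemx_sub.
    by rewrite (mul_transK _ qq pq).
  exact: (cvg_unique _ h2 (cvg_cst _)).
have s0K : s0 *m trans X (f x) p (f x) = u *m trans X (f b) p (f b) by exact: mul_transK.
have E0 : u *m trans X (f b) p (f b) = 0.
  apply: (Ht (f x) (f b) u s0 Lq Ntq La Nta uu s0E).
  clearbody s0; move: (s0 *m _) (u *m _) s0K => ? v ->.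
  by rewrite subrr normr0 mulr_ge0// ltW.
have u0 : u = 0.
  have uK := mul_transK u ff pa.
  apply: etrans (esym uK) _; apply: etrans (f_equal (fun v => v *m _) E0) _.
  exact: mul0mx.
have w0 : w = 0.
  have cb : {for b, continuous f} by exact: (hyp_f_cts H).
  have TK := tmxK (hyp_fK H) cb (hyp_f_secant H) (hyp_finv_secant H).
  apply: etrans (esym (mulmx1 w)) _; rewrite -TK; apply: etrans (mulmxA _ _ _) _.
  by apply: etrans (f_equal (fun v => v *m _) u0) _; exact: mul0mx.
by move: w1; rewrite w0 normr0 => /eqP; rewrite eq_sym oner_eq0.
Qed.

Lemma unstable_open alpha L : 0 < alpha ->
  exists2 tau0 : R, 0 < tau0 & forall tau lambda Vs Vu,
  0 < tau < tau0 -> 0 <= lambda <= 1 ->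
  local_manifolds X f finv Lambda Es Eu alpha tau L lambda Vs Vu ->
  forall x, Lambda x -> unstable_open_at Vu x.
Proof.
move=> al0.
pose P (t : R) q := forall tau lambda Vs Vu,
  0 < tau <= t -> 0 <= lambda <= 1 ->
  local_manifolds X f finv Lambda Es Eu alpha tau L lambda Vs Vu ->
  forall x, Lambda x -> f x = q -> unstable_open_at Vu x.
have /(compact_near_coveringP _).1 cov := hyp_compact H.
have : \forall t \near (0 : R)^'+, Lambda `<=` P t.
  apply: cov => p Lp; have [t0 t00 [N pN HN]] := unstable_open_near L Lp al0.
  exists (N, [set t | t <= t0]); first by split => //=; exact: nbhs_right_le.
  move=> [q t] /= [Nq tt] tau lambda Vs Vu /andP[tau0 taut] l01 Hl x Lx xq.
  apply: (HN tau lambda Vs Vu _ l01 Hl x Lx); last by rewrite xq.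
  by rewrite tau0 (le_trans taut).
move=> cov'; have [t [t0 Ht]] : exists t : R, 0 < t /\ Lambda `<=` P t.
  near (0 : R)^'+ => t; exists t; split; first by near: t; exact: nbhs_right_gt.
  by near: t.
exists t => // tau lambda Vs Vu /andP[tau0 taut] l01 Hl x Lx.
apply: (Ht (f x) (hyp_fL H Lx) tau lambda Vs Vu _ l01 Hl x Lx erefl).
by rewrite tau0 ltW.
Unshelve. all: by end_near. Qed.

End Projection.

End UnstableGraphs.

(** * Measurability of Borel sets *)

(* Caratheodory's criterion along the level sets of [g]: below the level [c] the
   layers with even indices, like those with odd indices, are separated, so that
   the outer measures of the layers are summable when [mu E] is finite. *)
Lemma level_caratheodory (R : realType) (T : Type)
    (mu : {outer_measure set T -> \bar R}) (g : T -> R) (c : R) :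
  (forall (a b : R) (A B : set T), a < b -> b <= c -> (forall x, A x -> g x <= a) ->
     (forall x, B x -> b <= g x) -> (mu A + mu B <= mu (A `|` B))%E) ->
  caratheodory_measurable mu [set x | g x < c].
Proof.
move=> Hsep; apply: le_caratheodory_measurable => E.
have [->|Eoo] := eqVneq (mu E) +oo%E; first by rewrite leey.
have mu0 A : (0 <= mu A)%E by exact: outer_measure_ge0.
have Efin : mu E \is a fin_num by rewrite ge0_fin_numE// ltey.
pose l j : R := c - j.+1%:R^-1.
have lS i j : (i < j)%N -> l i < l j.
  by move=> ij; rewrite /l ltrD2l ltrN2 ltf_pV2 ?posrE// ltr_nat ltnS.
have lc j : l j <= c by rewrite /l gerBl invr_ge0.
have lc' j : l j < c by rewrite /l ltrBlDr ltrDl invr_gt0.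
pose A j := E `&` [set x | g x <= l j].
pose D j := E `&` [set x | l j < g x <= l j.+1].
pose f j := mu (D j.+1).
(* Layers of the same parity, counted from [b = 0] or [b = 1], are separated by the layer in
   between, so their outer measures add up. *)
have half b k : (\sum_(i < k) f (b + i.*2)%N <= mu (A (b + k.*2)%N))%E.
  elim: k => [|k ih]; first by rewrite big_ord0.
  rewrite big_ord_recr /=; apply: (@le_trans _ _ (mu (A (b + k.*2)%N) + f (b + k.*2)%N)).
    exact: leeD2r.
  apply: le_trans (Hsep (l (b + k.*2)%N) (l (b + k.*2).+1) _ _ _ (lc _) _ _) _.
  - exact: lS.
  - by move=> x [].
  - by move=> x [_ /andP[/ltW]].
  - apply: le_outer_measure => x [[Ex gx]|[Ex /andP[_ gx]]]; split => //=.
      apply: le_trans gx _; apply/ltW/lS; rewrite doubleS !addnS; exact: leqW.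
    by rewrite doubleS !addnS.
have sum2 k : (\sum_(j < k.*2) f j <= mu E + mu E)%E.
  have -> : (\sum_(j < k.*2) f j =
      \sum_(i < k) f (0 + i.*2)%N + \sum_(i < k) f (1 + i.*2)%N)%E.
    elim: k => [|k ih]; first by rewrite !big_ord0 adde0.
    by rewrite doubleS !big_ord_recr/= ih addeACA -!addeA.
  apply: leeD; apply: le_trans (half _ k) _; apply: le_outer_measure => x; exact: proj1.
have f0 k : (0 <= f k)%E by exact: mu0.
have foo : (\sum_(j <oo) f j < +oo)%E.
  apply: (@le_lt_trans _ _ (mu E + mu E)%E); last by rewrite lte_add_pinfty// ltey_eq Efin.
  apply: lime_le; first exact: is_cvg_nneseries.
  apply: nearW => k; apply: le_trans (sum2 k); rewrite big_mkord.
  rewrite -!(big_mkord xpredT f) (@big_cat_nat _ _ _ k 0 k.*2)//=; last first.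
    by rewrite -addnn leq_addr.
  by rewrite leeDl// sume_ge0.
(* What lies between the level [l N.+1] and [c] costs only the tail of a convergent series; what
   lies below is separated from the complement. *)
have bound N : (mu (E `&` [set x | (g x < c)%R]) + mu (E `&` ~` [set x | (g x < c)%R])
    <= mu E + \sum_(N <= j <oo) f j)%E.
  have h1 : (mu (E `&` [set x | (g x < c)%R]) <= mu (A N.+1) + \sum_(N <= j <oo) f j)%E.
    apply: (@le_trans _ _ (mu (A N.+1 `|` \bigcup_(j in ~` `I_N) D j.+1))).
      apply: le_outer_measure => x [Ex /= gx].
      have [|nA] := pselect (g x <= l N.+1); first by left.
      have ex : exists m, g x <= l m.
        have cg : 0 < c - g x by rewrite subr_gt0.
        exists (Num.trunc (c - g x)^-1); rewrite /l lerBrDr -lerBrDl.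
        rewrite invf_ple ?posrE//; apply: ltW; exact: truncnS_gt.
      right; have [m gm mmin] := ex_minnP ex.
      have Nm : (N.+1 < m)%N.
        rewrite ltnNge; apply/negP; rewrite leq_eqVlt => /predU1P[mN|mN].
          by apply: nA; rewrite -mN.
        by apply: nA; apply: le_trans gm (ltW (lS _ _ mN)).
      case: m gm mmin Nm => [|[|m]]// gm mmin Nm.
      exists m; first by apply/negP; rewrite -leqNgt.
      split => //=; rewrite gm andbT ltNge; apply/negP => gm'.
      by have := mmin _ gm'; rewrite ltnn.
    apply: le_trans (outer_measureU2 _ _ _) _; apply: leeD2l.
    exact: outer_measure_sigma_subadditive_tail.
  apply: le_trans (leeD2r _ h1) _; rewrite addeAC leeD2r//.
  apply: le_trans (Hsep (l N.+1) c _ _ (lc' _) (lexx _) _ _) _.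
  - by move=> x [].
  - by move=> x [_ /= /negP]; rewrite -leNgt.
  - by apply: le_outer_measure => x [[]|[]].
have cv : (mu E + \sum_(N <= j <oo) f j @[N --> \oo] --> mu E + 0)%E.
  apply: cvgeD; last 2 first.
  - exact: cvg_cst.
  - exact: (nneseries_tail_cvg foo).
  - by rewrite fin_num_adde_defr.
rewrite -[leRHS]adde0 -(cvg_lim _ cv)//; apply: lime_ge; first by apply/cvg_ex; eexists; exact: cv.
exact: nearW.
Qed.

(** Lindeloef's property. The members are indexed by the codes of basic open sets contained in them;
    codes that serve no point get [set0]. *)
Lemma countable_subcover (T : topologicalType) (D : set T) (O : T -> set T) :
  @second_countable T -> (forall a, D a -> nbhs a (O a)) ->
  exists V : nat -> set T, (forall i, V i = set0 \/ exists2 a, D a & V i = O a) /\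
    D `<=` \bigcup_i V i.
Proof.
move=> [B /countable_injP[e einj] [_ BT]] DO.
pose P i a := D a /\ exists U, [/\ B U, e U = i & U `<=` O a].
pose V i := match pselect (exists a, P i a) with
  | left h => O (projT1 (cid h)) | right _ => set0 end.
have VP i : (exists a, P i a) -> exists2 a, P i a & V i = O a.
  move=> h; rewrite /V; case: pselect => // h'.
  by exists (projT1 (cid h')) => //; exact: projT2 (cid h').
exists V; split.
  move=> i; have [h|h] := pselect (exists a, P i a).
    by right; have [a [Da _] ?] := VP i h; exists a.
  by left; rewrite /V; case: pselect.
move=> a Da; have [U [BU Ua] UO] := BT a _ (DO a Da).
have [|b [Db [U' [BU' eU' U'O]]] VO] := VP (e U); first by exists a; split => //; exists U.
exists (e U) => //; rewrite VO; apply: U'O.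
by rewrite (einj U' U) ?inE.
Qed.

Lemma borel_caratheodory (R : realType) (T : topologicalType)
    (mu : {outer_measure set T -> \bar R}) :
  (forall U, open U -> caratheodory_measurable mu U) ->
  forall A, borel A -> caratheodory_measurable mu A.
Proof.
move=> Ho A; apply: smallest_sub => //; split.
- exact: caratheodory_measurable_set0.
- by move=> B mB; rewrite setTD; exact: caratheodory_measurable_setC.
- exact: caratheodory_measurable_bigcup.
Qed.

Section BorelSets.
Context {T : topologicalType}.

Lemma borel_open (U : set T) : open U -> borel U.
Proof. exact: sub_sigma_algebra. Qed.

Lemma borel_setI (A B : set T) : borel A -> borel B -> borel (A `&` B).
Proof.
move=> bA bB; have [b0 bC bU] := @smallest_sigma_algebra _ setT (@open T).
rewrite -(setCK (A `&` B)) setCI -setTD; apply: (bC).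
rewrite -bigcup2E; apply: (bU) => -[|[|i]] /=; last exact: b0.
  by rewrite -setTD; exact: bC.
by rewrite -setTD; exact: bC.
Qed.

Lemma borel_setD (A B : set T) : borel A -> borel B -> borel (A `\` B).
Proof.
move=> bA bB; rewrite setDE; apply: borel_setI => //.
have [_ bC _] := @smallest_sigma_algebra _ setT (@open T).
by rewrite -setTD; exact: bC.
Qed.

Lemma borel_preimage (h : T -> T) (A : set T) : continuous h -> borel A ->
  borel (h @^-1` A).
Proof.
move=> ch; move: A; apply: smallest_sub; last first.
  by move=> U oU; apply: borel_open; apply: open_comp oU => x _; exact: ch.
have [b0 bC bU] := @smallest_sigma_algebra _ setT (@open T).
split.
- by rewrite preimage_set0.
- by move=> B bB; rewrite /= setTD preimage_setC -setTD; exact: bC.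
- by move=> B bB; rewrite /= preimage_bigcup; exact: bU.
Qed.

End BorelSets.

(** * Covers by Bowen balls: separation and transfer *)

Section ReferenceOuterMeasure.
Context {R : realType} {n : nat} {M : ptopologicalType} (X : riemannian R n M).
Context (f : M -> M) (Lambda : set M) (phi : M -> R) (r : R).
Implicit Types (W A B : set M) (x y z p a : M).

Local Notation dom p := (cdom (rchart X p)).
Local Notation ball k y := (bowen_ball X f k y r).
Local Notation outer W := (ref_outer X f Lambda phi r W).
Local Notation level W := (ubowen_inf X f Lambda phi r W).
Local Notation weight := (ubowen_weight X f Lambda phi).

Lemma ubowen_inf_le_outer W N A : (level W N (A `&` (W `&` Lambda)) <= outer W A)%E.
Proof. by rewrite ref_outerE; apply: ereal_sup_ubound; exists N. Qed.

(** No ball of large order meets both sets, so a fine cover of the union splits into the balls that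
    meet [A], which cover [A], and the others, which cover [B]. *)
Lemma ref_outer_separated W A B N :
  (forall k y z z', (N <= k)%N -> (W `&` Lambda) y -> (W `&` Lambda) z ->
     (W `&` Lambda) z' -> A z -> B z' -> ball k y z -> ~ ball k y z') ->
  (outer W A + outer W B <= outer W (A `|` B))%E.
Proof.
move=> Hsep.
have cvg_level Z : level W N' (Z `&` (W `&` Lambda)) @[N' --> \oo] --> outer W Z.
  rewrite ref_outerE; exact/ereal_nondecreasing_cvgn/nd_ubowen_inf.
have cAB : (level W N' (A `&` (W `&` Lambda)) + level W N' (B `&` (W `&` Lambda))
    @[N' --> \oo] --> outer W A + outer W B)%E.
  apply: cvgeD; [|exact: cvg_level|exact: cvg_level].
  by apply: ge0_adde_def; rewrite inE; exact: ref_outer_ge0.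
rewrite -(cvg_lim _ cAB)//; apply: lime_le; first by apply/cvg_ex; eexists; exact: cAB.
near=> N'; apply: le_trans (ubowen_inf_le_outer W N' _).
apply: le_ereal_inf_tmp => _ [C [cC CN CZ] <-].
pose P := [set p : M * nat | exists z, [/\ (W `&` Lambda) z, A z & ball p.2 p.1 z]].
rewrite (esumID P); last by move=> p _; exact: ubowen_weight_ge0.
apply: leeD; apply: ereal_inf_lbound; eexists; try reflexivity.
  split.
  - by apply: sub_countable cC; apply: subset_card_le => p [].
  - by move=> p [/CN].
  - move=> z [Az Wz]; have [|p Cp pz] := CZ z; first by split => //; left.
    by exists p => //; split => //; exists z; split => //; case: pz.
split.
- by apply: sub_countable cC; apply: subset_card_le => p [].
- by move=> p [/CN].
- move=> z' [Bz' Wz']; have [|p Cp pz'] := CZ z'; first by split => //; right.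
  exists p => //; split => // -[z [Wz Az pz]].
  have [Wp Np] := CN p Cp; have [pz'' _] := pz'.
  apply: (Hsep p.2 p.1 z z') pz pz'' => //; apply: leq_trans Np.
  by near: N'; exact: nbhs_infty_ge.
Unshelve. all: by end_near. Qed.

(** [h] moves the balls of a cover and [g] the points in them; only balls that meet [A1] are moved.
    Injectivity of [h] turns the sum of weights over the new cover into a sum over the old one. It
    is asked at positive orders only, because [h] may lower the order by one. *)
Lemma ref_outer_transfer W1 W2 A1 A2 (c : R) (h : M * nat -> M * nat) (g : M -> M) :
  0 < c ->
  {in [set p : M * nat | (0 < p.2)%N] &, injective h} ->
  (forall N, exists N', forall k y, (N' <= k)%N -> (W1 `&` Lambda) y ->
     (exists z, [/\ A1 z, (W1 `&` Lambda) z & ball k y z]) ->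
     [/\ (W2 `&` Lambda) (h (y, k)).1, (N <= (h (y, k)).2)%N,
       (weight (h (y, k)) <= c%:E * weight (y, k))%E &
       forall z, A1 z -> (W1 `&` Lambda) z -> ball k y z ->
         ball (h (y, k)).2 (h (y, k)).1 (g z)]) ->
  (forall z', A2 z' -> (W2 `&` Lambda) z' -> exists z, [/\ A1 z, (W1 `&` Lambda) z & g z = z']) ->
  (outer W2 A2 <= c%:E * outer W1 A1)%E.
Proof.
move=> c0 hinj Hh Hg; rewrite ref_outerE; apply: ge_ereal_sup => _ [N _ <-].
have [N' HN'] := Hh N.
(* Orders are taken at least 1, where [h] is injective. *)
apply: (@le_trans _ _ (c%:E * level W1 (maxn N' 1) (A1 `&` (W1 `&` Lambda)))%E); last first.
  by rewrite lee_wpmul2l ?lee_fin ?(ltW c0)// ubowen_inf_le_outer.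
rewrite -lee_pdivrMl//; apply: le_ereal_inf_tmp => _ [C [cC CN CZ] <-].
rewrite lee_pdivrMl//.
pose P := C `&` [set p : M * nat | exists z, [/\ A1 z, (W1 `&` Lambda) z & ball p.2 p.1 z]].
have HP (p : M * nat) : P p -> [/\ (W2 `&` Lambda) (h p).1, (N <= (h p).2)%N,
    (weight (h p) <= c%:E * weight p)%E & forall z, A1 z -> (W1 `&` Lambda) z ->
      ball p.2 p.1 z -> ball (h p).2 (h p).1 (g z)].
  case: p => y k [Cp Bp]; have [Wp] := CN _ Cp; rewrite geq_max => /andP[Nk _].
  exact: HN'.
apply: (@le_trans _ _ (\esum_(p in h @` P) weight p)).
  apply: ereal_inf_lbound; exists (h @` P) => //; split.
  - by apply: sub_countable (card_image_le h P) _; apply: sub_countable cC; apply: subset_card_le => ? [].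
  - by move=> _ [p Pp <-]; have [] := HP p Pp.
  - move=> z' [Az' Wz']; have [z [Az Wz gz]] := Hg z' Az' Wz'.
    have [|p Cp [pz Wp]] := CZ z; first by [].
    have Pp : P p by split => //; exists z.
    exists (h p); first by exists p.
    by split; [rewrite -gz; have [_ _ _] := HP p Pp; apply|case: Wz'].
rewrite (esum_image P h); last first.
  move=> p q /set_mem[Cp _] /set_mem[Cq _]; apply: hinj.
    by apply/mem_set; have [_] := CN _ Cp; rewrite geq_max => /andP[].
  by apply/mem_set; have [_] := CN _ Cq; rewrite geq_max => /andP[].
apply: ge_ereal_sup => _ [F [Ff FP] <-].
have w0 := ubowen_weight_ge0 X f Lambda phi.
apply: (@le_trans _ _ (\sum_(p \in F) (c%:E * weight p))%E).
  by apply: lee_fsum => // p /FP/HP[].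
rewrite -ge0_mule_fsumr//; apply: lee_wpmul2l; first by rewrite lee_fin ltW.
by apply: esum_ge; exists F => //; split => // p /FP[].
Qed.

Section Shrinking.
Variable W : set M.
Hypothesis shrink : forall e : R, 0 < e -> exists N, forall k y z, (N <= k)%N ->
  (W `&` Lambda) y -> (W `&` Lambda) z -> ball k y z ->
  (rdist X y z < e%:E)%E /\ (rdist X z y < e%:E)%E.

(** The centre of a ball may lie outside the set that the ball helps to cover; at large orders it is
    close to this set, so that local hypotheses apply to it too. *)
Lemma shrink_nbhs a (O : set M) : nbhs a O -> exists2 O', nbhs a O' & exists N,
  forall k y z, (N <= k)%N -> (W `&` Lambda) y -> (W `&` Lambda) z -> ball k y z ->
  O' z -> O y.
Proof.
move=> aO; have [s0 s00 gs0] := good_radius_ex X a.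
have [s1 s10 s1O] := qball_basis X aO.
pose s := Num.min s0 s1 / 4.
have s_gt0 : 0 < s by rewrite divr_gt0// lt_min s00.
have s4 : 4 * s = Num.min s0 s1 by rewrite /s; field.
have gs : good_radius X a (4 * s).
  by apply: good_radiusW gs0; rewrite s4 ge_min lexx.
exists (qball X a s); first exact: qball_nbhs.
have [N HN] := shrink s_gt0; exists N => k y z Nk Wy Wz yz az.
have [_ zy] := HN k y z Nk Wy Wz yz.
apply: s1O; apply: (@qballW _ _ _ X a (4 * s)); first by rewrite s4 ge_min lexx orbT.
apply: contrapT => nay; have := rdist_exit gs az nay; rewrite leNgt => /negP; apply.
apply: lt_le_trans zy _; rewrite lee_fin; lra.
Qed.

Lemma qball_caratheodory p : exists2 s0 : R, 0 < s0 & forall s, 0 < s <= s0 ->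
  caratheodory_measurable (ref_outer_measure X f Lambda phi r W) (qball X p s).
Proof.
have [s1 s10 gs1] := good_radius_ex X p.
exists (s1 / 64); first by rewrite divr_gt0.
move=> s /andP[s0 ss].
have g64 : good_radius X p (4 * (16 * s)) by apply: good_radiusW gs1; lra.
have g16 : good_radius X p (4 * (4 * s)) by apply: good_radiusW gs1; lra.
have g4 : good_radius X p (4 * s) by apply: good_radiusW gs1; lra.
(* Outside the ball the level is set to [s], so that the sublevel set is exactly the ball. *)
pose g y := match pselect (qball X p s y) with
  | left _ => pnorm X p (coord X p y - coord X p p) | right _ => s end.
have gE y : qball X p s y -> g y = pnorm X p (coord X p y - coord X p p).
  by rewrite /g; case: pselect.
have -> : qball X p s = [set y | g y < s].
  apply/seteqP; split=> y; first by move=> qy /=; rewrite gE//; case: qy.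
  by rewrite /= /g; case: pselect => //; rewrite ltxx.
apply: level_caratheodory => a b A B ab bs HA HB.
(* From [z] to [z'] through the centre [y] there are two distances below [e], each doubled in
   coordinates: less than [4 * e <= b - a] in all. *)
pose e := Num.min s ((b - a) / 4).
have e0 : 0 < e by rewrite lt_min s0 divr_gt0// subr_gt0.
have es : e <= s by rewrite ge_min lexx.
have eb : e <= (b - a) / 4 by rewrite ge_min lexx orbT.
clearbody e.
have [N HN] := shrink e0.
apply: (@ref_outer_separated W A B N) => k y z z' Nk Wy Wz Wz' Az Bz' yz yz'.
have [_ zy] := HN k y z Nk Wy Wz yz; have [yz1 _] := HN k y z' Nk Wy Wz' yz'.
have gz := HA z Az; have gz' := HB z' Bz'.
have qz : qball X p s z.
  apply: contrapT => nq; move: gz; rewrite /g; case: pselect => // _; lra.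
rewrite (gE z qz) in gz.
have q4y : qball X p (4 * s) y.
  apply: contrapT => ny; have := rdist_exit g4 qz ny; rewrite leNgt => /negP; apply.
  apply: lt_le_trans zy _; rewrite lee_fin; lra.
have q16z' : qball X p (16 * s) z'.
  apply: contrapT => ny; have := rdist_exit g16 q4y (z := z').
  rewrite (_ : 4 * (4 * s) = 16 * s); last by ring.
  move=> /(_ ny); rewrite leNgt => /negP; apply.
  apply: lt_le_trans yz1 _; rewrite lee_fin; lra.
have q16y : qball X p (16 * s) y by apply: qballW q4y; lra.
have q16z : qball X p (16 * s) z by apply: qballW qz; lra.
have d1 := le_lt_trans (rdist_lower g64 q16z q16y) zy.
have d2 := le_lt_trans (rdist_lower g64 q16y q16z') yz1.
rewrite lte_fin in d1; rewrite lte_fin in d2.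
have t1 := pnorm_tri X p (coord X p z') (coord X p y) (coord X p z).
have t2 := pnorm_tri X p (coord X p z') (coord X p z) (coord X p p).
rewrite (pnormC X p (coord X p z') (coord X p y)) (pnormC X p (coord X p y) (coord X p z)) in t1.
have lb : pnorm X p (coord X p z' - coord X p p) < b by lra.
have qz' : qball X p s z' by split; [case: q16z'|lra].
by move: gz'; rewrite gE//; lra.
Qed.

Lemma open_caratheodory U : open U ->
  caratheodory_measurable (ref_outer_measure X f Lambda phi r W) U.
Proof.
move=> oU.
have sP a : U a -> exists s : R, [/\ 0 < s, qball X a s `<=` U &
    caratheodory_measurable (ref_outer_measure X f Lambda phi r W) (qball X a s)].
  move=> Ua; have [s1 s10 s1U] := qball_basis X (open_nbhs_nbhs (conj oU Ua)).
  have [s2 s20 Hs] := qball_caratheodory a.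
  exists (Num.min s1 s2); split; first by rewrite lt_min s10.
    by apply: subset_trans s1U; apply: qballW; rewrite ge_min lexx.
  by apply: Hs; rewrite lt_min s10 s20 /= ge_min lexx orbT.
pose O a := match pselect (U a) with
  | left h => qball X a (projT1 (cid (sP a h))) | right _ => set0 end.
have OP a : U a -> [/\ nbhs a (O a), O a `<=` U &
    caratheodory_measurable (ref_outer_measure X f Lambda phi r W) (O a)].
  move=> Ua; rewrite /O; case: pselect => // h.
  by case: (cid _) => s /= [s0 sU sm]; split => //; exact: qball_nbhs.
have [V [VO UV]] := countable_subcover (rsecond_countable X) (fun a Ua => let: And3 h _ _ := OP a Ua in h).
have -> : U = \bigcup_i V i.
  apply/seteqP; split => // y [i _]; have [->//|[a Ua ->]] := VO i.
  by have [_ + _] := OP a Ua; apply.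
apply: caratheodory_measurable_bigcup => i.
have [->|[a Ua ->]] := VO i; first exact: caratheodory_measurable_set0.
by have [] := OP a Ua.
Qed.

End Shrinking.

End ReferenceOuterMeasure.

(** * Comparison of the reference measures *)

Lemma measurable_expR_sub (d : measure_display) (T : measurableType d) (R : realType)
    (D : set T) (g : T -> R) (c : R) :
  measurable_fun D g -> measurable_fun D (fun y => (expR (c - g y))%:E).
Proof.
move=> mg; apply/measurable_EFinP; apply: measurableT_comp; first exact: measurable_expR.
by apply: measurable_funB; [exact: measurable_cst|].
Qed.

Section LocalComparison.
Context {R : realType} {n : nat} {M : ptopologicalType} (X : riemannian R n M).
Context {f finv : M -> M} {Lambda : set M} {Es Eu : M -> 'M[R]_n} {chi : R}.
Context (phi : M -> R) (r : R) (Vu : M -> set M).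
Implicit Types (A B O : set M) (x y z a : M).
Hypothesis H : hyperbolic X f finv Lambda Es Eu chi.
Hypothesis phiH : holder_on X Lambda phi.
Hypothesis r0 : 0 < r.
Hypothesis Vu_sub : forall x, Lambda x -> Vu (f x) `<=` f @` Vu x.
Hypothesis Vu_contract : forall x, Lambda x -> forall y z k, Vu x y -> Vu x z ->
  (rdist X (iter k finv y) (iter k finv z) <= rdist X y z)%E.
Hypothesis Vu_open : forall x, Lambda x -> unstable_open_at (f := f) (Lambda := Lambda) Vu x.
Hypothesis Vu_shrink : forall x, Lambda x -> forall e : R, 0 < e -> exists N, forall k y z,
  (N <= k)%N -> (Vu x `&` Lambda) y -> (Vu x `&` Lambda) z -> bowen_ball X f k y r z ->
  (rdist X y z < e%:E)%E /\ (rdist X z y < e%:E)%E.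

Local Notation P := (fine (pressure X f Lambda phi)).
Local Notation outer W := (ref_outer X f Lambda phi r W).
Local Notation weight := (ubowen_weight X f Lambda phi).
Local Notation ball k y := (bowen_ball X f k y r).

Lemma bowen_ballP k y z : ball k y z <->
  forall i, (i < k)%N -> (rdist X (iter i f y) (iter i f z) < r%:E)%E.
Proof.
split=> [/bigmax_ltP[_ h] i ik|h].
  exact: (h (Ordinal ik) isT).
by apply/bigmax_ltP; split=> [|i _]; [rewrite lte_fin|exact: h].
Qed.

Lemma bowen_ball_pred k y z : ball k.+1 y z -> ball k (f y) (f z).
Proof.
move=> /bowen_ballP h; apply/bowen_ballP => i ik.
by rewrite -!iterSr; exact: h.
Qed.

Lemma ubowen_weight_succ k y :
  weight (y, k.+1) = ((expR (phi y - P))%:E * weight (f y, k))%E.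
Proof.
rewrite /ubowen_weight /= -EFinM; congr (_%:E).
rewrite -!expRD; congr expR.
have -> : birkhoff_sum f phi k.+1 y = phi y + birkhoff_sum f phi k (f y).
  rewrite /birkhoff_sum big_ord_recl /=; congr (_ + _).
  by apply: eq_bigr => i _; rewrite -iterSr.
by rewrite -natr1; ring.
Qed.

Lemma phi_near a (e : R) : Lambda a -> 0 < e ->
  \forall y \near a, Lambda y -> `|phi y - phi a| <= e.
Proof.
move=> La e0; have [K [b [K0 b0 Hphi]]] := phiH.
have Ke : 0 <= K / e by rewrite divr_ge0// ltW.
have [t t0 Ht] := powR_small b0 Ke.
have near_d : \forall y \near a, (rdist X a y < t%:E)%E.
  by apply: (@rdist_cvg _ _ _ X _ _ _ a (fun=> a) id t t0); [exact: cvg_cst|exact: cvg_id].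
apply: filterS near_d => y dy Ly.
have := Hphi a y La Ly; have := rdist_ge0 X a y.
case: (rdist X a y) dy => [d| |]// dt d0 h.
rewrite poweR_EFin -EFinM lee_fin in h; rewrite distrC; apply: le_trans h _.
rewrite lee_fin in d0; rewrite lte_fin in dt.
have := Ht d; rewrite d0 (ltW dt) => /(_ isT).
by rewrite mulrAC ler_pdivrMr// mul1r.
Qed.

Lemma local_comparison x a (e : R) : Lambda x -> Vu (f x) (f a) -> Lambda a -> 0 < e ->
  exists2 O, nbhs a O & forall B, B `<=` O -> B `<=` f @^-1` (Vu (f x) `&` Lambda) ->
  [/\ forall y, B y -> `|phi y - phi a| <= e,
    (outer (Vu (f x)) (f @` B) <= (expR (P - phi a + e))%:E * outer (Vu x) B)%E &
    (outer (Vu x) B <= (expR (phi a - P + e))%:E * outer (Vu (f x)) (f @` B))%E].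
Proof.
move=> Lx Va La e0; have Lq := hyp_fL H Lx; have Lfa := hyp_fL H La.
have nphi := phi_near La e0.
have cfa : f y @[y --> a] --> f a by exact: (hyp_f_cts H).
have cfinva : finv y @[y --> f a] --> finv (f a) by exact: (hyp_finv_cts H).
have nopen : \forall y \near a, (f @` Vu x) (f y) -> Vu (f x) (f y).
  exact: (cvg_near cfa (Vu_open Lx Va Lfa)).
(* What the centres of the balls have to satisfy: the oscillation bound for the weights, and
   openness for their images to be admissible centres. Centres need not lie in [B]; [O2] and [O3]
   force them into [O1], or their preimages under [f]. *)
pose O1 : set M := [set y | (Lambda y -> `|phi y - phi a| <= e) /\
  ((f @` Vu x) (f y) -> Vu (f x) (f y))].
have aO1 : nbhs a O1 by exact: filterI nphi nopen.
have [ O2 aO2 [N2 HN2]] := shrink_nbhs (Vu_shrink Lx) aO1.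
have faO1 : nbhs (f a) (finv @^-1` O1).
  by apply: (cvg_near cfinva); rewrite (hyp_fK H).
have [ O3 aO3 [N3 HN3]] := shrink_nbhs (Vu_shrink Lq) faO1.
exists (O2 `&` (f @^-1` O3) `&` O1).
  apply: filterI aO1; apply: filterI aO2 _; exact: (cvg_near cfa aO3).
move=> B BO BV.
have LB y : B y -> Lambda y.
  by move=> /BV[_ Ly]; rewrite -(hyp_fK H y); exact: (hyp_finvL H Ly).
split.
- by move=> y By; have [_ [+ _]] := BO y By; apply; exact: LB.
- apply: (@ref_outer_transfer _ _ _ X f Lambda phi r (Vu x) (Vu (f x)) B (f @` B) _
    (fun p : M * nat => (f p.1, p.2.-1)) f (expR_gt0 _)).
  + move=> [y [|k]] [y' [|k']] /set_mem//= _ /set_mem//= _ [/(can_inj (hyp_fK H)) -> ->].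
    by [].
  + move=> N; exists (maxn N.+1 N2) => -[|k] y; first by rewrite geq_max.
    rewrite geq_max => /andP[Nk Nk2] [Wy Ly] [z [Bz Wz yz]].
    have [[ O2z _] _] := BO z Bz.
    have [phiy oy] := HN2 k.+1 y z Nk2 (conj Wy Ly) Wz yz O2z.
    split => //=.
    * by split; [apply: oy; exists y|exact: (hyp_fL H Ly)].
    * rewrite ubowen_weight_succ; have := ubowen_weight_ge0 X f Lambda phi (f y, k).
      move: (ubowen_weight _ _ _ _ _) => w w0; rewrite muleA -EFinM -expRD.
      rewrite -[leLHS]mul1e; apply: lee_wpmul2r => //.
      rewrite lee_fin -expR0 ler_expR.
      have := phiy Ly; rewrite ler_norml => /andP[? ?]; lra.
    * by move=> z' Bz' Wz'; exact: bowen_ball_pred.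
  + move=> _ [z Bz <-] _; exists z; split => //.
    have [Wfz Lfz] := BV z Bz; have [z' Wz' zz'] := Vu_sub Lx Wfz.
    by rewrite -((can_inj (hyp_fK H)) _ _ zz'); split => //; rewrite ((can_inj (hyp_fK H)) _ _ zz'); exact: LB.
- apply: (@ref_outer_transfer _ _ _ X f Lambda phi r (Vu (f x)) (Vu x) (f @` B) B _
    (fun p : M * nat => (finv p.1, p.2.+1)) finv (expR_gt0 _)).
  + by move=> [y k] [y' k'] _ _ [/(can_inj (hyp_finvK H)) -> ->].
  + move=> N; exists (maxn N.+1 N3) => k w; rewrite geq_max => /andP[Nk Nk3] [Ww Lw].
    move=> [_ [[z Bz <-] Wz wz]].
    have [[ _ O3z] _] := BO z Bz.
    have [phiw _] := HN3 k w (f z) Nk3 (conj Ww Lw) Wz wz O3z.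
    have Lw' := hyp_finvL H Lw.
    split => /=.
    * split => //; have [w' Ww' ww'] := Vu_sub Lx Ww.
      by rewrite -ww' (hyp_fK H).
    * by apply: leqW; exact: ltnW.
    * rewrite ubowen_weight_succ (hyp_finvK H); apply: lee_wpmul2r; first exact: ubowen_weight_ge0.
      rewrite lee_fin ler_expR.
      have := phiw Lw'; rewrite ler_norml => /andP[? ?]; lra.
    (* At time 0 [finv] does not increase the distance of [w] and [z'], which is below [r] because
       [k] is positive; later times are those of the given ball, shifted by one. *)
    * move=> z' _ [Wz' Lz'] wz'; apply/bowen_ballP => -[|i] ik.
        have := Vu_contract Lq 1 Ww Wz'; rewrite /= => /le_lt_trans; apply.
        by move/bowen_ballP: wz' => /(_ 0%N); apply; exact: leq_trans Nk.
      by rewrite !iterSr !(hyp_finvK H); move/bowen_ballP: wz' => /(_ i); exact.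
  + move=> z Bz _; exists (f z); split; [by exists z|exact: BV|exact: (hyp_fK H)].
Qed.

Local Notation meas x := (ref_measure X f Lambda phi r (Vu x)).

Lemma borel_measurable x B : Lambda x -> borel B ->
  measurable (B : set (caratheodory_type (ref_outer_measure X f Lambda phi r (Vu x)))).
Proof.
move=> Lx; apply: borel_caratheodory; exact: open_caratheodory (Vu_shrink Lx).
Qed.

Lemma phi_measurable x (D : set M) : Lambda x -> borel D -> D `<=` Lambda ->
  measurable_fun (D : set (caratheodory_type (ref_outer_measure X f Lambda phi r (Vu x)))) phi.
Proof.
move=> Lx bD DL; apply: (measurability _ (RGenOpens.measurableE R)).
move=> _ [_ [a [b ->] <-]].
(* [phi] is continuous along [Lambda] only: [U] is the largest open set whose trace on [Lambda] lies
   in the preimage. *)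
pose U := \bigcup_(O in [set O | open O /\ O `&` Lambda `<=` phi @^-1` `]a, b[]) O.
have -> : D `&` phi @^-1` `]a, b[ = D `&` U.
  apply/seteqP; split=> y; last first.
    by move=> [Dy [ O [_ OL] Oy]]; split => //; apply: OL; split => //; exact: DL.
  move=> [Dy pab]; split => //.
  have oab : open (`]a, b[%classic : set R) by exact: interval_open.
  have /nbhs_ballP[e /= e0 eab] := open_nbhs_nbhs (conj oab pab).
  have e2 : 0 < e / 2 by rewrite divr_gt0.
  have yn : nbhs y [set z | Lambda z -> `|phi z - phi y| <= e / 2].
    exact: phi_near (DL y Dy) e2.
  rewrite nbhsE in yn; have [ O [oO Oy] OL] := yn.
  exists O => //; split => // z [ Oz Lz]; apply: eab; rewrite -ball_normE/= distrC.
  apply: le_lt_trans (OL z Oz Lz) _; lra.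
apply: (borel_measurable Lx); apply: borel_setI => //; apply: borel_open.
by apply: bigcup_open => O [].
Qed.

(** On small pieces both sides agree up to a factor [expR (2 * e)]. Such errors survive countable
    sums of possibly infinite terms, and disappear as [e] tends to 0. *)
Lemma ref_measure_image x A : Lambda x -> borel A -> A `<=` Vu (f x) `&` Lambda ->
  meas (f x) A = (\int[meas x]_(y in f @^-1` A) (expR (P - phi y))%:E)%E.
Proof.
move=> Lx bA AV; have Lq := hyp_fL H Lx; set D := f @^-1` A.
have bD : borel D by exact: borel_preimage (hyp_f_cts H) bA.
have fD : f @` D = A.
  apply/seteqP; split=> [_ [y Dy <-]//|y Ay].
  by exists (finv y); rewrite /D /= (hyp_finvK H).
have DL : D `<=` Lambda.
  by move=> y /AV[_ Ly]; rewrite -(hyp_fK H y); exact: (hyp_finvL H Ly).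
pose h y := (expR (P - phi y))%:E.
have h0 y : (0 <= h y)%E by rewrite lee_fin expR_ge0.
have mh B : borel B -> B `<=` Lambda ->
    measurable_fun (B : set (caratheodory_type (ref_outer_measure X f Lambda phi r (Vu x)))) h.
  by move=> bB BL; apply: measurable_expR_sub; exact: phi_measurable.
have split_sum (e : R) : 0 < e -> exists B : nat -> set M,
    [/\ forall i, borel (B i), trivIset setT B, D = \bigcup_i B i &
     forall i, ((expR (- (2 * e)))%:E * meas (f x) (f @` B i) <= \int[meas x]_(y in B i) h y)%E /\
       ((expR (- (2 * e)))%:E * (\int[meas x]_(y in B i) h y) <= meas (f x) (f @` B i))%E].
  move=> e0.
  have lc a : exists O, D a -> nbhs a O /\ (open O /\
      forall B, B `<=` O -> B `<=` f @^-1` (Vu (f x) `&` Lambda) ->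
      [/\ forall y, B y -> `|phi y - phi a| <= e,
       (outer (Vu (f x)) (f @` B) <= (expR (P - phi a + e))%:E * outer (Vu x) B)%E &
       (outer (Vu x) B <= (expR (phi a - P + e))%:E * outer (Vu (f x)) (f @` B))%E]).
    have [Da|nDa] := pselect (D a); last by exists set0.
    have [Va _] := AV _ Da.
    have [ O aO HO] := local_comparison Lx Va (DL a Da) e0.
    exists (interior O) => _; split; first exact: nbhs_interior.
    split; first exact: open_interior.
    by move=> B BO; apply: HO; apply: subset_trans BO _; exact: interior_subset.
  have {lc}[ O HO] := choice lc.
  have [V [VO DV]] := countable_subcover (rsecond_countable X) (fun a Da => (HO a Da).1).
  have oV i : open (V i).
    by have [->|[a Da ->]] := VO i; [exact: open0|exact: (HO a Da).2.1].
  exists (fun i => D `&` seqDU V i).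
  have bB i : borel (D `&` seqDU V i).
    apply: borel_setI => //; apply: borel_setD; first exact: borel_open.
    by rewrite -bigcup_mkord; apply: borel_open; apply: bigcup_open.
  split => //.
  - by apply: trivIset_setIl; exact: trivIset_seqDU.
  - by rewrite -setI_bigcupr -seqDU_bigcup_eq; apply/esym/setIidPl.
  move=> i; set B := D `&` seqDU V i.
  have BV : B `<=` V i by move=> y [_]; exact: subset_seqDU.
  have BD : B `<=` D by move=> y [].
  have BL : B `<=` Lambda by exact: subset_trans DL.
  have [V0|[a Da Va]] := VO i.
    have -> : B = set0 by rewrite -subset0 -V0.
    by rewrite image_set0 integral_set0 measure0 !mule0.
  have [_ [_ Ha]] := HO a Da.
  have [osc up lo] := Ha B (subset_trans BV (eq_ind_r (fun W => W `<=` O a) (@subset_refl _ _) Va))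
     (subset_trans BD (fun y Dy => AV _ Dy)).
  have mB := borel_measurable Lx (bB i).
  (* The lower bound of the density on [B]; its upper bound is [k] times [expR (2 * e)]. *)
  pose k := (expR (P - phi a - e))%:E.
  have k0 : (0 <= k)%E by rewrite lee_fin expR_ge0.
  have osc' y : B y -> phi a - e <= phi y <= phi a + e.
    by move=> /osc; rewrite ler_distl.
  split.
    apply: (@le_trans _ _ (k * meas x B)%E).
      apply: le_trans (lee_wpmul2l _ up) _; first by rewrite lee_fin expR_ge0.
      rewrite muleA -EFinM -expRD; apply: lee_wpmul2r; first exact: ref_outer_ge0.
      by rewrite lee_fin ler_expR; lra.
    rewrite -integral_cst//; apply: ge0_le_integral => //; first exact: (mh _ (bB i) BL).
    move=> y /osc' /andP[? ?]; rewrite lee_fin ler_expR; lra.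
  apply: (@le_trans _ _ (k * meas x B)%E).
    apply: (@le_trans _ _ ((expR (- (2 * e)))%:E * ((expR (P - phi a + e))%:E * meas x B))%E).
      apply: lee_wpmul2l; first by rewrite lee_fin expR_ge0.
      rewrite -integral_cst//; apply: ge0_le_integral => //; first exact: (mh _ (bB i) BL).
      move=> y /osc' /andP[? ?]; rewrite lee_fin ler_expR; lra.
    rewrite muleA -EFinM -expRD; apply: lee_wpmul2r; first exact: ref_outer_ge0.
    by rewrite lee_fin ler_expR; lra.
  apply: le_trans (lee_wpmul2l k0 lo) _.
  rewrite muleA -EFinM -expRD -[leRHS]mul1e; apply: lee_wpmul2r; first exact: ref_outer_ge0.
  by rewrite lee_fin -expR0 ler_expR; lra.
have int_ge0 B : (0 <= \int[meas x]_(y in B) h y)%E by apply: integral_ge0 => y _.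
have sums (e : R) : 0 < e ->
    ((expR (- (2 * e)))%:E * meas (f x) A <= \int[meas x]_(y in D) h y)%E /\
    ((expR (- (2 * e)))%:E * (\int[meas x]_(y in D) h y) <= meas (f x) A)%E.
  move=> /split_sum[B [bB tB DB HB]].
  have bfB i : borel (f @` B i).
    rewrite (_ : f @` B i = finv @^-1` B i); first exact: borel_preimage (hyp_finv_cts H) (bB i).
    apply/seteqP; split=> [_ [y By <-]|y By]; first by rewrite /= (hyp_fK H).
    by exists (finv y) => //; rewrite (hyp_finvK H).
  have tfB : trivIset setT (fun i => f @` B i).
    move=> i j _ _ [_ [[y By <-] [z Bz /(can_inj (hyp_fK H)) zy]]].
    by apply: tB => //; exists y; split => //; rewrite -zy.
  have ES : meas (f x) A = (\sum_(i <oo) meas (f x) (f @` B i))%E.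
    rewrite -fD DB image_bigcup measure_semi_bigcup//.
    + by move=> i; exact: borel_measurable.
    + by apply: bigcupT_measurable => i; exact: borel_measurable.
  have EI : (\int[meas x]_(y in D) h y = \sum_(i <oo) \int[meas x]_(y in B i) h y)%E.
    rewrite DB ge0_integral_bigcup//.
    + by move=> i; exact: borel_measurable.
    + by rewrite -DB; exact: mh.
  rewrite ES EI -!nneseriesZl//.
  split; apply: lee_nneseries => [i _ _|i _].
  - by rewrite mule_ge0// lee_fin expR_ge0.
  - exact: (HB i).1.
  - by rewrite mule_ge0// lee_fin expR_ge0.
  - exact: (HB i).2.
(* Every factor between 0 and 1 has the form [expR (- (2 * e))], and an inequality that holds up to
   all such factors holds. *)
have tE (t : R) : 0 < t < 1 -> exists2 e : R, 0 < e & expR (- (2 * e)) = t.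
  move=> /andP[t0 t1]; exists (- ln t / 2).
    by rewrite divr_gt0// oppr_gt0 ln_lt0// t0 t1.
  by rewrite (_ : - (2 * (- ln t / 2)) = ln t) ?lnK ?posrE//; field.
apply/eqP; rewrite eq_le; apply/andP; split; apply/lee_mul01Pr => //.
- by move=> t /tE[e /sums[+ _] <-].
- by move=> t /tE[e /sums[_ +] <-].
Qed.

End LocalComparison.

Theorem theorem4p8 (R : realType) (n : nat) (M : ptopologicalType)
    (X : riemannian R n M) (alpha : R) (f finv : M -> M) (Lambda : set M)
    (Es Eu : M -> 'M[R]_n) (chi : R) :
  0 < alpha <= 1 ->
  C1holder_diffeo X alpha f finv ->
  hyperbolic_set X f finv Lambda Es Eu 1 chi ->
  locally_maximal f finv Lambda ->
  topologically_transitive f Lambda ->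
  forall L : R, exists2 tau0 : R, 0 < tau0 &
  forall (tau lambda : R) (Vs Vu : M -> set M),
  0 < tau < tau0 -> chi < lambda < 1 ->
  local_manifolds X f finv Lambda Es Eu alpha tau L lambda Vs Vu ->
  forall (phi : M -> R) (r : R),
  holder_on X Lambda phi ->
  0 < r < tau / 3 ->
  let m := fun x : M => ref_measure X f Lambda phi r (Vu x) in
  let P : R := fine (pressure X f Lambda phi) in
  forall x : M, Lambda x ->
    (forall B : set M, borel B -> B `<=` f @^-1` (Vu (f x) `&` Lambda) ->
       m x B = 0%E -> m (f x) (f @` B) = 0%E) /\
    (forall A : set M, borel A -> A `<=` Vu (f x) `&` Lambda ->
       m (f x) A = (\int[m x]_(y in f @^-1` A) (expR (P - phi y))%:E)%E).
Proof.
move=> /andP[al0 _] Hd Hh _ _ L.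
have H := hyperbolic_setP al0 Hd Hh.
have [r0 r00 Hr0] := uniform_shrinking H.
have [t0 t00 Ht0] := unstable_open H L al0.
(* [tau < 3 * r0] and [r < tau / 3] put [r] below the radius [r0] of uniform shrinking. *)
exists (Num.min t0 (3 * r0)); first by rewrite lt_min t00 mulr_gt0.
move=> tau lambda Vs Vu /andP[tau_gt0]; rewrite lt_min => /andP[taut taur].
move=> /andP[chil lam1] Hloc phi r Hphi /andP[r_gt0 rtau] m P x Lx.
have l01 : 0 <= lambda <= 1.
  have /andP[chi0 _] := hyp_chi H.
  by rewrite (ltW lam1) (ltW (lt_trans chi0 chil)).
have Vsub y : Lambda y -> Vu (f y) `<=` f @` Vu y by move=> /Hloc[].
have Vcon := unstable_contract H l01 Hloc.
have tau0t : 0 < tau < t0 by rewrite tau_gt0.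
have Vopen := Ht0 tau lambda Vs Vu tau0t l01 Hloc.
have Vshrink y : Lambda y -> forall e : R, 0 < e -> exists N, forall k u v,
    (N <= k)%N -> (Vu y `&` Lambda) u -> (Vu y `&` Lambda) v -> bowen_ball X f k u r v ->
    (rdist X u v < e%:E)%E /\ (rdist X v u < e%:E)%E.
  move=> Ly e e0; have rr0 : 0 < r <= r0 by rewrite r_gt0 /=; lra.
  have [N HN] := Hr0 r (Vu y) rr0 (Vcon y Ly) e e0.
  exists N => k u v Nk [Vu_u Lu] [Vu_v Lv] /(bowen_ballP X r_gt0) uv.
  exact: HN Nk Lu Lv Vu_u Vu_v uv.
have image A : borel A -> A `<=` Vu (f x) `&` Lambda ->
    m (f x) A = (\int[m x]_(y in f @^-1` A) (expR (P - phi y))%:E)%E.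
  exact: (ref_measure_image H Hphi r_gt0 Vsub Vcon Vopen Vshrink Lx).
split => // B bB BV B0.
(* The image is thus Borel, and the integral formula reduces absolute continuity to an integral over
   a null set. *)
have fB : f @` B = finv @^-1` B.
  apply/seteqP; split=> [_ [y By <-]|y By]; first by rewrite /= (hyp_fK H).
  by exists (finv y) => //; rewrite (hyp_finvK H).
have fBK : f @^-1` (f @` B) = B.
  apply/seteqP; split=> y; last by exists y.
  by move=> [z Bz /(can_inj (hyp_fK H)) <-].
rewrite image.
- have BL : B `<=` Lambda.
    by move=> y /BV[_ Ly]; rewrite -(hyp_fK H y); exact: (hyp_finvL H Ly).
  rewrite fBK; apply: null_set_integral; last exact: B0.
    exact: (borel_measurable phi Vshrink Lx bB).
  apply: measurable_expR_sub; exact: (phi_measurable Hphi Vshrink Lx bB BL).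
- by rewrite fB; exact: borel_preimage (hyp_finv_cts H) bB.
- by move=> _ [y /BV + <-].
Qed.
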